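(* Let $\Omega\subset\mathbb R$ be open and bounded with Lipschitz boundary. Let $H\in C(\Omega\times\mathbb R\times\mathbb R\times\mathbb R)$ be bounded below and level-convex in its final argument, namely for all $(x,\eta,p)\in\Omega\times\mathbb R\times\mathbb R$ and all $t\in\mathbb R$ the set $\{X\in\mathbb R: H(x,\eta,p,X)\le t\}$ is convex. Suppose further that: (i) there exist $C_1,C_2>0$ and $0\le s,t<1$ such that $H(x,\eta,p,X)\ge C_1|X|-C_2(1+|\eta|^s+|p|^t)$ for a.e. $x\in\Omega$ and all $(\eta,p,X)\in\mathbb R\times\mathbb R\times\mathbb R$; (ii) for any $R>0$ there exist $\ell=\ell(R)>1$ and an increasing modulus of continuity $\omega_R\in C[0,\infty)$ with $\omega_R(0)=0$ such that $$\big|H(x,\eta',p',X)-H(x,\eta'',p'',X)\big|\le\omega_R\big(|\eta'-\eta''|+|p'-p''|\big)(1+|X|^\ell)$$ for a.e. $x\in\Omega$, any $\eta',\eta'',p',p''\in(-R,R)$, and any $X\in\mathbb R$. Then, for any $g\in W^{2,\infty}(\Omega)$, there exists a global minimiser $u_\infty\in W^{2,\infty}_g(\Omega)$ of $E_\infty$ on $\Omega$ which, for any fixed $q\in(1,\infty)$, is the subsequential weak $W^{2,q}(\Omega)$-limit as $p\to\infty$ of approximate minimisers of the functionals $\{E_p:p\in(1,\infty)\}$, and which is moreover an absolute minimiser of $E_\infty$ on $\Omega$, i.e. $$E_\infty(u_\infty,\Omega')\le E_\infty(u_\infty+\varphi,\Omega')\qquad\text{for all open }\Omega'\Subset\Omega\text{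 and all }\varphi\in W^{2,\infty}_0(\Omega').$$
   Context: For an open set $U$, $W^{2,\infty}_0(U)$ denotes the functions of $W^{2,\infty}(U)$ that vanish together with their derivative on $\partial U$ (i.e. $W^{2,\infty}(U)\cap W^{2,1}_0(U)$), and $W^{2,\infty}_g(\Omega):=g+W^{2,\infty}_0(\Omega)$. $\Omega'\Subset\Omega$ means that $\overline{\Omega'}$ is a compact subset of $\Omega$. The supremal functional is $$E_\infty(u,\mathcal O):=\operatorname*{ess\,sup}_{x\in\mathcal O}H\big(x,u(x),u'(x),u''(x)\big),\qquad u\in W^{2,\infty}(\Omega),\ \mathcal O\subseteq\Omega\text{ measurable}.$$ A function $u\in W^{2,\infty}_g(\Omega)$ is a global minimiser of $E_\infty$ on $\Omega$ if $E_\infty(u,\Omega)\le E_\infty(u+\varphi,\Omega)$ for all $\varphi\in W^{2,\infty}_0(\Omega)$. Since $H$ is bounded below, $H\ge -m$ for some $m>0$; fix any $M>m$. For $p\in(1,\infty)$, $$E_p(u,\mathcal O):=\Big(\frac1{|\mathcal O|}\int_{\mathcal O}\big(M+H(x,u(x),u'(x),u''(x))\big)^p\,dx\Big)^{1/p}-M .$$ An approximate minimiser of $E_p$ (for the boundary data $g$) is a function $u_p\in W^{2,\infty}_g(\Omega)$ with $E_p(u_p,\Omega)\le 2^{-p}+\inf\{E_p(v,\Omega): v\in W^{2,\infty}_g(\Omega)\}$.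
   Formalization: The formal theorem additionally assumes that E_∞(v,Ω) is finite (< +∞) for some v in W^{2,∞}_g(Ω); without this the claim can fail, e.g. Ω=(0,1), g=0, H=|X|+|X−1/x|/x has no absolute minimiser. *)

(* Defs.v *)
From HB Require Import structures.
From mathcomp Require Export all_boot all_order all_algebra.
From mathcomp Require Export all_classical all_reals all_analysis ess_sup_inf.
Export Order.TTheory GRing.Theory Num.Theory.
Export numFieldNormedType.Exports.

Set Implicit Arguments.
Unset Strict Implicit.
Unset Printing Implicit Defensive.

Local Open Scope classical_set_scope.
Local Open Scope ring_scope.

(* In R^1 the Lipschitz graph over R^0 is a single point c, and the choice of
   local coordinates is the choice of the side of c on which Om lies. *)
Definition lipschitz_boundary (R : realType) (Om : set R) : Prop :=
  forall x, (closure Om `\` Om°) x ->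
  exists r c : R, 0 < r /\
    ((forall y, ball x r y -> (Om y <-> c < y)) \/
     (forall y, ball x r y -> (Om y <-> y < c))).

Definition compactly_contained (R : realType) (U V : set R) : Prop :=
  compact (closure U) /\ closure U `<=` V.

(** ** Sobolev spaces on an open set U of the line

   Functions are total maps [R -> R] of which only the restriction to U is
   relevant, up to almost-everywhere equality. *)

Definition test_function (R : realType) (U : set R) (phi : R -> R) : Prop :=
  [/\ forall n x, derivable (derive1n n phi) x 1,
      compact (closure [set x | phi x != 0]) &
      closure [set x | phi x != 0] `<=` U].

Definition is_weak_derivative (R : realType) (j : nat) (U : set R)
    (u v : R -> R) : Prop :=
  [/\ locally_integrable U u, locally_integrable U v &
      forall phi, test_function U phi ->
        (\int[lebesgue_measure]_(x in U) (u x * derive1n j phi x) =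
         (-1) ^+ j * \int[lebesgue_measure]_(x in U) (v x * phi x))%R].

(* A representative of the j-th weak derivative; it is unspecified when there
   is no such derivative, and otherwise determined almost everywhere on U. *)
Definition wderiv (R : realType) (j : nat) (U : set R) (u : R -> R) : R -> R :=
  xget (fun=> 0) [set v | is_weak_derivative j U u v].

Definition Lnorm_on (R : realType) (q : \bar R) (U : set R) (f : R -> R) :
    \bar R :=
  ('N[lebesgue_measure]_q[EFin \o (f \_ U)])%E.

Definition sobolev (R : realType) (k : nat) (q : \bar R) (U : set R)
    (u : R -> R) : Prop :=
  forall j, (j <= k)%N ->
  exists2 v, is_weak_derivative j U u v & (Lnorm_on q U v < +oo)%E.

Definition sobolev_norm (R : realType) (k : nat) (q : \bar R) (U : set R)
    (u : R -> R) : \bar R :=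
  (\sum_(j < k.+1) Lnorm_on q U (wderiv j U u))%E.

Definition sobolev0 (R : realType) (k : nat) (q : \bar R) (U : set R)
    (u : R -> R) : Prop :=
  sobolev k q U u /\
  exists phi_ : nat -> R -> R,
    (forall n, test_function U (phi_ n)) /\
    sobolev_norm k q U (u \- phi_ n) @[n --> \oo] --> 0%E.

Definition W2oo (R : realType) (U : set R) (u : R -> R) : Prop :=
  sobolev 2 +oo%E U u.

Definition W2oo0 (R : realType) (U : set R) (u : R -> R) : Prop :=
  W2oo U u /\ sobolev0 2 1%E U u.

Definition W2oo_bd (R : realType) (U : set R) (g u : R -> R) : Prop :=
  W2oo0 U (u \- g).

(* Convergence against every bounded linear functional of W^{k,q}(U); the bound
   makes F compatible with almost-everywhere equality on U. *)
Definition sobolev_weak_cvg (R : realType) (k : nat) (q : \bar R) (U : set R)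
    (u_ : nat -> R -> R) (u : R -> R) : Prop :=
  [/\ forall n, sobolev k q U (u_ n), sobolev k q U u &
      forall F : (R -> R) -> R,
        (forall (a : R) f h, sobolev k q U f -> sobolev k q U h ->
           F (fun x => a * f x + h x) = a * F f + F h) ->
        (exists C : R, forall f, sobolev k q U f ->
           (`|F f|%:E <= C%:E * sobolev_norm k q U f)%E) ->
        F (u_ n) @[n --> \oo] --> F u].

(** ** The functionals

   [u] is a Sobolev function on [Om], and the functionals are evaluated on a
   measurable subset [O] of [Om]. *)

Definition Hjet (R : realType) (Om : set R) (H : R -> R -> R -> R -> R)
    (u : R -> R) (x : R) : R :=
  H x (u x) (wderiv 1 Om u x) (wderiv 2 Om u x).

(* The value -oo outside O makes this the essential supremum over O. *)
Definition E_oo (R : realType) (Om : set R) (H : R -> R -> R -> R -> R)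
    (u : R -> R) (O : set R) : \bar R :=
  ess_sup lebesgue_measure
    (patch (fun=> -oo%E) O (fun x => (Hjet Om H u x)%:E)).

Definition E_p (R : realType) (Om : set R) (H : R -> R -> R -> R -> R)
    (M p : R) (u : R -> R) (O : set R) : \bar R :=
  (((fine (lebesgue_measure O))^-1%:E *
    \int[lebesgue_measure]_(x in O) ((M + Hjet Om H u x) `^ p)%:E) `^ p^-1
   - M%:E)%E.

Definition approximate_minimiser (R : realType) (Om : set R)
    (H : R -> R -> R -> R -> R) (M : R) (g : R -> R) (p : R) (u : R -> R) :
    Prop :=
  W2oo_bd Om g u /\
  (E_p Om H M p u Om <=
   (2 `^ (- p))%:E +
   ereal_inf [set E_p Om H M p v Om | v in [set v | W2oo_bd Om g v]])%E.

Definition global_minimiser (R : realType) (Om : set R)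
    (H : R -> R -> R -> R -> R) (g u : R -> R) : Prop :=
  W2oo_bd Om g u /\
  forall phi, W2oo0 Om phi ->
    (E_oo Om H u Om <= E_oo Om H (u \+ phi)%R Om)%E.

(* A function of W^{2,oo}_0(Om') is extended by zero to Om. *)
Definition absolute_minimiser (R : realType) (Om : set R)
    (H : R -> R -> R -> R -> R) (u : R -> R) : Prop :=
  forall Om', open Om' -> compactly_contained Om' Om ->
  forall phi, W2oo0 Om' phi ->
    (E_oo Om H u Om' <= E_oo Om H (u \+ (phi \_ Om'))%R Om')%E.

(* Main.v *)
(* Every competitor is written as g plus the second primitive (vanishing near -oo) of a
   bounded z that is an L^1-limit of second derivatives of test functions. For each p let z_p
   minimise the integral of (M + H)^p over Om up to the error |Om| 2^(-p^2); this is smaller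
   than approximate minimality requires (its p-th root is 2^(-p)), and it remains negligible
   after taking p-th roots on subdomains. The coercivity of H with sublinear lower-order terms
   bounds the z_p in every L^r, so along a subsequence u_p and u_p' converge uniformly (Ascoli)
   and convex combinations of tails of the z_p converge in L^1 and almost everywhere to a limit
   z. If the p-energies of u_p on a set O are asymptotically at most those of the constant c,
   then Chebyshev, Borel-Cantelli and the convexity of the sublevel sets of H in its last
   argument give M + H <= c a.e. on O for the limit. On O = Om this applies by comparison with a
   competitor. On a component ]a, b[ of Om' the competitor is first transplanted into u_p: the
   mismatch of values and derivatives at a and b tends to zero and is corrected by small bumps.
   Finally a bounded functional staying away from its limit value along a subsequence would do
   so on convex combinations of that subsequence, which however converge strongly. *)

Require Import Defs.
From mathcomp Require Import measurable_realfun ring lra.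

Set Implicit Arguments.
Unset Strict Implicit.
Unset Printing Implicit Defensive.

Local Open Scope classical_set_scope.
Local Open Scope ring_scope.

(** * Smooth plateau functions *)

(** Level-convexity does not make the p-energies weakly lower semicontinuous: almost minimisers must
    replace minimisers, and what passes to the limit is not an energy but the measure of a
    superlevel set. On the line u and u' converge uniformly, so the lower-order arguments can be
    frozen at a point and only convexity in the last one is needed there. Convex combinations are
    restricted to iterated midpoints, which suffice for the parallelogram law and for sublevel sets.
    Energies are kept as plain integrals, without root or mean, because these are additive:
    contributions outside an interval then cancel. The error has to be smaller than every
    exponential since it is compared with c^p, where c may lie below 1. Limits of convex
    combinations from different subsequences agree because their primitives are the same uniform
    limit; for this reason one sequence of exponents serves every q. *)

Section Smooth.
Variable R : realType.
Implicit Types (f g : R -> R) (x a b c : R).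

Definition smooth f := forall n x, derivable (derive1n n f) x 1.

Lemma is_derive_derive1 f f' : (forall x, is_derive x 1 f (f' x)) -> (derive1 f) = f'.
Proof. by move=> ff'; apply/funext => x; rewrite derive1E; exact: derive_val. Qed.

(** Coinduction principle: with a class of functions closed under differentiation, no formula for
    the n-th derivative is needed. *)
Lemma smooth_coind (P : (R -> R) -> Prop) :
  (forall f, P f -> exists2 f', P f' & forall x, is_derive x 1 f (f' x)) ->
  forall f, P f -> smooth f.
Proof.
move=> Pd f Pf n; elim: n f Pf => [|n IHn] f /Pd[f' Pf' ff'] x.
  by have := ff' x => /@ex_derive.
by rewrite derive1Sn (is_derive_derive1 ff'); exact: IHn.
Qed.

Lemma smooth_is_derive f : smooth f -> forall x, is_derive x 1 f ((derive1 f) x).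
Proof. by move=> sf x; rewrite derive1E; apply: DeriveDef => //; exact: (sf 0%N). Qed.

Lemma smooth_derive1 f : smooth f -> smooth (derive1 f).
Proof. by move=> sf n x; rewrite -derive1Sn; exact: sf. Qed.

Lemma smooth_prim f f' : (forall x, is_derive x 1 f (f' x)) -> smooth f' -> smooth f.
Proof.
move=> ff' sf' [|n] x; first by have := ff' x => /@ex_derive.
by rewrite derive1Sn (is_derive_derive1 ff'); exact: sf'.
Qed.

Lemma smooth_cst c : smooth (fun=> c).
Proof.
apply: (@smooth_coind (fun f => exists c, f = fun=> c)); last by exists c.
by move=> _ [d ->]; exists (fun=> 0); [exists 0 | move=> x; exact: is_derive_cst].
Qed.

Lemma is_derive_lin c (u v : R -> R) x (du dv : R) : is_derive x 1 u du -> is_derive x 1 v dv ->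
  is_derive x 1 (fun y => c * u y + v y : R) (c * du + dv).
Proof.
move=> hu hv; pose cu := (fun y => c * u y) : R -> R.
have h1 : is_derive x 1 cu (c * du) by exact: (is_deriveZ c hu).
by have h2 := is_deriveD h1 hv; exact: h2.
Qed.

Lemma smooth_lin c f g : smooth f -> smooth g -> smooth (fun x => c * f x + g x).
Proof.
move=> sf sg.
apply: (@smooth_coind (fun h => exists u v, [/\ smooth u, smooth v & h = fun x => c * u x + v x])); last by exists f, g.
move=> _ [u [v [su sv ->]]].
exists (fun x => c * (derive1 u) x + (derive1 v) x).
  by exists (derive1 u), (derive1 v); split; [exact: smooth_derive1..|].
by move=> x; apply: is_derive_lin; exact: smooth_is_derive.
Qed.

Lemma smoothZ c f : smooth f -> smooth (fun x => c * f x).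
Proof.
move=> sf; rewrite (_ : (fun _ => _) = fun x => c * f x + 0).
  exact/smooth_lin/smooth_cst.
by apply/funext => x; rewrite addr0.
Qed.

Lemma smooth_sub f g : smooth f -> smooth g -> smooth (fun x => f x - g x).
Proof.
move=> sf sg; rewrite (_ : (fun _ => _) = fun x => -1 * g x + f x).
  exact: smooth_lin.
by apply/funext => x; rewrite mulN1r addrC.
Qed.

Lemma smooth_mul f g : smooth f -> smooth g -> smooth (fun x => f x * g x).
Proof.
move=> sf sg.
(* A single product is not stable under differentiation, but finite sums of products are, by
   Leibniz' rule. *)
pose ev (s : seq ((R -> R) * (R -> R))) x := \sum_(p <- s) p.1 x * p.2 x.
pose ok s := forall p, List.In p s -> smooth (p.1 : R -> R) /\ smooth (p.2 : R -> R).
apply: (@smooth_coind (fun h => exists2 s, ok s & h = ev s)); last first.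
  exists [:: (f, g)]; first by move=> p [<- /=|[]]; split.
  by apply/funext => x; rewrite /ev big_seq1.
move=> _ [s + ->]; elim: s => [|[u v] s IHs] oks.
  exists (fun=> 0); first by exists [::] => //; apply/funext => x; rewrite /ev big_nil.
  move=> x; rewrite (_ : ev [::] = fun=> 0); first exact: is_derive_cst.
  by apply/funext => y; rewrite /ev big_nil.
have [su sv] : smooth u /\ smooth v by apply: (oks (u, v)); left.
have /IHs[e' [s' oks' ->] es'] : ok s by move=> p ps; apply: oks; right.
exists (fun x => u x * (derive1 v) x + v x * (derive1 u) x + ev s' x).
  exists [:: (u, (derive1 v)), (v, (derive1 u)) & s'].
    move=> p [<-|[<-|]]; last exact: oks'.
    - split; [exact: su|exact: smooth_derive1].
    - split; [exact: sv|exact: smooth_derive1].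
  by apply/funext => x; rewrite /ev !big_cons/= addrA.
move=> x.
rewrite (_ : ev _ = u * v + ev s); last first.
  by apply/funext => y; rewrite /ev big_cons.
have h : is_derive x 1 (u * v) (u x * derive1 v x + v x * derive1 u x).
  exact: (is_deriveM (smooth_is_derive su x) (smooth_is_derive sv x)).
by have h2 := is_deriveD h (es' x); exact: h2.
Qed.

Lemma smooth_exp f n : smooth f -> smooth (fun x => f x ^+ n).
Proof.
move=> sf; elim: n => [|n IHn]; first by under eq_fun do rewrite expr0; exact: smooth_cst.
by under eq_fun do rewrite exprS; exact: smooth_mul.
Qed.

Lemma is_derive_affine f (f' c d x : R) : is_derive (c * x + d) 1 f f' ->
  is_derive x 1 (fun y => f (c * y + d)) (c * f').
Proof.
move=> ff'.
have h : is_derive x 1 (fun y => c * y + d) (c * 1 + 0).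
  exact: (is_derive_lin c (is_derive_id x 1) (is_derive_cst d x 1)).
rewrite (_ : c * f' = f' * (c * 1 + 0)); last by rewrite addr0 mulr1 mulrC.
exact: (@is_derive1_comp _ f (fun y => c * y + d)).
Qed.

Lemma smooth_affine f c d : smooth f -> smooth (fun x => f (c * x + d)).
Proof.
move=> sf.
apply: (@smooth_coind (fun h => exists k u, smooth u /\ h = fun x => k * u (c * x + d))); last first.
  by exists 1, f; split => //; under [RHS]eq_fun do rewrite mul1r.
move=> _ [k [u [su ->]]].
exists (fun x => (k * c) * (derive1 u) (c * x + d)).
  by exists (k * c), (derive1 u); split; [exact: smooth_derive1|].
move=> x; rewrite -mulrA.
exact: (is_deriveZ k (is_derive_affine (smooth_is_derive su (c * x + d)))).
Qed.

Lemma smooth_continuous f : smooth f -> continuous f.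
Proof.
move=> sf x; apply/differentiable_continuous/derivable1_diffP; exact: (sf 0%N).
Qed.

(* [flat k x = x^-k exp (- 1/x)] for [x > 0]; the linear span of these
   functions is stable under derivation. *)
Definition flat k x : R := if 0 < x then x^-1 ^+ k * expR (- x^-1) else 0.

(** The exponential at 1/x dominates the term of degree k + 1 of its series; the spare power of x
    yields the limit at 0. *)
Lemma flat_le k x : 0 < x -> flat k x <= (k.+1)`!%:R * x.
Proof.
move=> x0; rewrite /flat x0 expRN.
have y0 : 0 < x^-1 by rewrite invr_gt0.
have := @expR_ge1Dxn _ _ k (ltW y0).
rewrite ler_pdivrMr ?expR_gt0// => h.
have {h} : x^-1 ^+ k.+1 / k.+1`!%:R <= expR x^-1.
  by apply: le_trans h; rewrite lerDr.
rewrite ler_pdivrMr ?ltr0n ?fact_gt0// => h.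
rewrite mulrAC [_ * expR _]mulrC -ler_pdivrMr//.
by rewrite -exprSr.
Qed.

Lemma flat_ge0 k x : 0 <= flat k x.
Proof.
rewrite /flat; case: ifPn => // x0.
by rewrite mulr_ge0 ?expR_ge0 ?exprn_ge0// invr_ge0 ltW.
Qed.

Lemma is_derive_flat k x :
  is_derive x 1 (flat k) (- k%:R * flat k.+1 x + flat k.+2 x).
Proof.
have [x0|x0|->] := ltrgtP x 0.
- rewrite /flat !(lt_gtF x0) mulr0 addr0.
  have h : {near x, (fun=> 0) =1 flat k}.
    near=> y; rewrite /flat; case: ifPn => // y0.
    suff : y < 0 by move=> /lt_gtF; rewrite y0.
    by near: y; exact: lt_nbhsl.
  split; first exact: (near_eq_derivable h (@derivable_cst _ _ _ 0 x 1)).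
  by rewrite -(near_eq_derive _ h) derive_cst.
- have xN0 : x != 0 by rewrite gt_eqF.
  have h : {near x, (fun y => y^-1 ^+ k * expR (- y^-1)) =1 flat k}.
    near=> y; rewrite /flat; case: ifPn => // /negP[].
    by near: y; exact: lt_nbhsr.
  have hi : is_derive x 1 (@GRing.inv R) (- x ^- 2).
    have := @is_deriveV R (fun y => y) x 1 1 xN0 (is_derive_id x 1).
    by rewrite /GRing.scale/= mulr1.
  have hN : is_derive x 1 (fun y => - y^-1) (x ^- 2).
    by have := is_deriveN hi; rewrite opprK.
  have he : is_derive x 1 (fun y => expR (- y^-1)) (expR (- x^-1) * x ^- 2).
    by exact: (is_derive1_comp (is_derive_expR _) hN).
  have hk : is_derive x 1 (fun y => y^-1 ^+ k) ((k%:R * x^-1 ^+ k.-1) * (- x ^- 2)).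
    by have h1 := is_deriveX k hi; rewrite exprfctE in h1; exact: h1.
  have hm := is_deriveM hk he.
  have hm' : is_derive x 1 (fun y => y^-1 ^+ k * expR (- y^-1))
     (- k%:R * flat k.+1 x + flat k.+2 x).
    apply: (is_derive_eq hm); rewrite /flat x0 /GRing.scale/= -exprVn.
    case: k {h hk hm} => [|k]; first by rewrite /= !mul0r !expr0 oppr0 !mul0r mulr0 addr0 add0r; ring.
    by rewrite succnK; move: (x^-1) (expR _) (k.+1%:R) => y z w; rewrite !exprS; ring.
  split; first exact: (near_eq_derivable h (@ex_derive _ _ _ _ _ _ _ hm')).
  by rewrite -(near_eq_derive _ h); exact: derive_val.
- rewrite {2 3}/flat ltxx mulr0 addr0.
  have hc : h^-1 *: (flat k (h *: 1 + 0) - flat k 0) @[h --> 0^'] --> (0 : R).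
    apply/cvgrPdist_le => e e0; near=> h.
    rewrite addr0 sub0r normrN [flat k 0]/flat ltxx subr0 /GRing.scale/= mulr1.
    have [h0|h0] := ltP 0 h; last by rewrite /flat ltNge h0/= mulr0 normr0 ltW.
    (* Dividing by h only raises the index, so the difference quotient is again at most a multiple
       of h. *)
    have -> : h^-1 * flat k h = flat k.+1 h by rewrite /flat h0 exprS mulrA.
    rewrite ger0_norm ?flat_ge0// (le_trans (flat_le _ h0))// -ler_pdivlMl ?ltr0n ?fact_gt0//.
    rewrite -[h]gtr0_norm//; near: h; apply: dnbhs0_le.
    by rewrite mulr_gt0 ?invr_gt0 ?ltr0n ?fact_gt0.
  have hd : derivable (flat k) 0 1 by apply/cvg_ex; exists 0.
  by split => //; apply/cvg_lim.
Unshelve. all: by end_near. Qed.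

Lemma smooth_flat k : smooth (flat k).
Proof.
pose ev (s : seq (R * nat)) x := \sum_(p <- s) p.1 * flat p.2 x.
apply: (@smooth_coind (fun h => exists s, h = ev s)); last first.
  by exists [:: (1, k)]; apply/funext => x; rewrite /ev big_seq1 mul1r.
move=> _ [s ->]; elim: s => [|[c n] s [_ [s' ->] es']].
  exists (fun=> 0); first by exists [::]; apply/funext => x; rewrite /ev big_nil.
  move=> x; rewrite (_ : ev [::] = fun=> 0); first exact: is_derive_cst.
  by apply/funext => y; rewrite /ev big_nil.
exists (fun x => c * (- n%:R * flat n.+1 x + flat n.+2 x) + ev s' x).
  exists [:: (- c * n%:R, n.+1), (c, n.+2) & s'].
  by apply/funext => x; rewrite /ev !big_cons/=; ring.
move=> x; rewrite (_ : ev _ = fun x => c * flat n x + ev s x); last first.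
  by apply/funext => y; rewrite /ev big_cons.
exact: (is_derive_lin c (is_derive_flat n x) (es' x)).
Qed.

Definition bump a b x := flat 0 (x - a) * flat 0 (b - x).

Lemma smooth_bump a b : smooth (bump a b).
Proof.
apply: smooth_mul.
  rewrite (_ : (fun _ => _) = fun x => flat 0 (1 * x + - a)).
    exact/smooth_affine/smooth_flat.
  by apply/funext => x; rewrite mul1r.
rewrite (_ : (fun _ => _) = fun x => flat 0 (-1 * x + b)).
  exact/smooth_affine/smooth_flat.
by apply/funext => x; rewrite mulN1r addrC.
Qed.

Lemma flat0_le1 x : flat 0 x <= 1.
Proof.
by rewrite /flat; case: ifPn => // x0; rewrite expr0 mul1r expR_le1 oppr_le0 invr_ge0 ltW.
Qed.

Lemma flat0_gt0 x : (0 < flat 0 x) = (0 < x).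
Proof. by rewrite /flat; case: ifPn => x0; rewrite ?ltxx// expr0 mul1r expR_gt0. Qed.

Lemma bump_ge0 a b x : 0 <= bump a b x.
Proof. by rewrite mulr_ge0 ?flat_ge0. Qed.

Lemma bump_le1 a b x : bump a b x <= 1.
Proof. by rewrite mulr_ile1 ?flat_ge0 ?flat0_le1. Qed.

Lemma bump_gt0 a b x : a < x < b -> 0 < bump a b x.
Proof. by move=> /andP[ax xb]; rewrite mulr_gt0 ?flat0_gt0 ?subr_gt0. Qed.

Lemma bump_eq0 a b x : ~~ (a < x < b) -> bump a b x = 0.
Proof.
rewrite /bump /flat !subr_gt0 negb_and => /orP[] /negbTE ->; first by rewrite mul0r.
by rewrite mulr0.
Qed.

(** Since 0 < [bump] <= 1 inside []a, b[], these increase with n to the indicator of the interval: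
    smooth cut-offs without convolution. *)
Definition plateau a b n x := 1 - (1 - bump a b x) ^+ n.

Lemma smooth_plateau a b n : smooth (plateau a b n).
Proof.
apply: smooth_sub; first exact: smooth_cst.
by apply: smooth_exp; apply: smooth_sub; [exact: smooth_cst|exact: smooth_bump].
Qed.

Lemma plateau_ge0 a b n x : 0 <= plateau a b n x.
Proof.
by rewrite subr_ge0 exprn_ile1// ?subr_ge0 ?bump_le1// gerBl bump_ge0.
Qed.

Lemma plateau_le1 a b n x : plateau a b n x <= 1.
Proof. by rewrite gerBl exprn_ge0// subr_ge0 bump_le1. Qed.

Lemma plateau_eq0 a b n x : ~~ (a < x < b) -> plateau a b n x = 0.
Proof. by move=> /bump_eq0 xab; rewrite /plateau xab subr0 expr1n subrr. Qed.

Lemma plateau_cvg a b x : plateau a b n x @[n --> \oo] --> (\1_`]a, b[ x : R).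
Proof.
rewrite indicE; have [xab|xab] := boolP (a < x < b).
  rewrite mem_set ?in_itv//=.
  rewrite -[X in _ --> X]subr0; apply: cvgB; first exact: cvg_cst.
  apply: cvg_expr; rewrite ger0_norm ?subr_ge0 ?bump_le1//.
  by rewrite ltrBlDr ltrDl bump_gt0.
rewrite memNset /= ?in_itv/=; last exact/negP.
rewrite (_ : (fun _ => _) = fun=> 0); first exact: cvg_cst.
by apply/funext => n; exact: plateau_eq0.
Qed.

End Smooth.

(** * Integrable functions and their primitives *)

Section Integrals.
Variable R : realType.
Implicit Types (f g h : R -> R) (x y a b c C L e : R) (A : set R).
Local Notation mu := (@lebesgue_measure R).

Lemma aeS (P Q : R -> Prop) : {ae mu, forall x, P x} -> (forall x, P x -> Q x) ->
  {ae mu, forall x, Q x}.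
Proof. by move=> aeP PQ; apply: (@filterS _ _ (ae_filter_ringOfSetsType mu) _ _ _ aeP). Qed.

Lemma aeS2 (P Q S : R -> Prop) : {ae mu, forall x, P x} -> {ae mu, forall x, Q x} ->
  (forall x, P x -> Q x -> S x) -> {ae mu, forall x, S x}.
Proof.
by move=> aeP aeQ PQ; apply: (@filterS2 _ _ (ae_filter_ringOfSetsType mu) _ _ _ _ aeP aeQ).
Qed.

Lemma aeW (P : R -> Prop) : (forall x, P x) -> {ae mu, forall x, P x}.
Proof. move=> HP; suff -> : P = (fun=> True) by exact: (@filterT _ _ (ae_filter_ringOfSetsType mu)).
by apply/funext => x; apply/propext; split. Qed.

Definition L1 f := mu.-integrable setT (EFin \o f).
Definition nrm1 f := \int[mu]_x `|f x|.
Definition prim f x := \int[mu]_(t in `]-oo, x]) f t.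

Lemma L1_measurable f : L1 f -> measurable_fun setT f.
Proof. by move=> /measurable_int/measurable_EFinP. Qed.

Lemma L1S f A : measurable A -> L1 f -> mu.-integrable A (EFin \o f).
Proof. by move=> mA; exact: integrableS. Qed.

Lemma L1_lin c f g : L1 f -> L1 g -> L1 (fun x => c * f x + g x).
Proof.
move=> /(integrableZl measurableT c) f1 g1.
by have := integrableD measurableT f1 g1; apply: eq_integrable.
Qed.

Lemma L1Z c f : L1 f -> L1 (fun x => c * f x).
Proof. by move=> /(integrableZl measurableT c); apply: eq_integrable. Qed.

Lemma L1D f g : L1 f -> L1 g -> L1 (fun x => f x + g x).
Proof. by move=> f1 g1; have := integrableD measurableT f1 g1; apply: eq_integrable. Qed.

Lemma L1B f g : L1 f -> L1 g -> L1 (fun x => f x - g x).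
Proof. by move=> f1 g1; have := integrableB measurableT f1 g1; apply: eq_integrable. Qed.

Lemma L1_norm f : L1 f -> L1 (fun x => `|f x|).
Proof. by move=> f1; exact: integrable_norm. Qed.

Lemma L1_mul f h C : L1 f -> measurable_fun setT h -> (forall x, `|h x| <= C) ->
  L1 (fun x => f x * h x).
Proof.
move=> f1 mh hC; apply: (@le_integrable _ _ R mu _ measurableT _ (EFin \o (fun x => C * f x))).
- by apply/measurable_EFinP/measurable_funM => //; exact: L1_measurable.
- move=> x _; rewrite /= lee_fin normrM [leRHS]normrM mulrC ler_wpM2r//.
  by rewrite (le_trans (hC x))// ler_norm.
- exact: L1Z.
Qed.

Lemma L1_patch f A : measurable A -> L1 f -> L1 (f \_ A).
Proof.
move=> mA f1; rewrite /L1 -restrict_EFin.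
exact: (proj1 (@integrable_mkcond _ _ _ mu _ (EFin \o f) mA) (L1S mA f1)).
Qed.

Lemma L1_patchP f A : measurable A -> mu.-integrable A (EFin \o f) <-> L1 (f \_ A).
Proof. by move=> mA; rewrite /L1 -restrict_EFin; exact: (@integrable_mkcond _ _ _ mu _ (EFin \o f) mA). Qed.

Lemma measure_itv_lty L : (mu `[(- L)%R, L] < +oo)%E.
Proof. by rewrite lebesgue_measure_itv/=; case: ifP => _; rewrite -?EFinD ?ltry. Qed.

Lemma L1_bounded f C L : measurable_fun setT f -> (forall x, `|f x| <= C) ->
  (forall x, L < `|x| -> f x = 0) -> L1 f.
Proof.
move=> mf fC fL; rewrite (_ : f = f \_ `[- L, L]).
  apply: (proj1 (L1_patchP f (measurable_itv `[- L, L]))).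
  apply: measurable_bounded_integrable => //.
  - exact: measure_itv_lty.
  - exact: measurable_funTS.
  - exists C; split; first by rewrite num_real.
    by move=> y Cy x _ /=; rewrite (le_trans (fC x))// ltW.
apply/funext => x; rewrite patchE; case: ifPn => //; rewrite notin_setE/= in_itv/=.
by rewrite -ler_norml => /negP; rewrite -ltNge; exact: fL.
Qed.

Lemma eq_nrm1 f g : f =1 g -> nrm1 f = nrm1 g.
Proof. by move=> fg; congr nrm1; apply/funext. Qed.

Lemma nrm1_ge0 f : 0 <= nrm1 f.
Proof. by apply: Rintegral_ge0. Qed.

Lemma nrm1_le f g : L1 f -> L1 g -> (forall x, `|f x| <= `|g x|) -> nrm1 f <= nrm1 g.
Proof. by move=> f1 g1 fg; apply: le_Rintegral => //; exact: L1_norm. Qed.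

Lemma nrm1Z c f : L1 f -> nrm1 (fun x => c * f x) = `|c| * nrm1 f.
Proof.
move=> f1; rewrite /nrm1 -RintegralZl//; last exact: L1_norm.
by apply: eq_Rintegral => x _; rewrite normrM.
Qed.

Lemma nrm1_add f g : L1 f -> L1 g -> nrm1 (fun x => f x + g x) <= nrm1 f + nrm1 g.
Proof.
move=> f1 g1; rewrite /nrm1 -RintegralD//; try exact: L1_norm.
apply: le_Rintegral => //; first exact/L1_norm/L1D.
  by apply: L1D; exact: L1_norm.
by move=> x _; exact: ler_normD.
Qed.

Lemma nrm1_sym f g : nrm1 (fun x => f x - g x) = nrm1 (fun x => g x - f x).
Proof. by apply: eq_Rintegral => x _; rewrite distrC. Qed.

Lemma nrm1_triangle f g h : L1 f -> L1 g -> L1 h ->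
  nrm1 (fun x => f x - h x) <= nrm1 (fun x => f x - g x) + nrm1 (fun x => g x - h x).
Proof.
move=> f1 g1 h1; apply: le_trans (nrm1_add (L1B f1 g1) (L1B g1 h1)).
apply: nrm1_le; [exact: L1B|by apply: L1D; exact: L1B|].
by move=> x; rewrite subrKA.
Qed.

Lemma le_Rintegral_nrm1 f A : measurable A -> L1 f -> `|\int[mu]_(x in A) f x| <= nrm1 f.
Proof.
move=> mA f1; rewrite (le_trans (le_normr_Rintegral _ _))//; first exact: L1S.
rewrite /nrm1 Rintegral_mkcond; apply: le_Rintegral => //.
- by apply: L1_patch => //; exact: L1_norm.
- exact: L1_norm.
- by move=> x _; rewrite patchE; case: ifP => _; [exact: lexx|exact: normr_ge0].
Qed.

Lemma le_prim f x : L1 f -> `|prim f x| <= nrm1 f.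
Proof. exact: le_Rintegral_nrm1. Qed.

Lemma prim_lin c f g x : L1 f -> L1 g ->
  prim (fun t => c * f t + g t) x = c * prim f x + prim g x.
Proof.
move=> f1 g1; rewrite /prim RintegralD//; last exact: L1S.
  by rewrite RintegralZl//; exact: L1S.
by apply: L1S => //; exact: L1Z.
Qed.

Lemma primD f g x : L1 f -> L1 g ->
  prim (fun t => f t + g t) x = prim f x + prim g x.
Proof. by move=> f1 g1; rewrite /prim RintegralD//; exact: L1S. Qed.

Lemma primB f g x : L1 f -> L1 g ->
  prim (fun t => f t - g t) x = prim f x - prim g x.
Proof. by move=> f1 g1; rewrite /prim RintegralB//; exact: L1S. Qed.

Lemma primZ c f x : L1 f -> prim (fun t => c * f t) x = c * prim f x.
Proof. by move=> f1; rewrite /prim RintegralZl//; exact: L1S. Qed.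

Lemma prim_sub f x y : L1 f -> x <= y -> prim f y - prim f x = \int[mu]_(t in `]x, y]) f t.
Proof. by move=> f1 xy; rewrite /prim Rintegral_itvB//; exact: L1S. Qed.

Lemma ae_eq_Rintegral f g A : measurable A -> measurable_fun A f -> measurable_fun A g ->
  {ae mu, forall x, A x -> f x = g x} ->
  \int[mu]_(x in A) f x = \int[mu]_(x in A) g x.
Proof.
move=> mA mf mg fg; congr fine; apply: ae_eq_integral => //; try exact/measurable_EFinP.
by apply: (aeS fg) => x /= fgx Ax; rewrite fgx.
Qed.

Lemma ae_eq_prim f g x : measurable_fun setT f -> measurable_fun setT g ->
  {ae mu, forall x, f x = g x} -> prim f x = prim g x.
Proof.
move=> mf mg fg; apply: ae_eq_Rintegral => //; try exact: measurable_funTS.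
by apply: (aeS fg) => t ->.
Qed.

Lemma ae_eq_nrm1 f g : measurable_fun setT f -> measurable_fun setT g ->
  {ae mu, forall x, f x = g x} -> nrm1 f = nrm1 g.
Proof.
move=> mf mg fg; apply: ae_eq_Rintegral => //; try exact: measurableT_comp.
by apply: (aeS fg) => t ->.
Qed.

Lemma ae_eq_L1 f g : measurable_fun setT g ->
  {ae mu, forall x, f x = g x} -> L1 f -> L1 g.
Proof.
move=> mg fg f1; apply/integrableP; split; first exact/measurable_EFinP.
have /integrableP[mf] := f1; apply: le_lt_trans.
rewrite le_eqVlt; apply/orP; left; apply/eqP; apply: ge0_ae_eq_integral => //.
- exact/measurableT_comp/measurable_EFinP.
- exact: measurableT_comp.
- by apply: (aeS fg) => x /= -> .
Qed.

Lemma nrm1_eq0 f : L1 f -> nrm1 f = 0 -> {ae mu, forall x, f x = 0}.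
Proof.
move=> f1 /eqP; rewrite /nrm1 /Rintegral fine_eq0; last first.
  by apply: integrable_fin_num => //; exact: L1_norm.
move=> /eqP f0.
have : ae_eq mu setT (EFin \o f) (cst 0%E).
  apply/(ae_eq_integral_abs mu measurableT) => //.
  by apply/measurable_EFinP; exact: L1_measurable.
by move=> /aeS; apply => x /= /(_ I) [].
Qed.

(** Lebesgue differentiation: f is almost everywhere the derivative of its primitive. *)
Lemma prim_eq0 f : L1 f -> (forall x, prim f x = 0) -> {ae mu, forall x, f x = 0}.
Proof.
move=> f1 pf0.
have fy y : mu.-integrable `]-oo, y] (EFin \o f) by exact: L1S.
have locf : locally_integrable setT f by apply: open_integrable_locally => //; exact: openT.
apply: (aeS (FTC1Ny fy locf)) => x [_ <-].
rewrite (_ : (fun _ => _) = fun=> 0) ?derive1_cst//.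
by apply/funext => y; exact: pf0.
Qed.

Lemma prim_inj f g : L1 f -> L1 g -> (forall x, prim f x = prim g x) ->
  {ae mu, forall x, f x = g x}.
Proof.
move=> f1 g1 fg; have := @prim_eq0 _ (L1B f1 g1).
have h x : prim (fun t => f t - g t) x = 0 by rewrite primB// fg subrr.
by move=> /(_ h) /aeS; apply => x /eqP; rewrite subr_eq0 => /eqP.
Qed.

End Integrals.

(** * Test functions *)

Section TestFunctions.
Variable R : realType.
Implicit Types (f g h phi psi : R -> R) (x y a b c C L e : R) (A U V : set R).
Local Notation mu := (@lebesgue_measure R).

Lemma continuous_bounded f a b : continuous f -> exists C : R, forall x, a <= x <= b -> `|f x| <= C.
Proof.
move=> cf; have : compact (f @` `[a, b]).
  by apply: continuous_compact; [exact: continuous_subspaceT|exact: segment_compact].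
move=> /compact_bounded[C [_ HC]]; exists (C + 1) => x xab.
by apply: (HC (C + 1)); rewrite ?ltrDl//; exists x => //=; rewrite in_itv.
Qed.

Lemma test_smooth U phi : test_function U phi -> smooth phi.
Proof. by case. Qed.

Lemma test_supp U phi : test_function U phi -> exists2 L : R, 0 < L & forall x, L < `|x| -> phi x = 0.
Proof.
move=> [_ /compact_bounded[C [_ HC]] _]; exists (`|C| + 1); first by rewrite ltr_wpDl.
move=> x Lx; apply: contrapT => /eqP phix.
have := HC (`|C| + 1); rewrite ltr_pwDr// ?ler_norm// => /(_ isT x).
have cx : closure [set y | phi y != 0] x by exact: subset_closure.
by move=> /(_ cx)/=; rewrite leNgt Lx.
Qed.

Lemma test_eq0 U phi x : test_function U phi -> ~ U x -> phi x = 0.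
Proof.
move=> [_ _ sU] Ux; apply: contrapT => /eqP phix.
by apply/Ux/sU/subset_closure.
Qed.

Lemma testS U V phi : U `<=` V -> test_function U phi -> test_function V phi.
Proof. by move=> UV [sphi cphi sU]; split => //; exact: subset_trans UV. Qed.

Lemma test_continuous U phi : test_function U phi -> continuous phi.
Proof. by move=> /test_smooth; exact: smooth_continuous. Qed.

Lemma test_measurable U phi : test_function U phi -> measurable_fun setT phi.
Proof. by move=> /test_continuous; exact: continuous_measurable_fun. Qed.

Lemma test_bounded U phi : test_function U phi -> exists2 C : R, 0 <= C & forall x, `|phi x| <= C.
Proof.
move=> tphi; have [L L0 phiL] := test_supp tphi.
have [C HC] := @continuous_bounded phi (- L) L (test_continuous tphi).
exists `|C| => // x; have [xL|xL] := leP `|x| L; last by rewrite phiL// normr0.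
by rewrite (le_trans (HC x _)) ?ler_norm// -ler_norml.
Qed.

Lemma test_L1 U phi : test_function U phi -> L1 phi.
Proof.
move=> tphi; have [L L0 phiL] := test_supp tphi; have [C C0 HC] := test_bounded tphi.
exact: (L1_bounded (test_measurable tphi) HC phiL).
Qed.

Lemma smooth_test U phi psi : smooth phi -> test_function U psi ->
  (forall x, psi x = 0 -> phi x = 0) -> test_function U phi.
Proof.
move=> sphi [_ cpsi sU] psi0.
have sub : closure [set x | phi x != 0] `<=` closure [set x | psi x != 0].
  by apply: closureS => x /=; apply: contra_neq; exact: psi0.
split; [exact: sphi| |exact: subset_trans sU].
by apply: subclosed_compact sub => //; exact: closed_closure.
Qed.

Lemma test_mul U f phi : smooth f -> test_function U phi ->
  test_function U (fun x => f x * phi x).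
Proof.
move=> sf tphi; apply: (smooth_test _ tphi).
  exact: smooth_mul sf (test_smooth tphi).
by move=> x ->; rewrite mulr0.
Qed.

Lemma test_itv U a b phi : smooth phi -> `[a, b] `<=` U ->
  (forall x, ~~ (a < x < b) -> phi x = 0) -> test_function U phi.
Proof.
move=> sphi abU phi0.
have sub : closure [set x | phi x != 0] `<=` `[a, b].
  have cl : closed `[a, b] by exact: compact_closed (@segment_compact _ a b).
  rewrite [X in _ `<=` X](proj1 (closure_id _) cl).
  apply: closureS => x /= phix; rewrite in_itv/=; apply: contraT => xab.
  suff : phi x = 0 by move/eqP; rewrite (negbTE phix).
  by apply: phi0; apply: contra xab => /andP[/ltW -> /ltW ->].
split; [exact: sphi| |exact: subset_trans abU].
by apply: subclosed_compact sub; [exact: closed_closure|exact: segment_compact].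
Qed.

Lemma test_lin U c phi psi : test_function U phi -> test_function U psi ->
  test_function U (fun x => c * phi x + psi x).
Proof.
move=> tphi tpsi; split; first exact: smooth_lin (test_smooth tphi) (test_smooth tpsi).
  have [_ c1 _] := tphi; have [_ c2 _] := tpsi.
  apply: subclosed_compact (compactU c1 c2) _; first exact: closed_closure.
  rewrite -closureU; apply: closureS => x /= xN0; apply: contrapT => /not_orP[/negP].
  rewrite negbK => /eqP p0 /negP; rewrite negbK => /eqP q0.
  by move: xN0; rewrite p0 q0 mulr0 addr0 eqxx.
have [_ _ s1] := tphi; have [_ _ s2] := tpsi.
apply: (@subset_trans _ (closure ([set x | phi x != 0] `|` [set x | psi x != 0]))).
  apply: closureS => x /= xN0; apply: contrapT => /not_orP[/negP].
  rewrite negbK => /eqP p0 /negP; rewrite negbK => /eqP q0.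
  by move: xN0; rewrite p0 q0 mulr0 addr0 eqxx.
by rewrite closureU => x [/s1|/s2].
Qed.

Lemma test0 U : test_function U (fun=> 0).
Proof.
split; first exact: smooth_cst.
  by rewrite (_ : [set _ | _] = set0) ?closure0; [exact: compact0|apply/seteqP; split => x //=; rewrite eqxx].
by rewrite (_ : [set _ | _] = set0) ?closure0//; apply/seteqP; split => x //=; rewrite eqxx.
Qed.

Lemma test_derive1 U phi : test_function U phi -> test_function U (derive1 phi).
Proof.
move=> tphi; have [_ cphi sU] := tphi.
have sub : closure [set x | derive1 phi x != 0] `<=` closure [set x | phi x != 0].
  rewrite [X in _ `<=` X](proj1 (closure_id _) (@closed_closure _ _)).
  apply: closureS => x /= dx; apply: contrapT => xN.
  have : nbhs x (~` closure [set x | phi x != 0]).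
    by apply: open_nbhs_nbhs; split => //; apply: closed_openC; exact: closed_closure.
  move=> /nbhs_ballP[e /= e0 xe].
  have h : {near x, (fun=> 0) =1 phi}.
    near=> y; apply/esym/eqP/negPn/negP => phiy.
    have : ball x e y by near: y; exact: nbhsx_ballx.
    by move=> /xe; apply; exact: subset_closure.
  by move: dx; rewrite derive1E -(near_eq_derive _ h) derive_cst eqxx.
split; [exact/smooth_derive1/(test_smooth tphi)| |exact: subset_trans sU].
by apply: subclosed_compact sub => //; exact: closed_closure.
Unshelve. all: by end_near. Qed.

Lemma FTC_smooth f a b : a <= b -> smooth f -> \int[mu]_(t in `[a, b]) derive1 f t = f b - f a.
Proof.
rewrite le_eqVlt => /predU1P[<- _|ab sf]; first by rewrite set_itv1 Rintegral_set1 subrr.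
have cf := smooth_continuous sf.
have /= := @continuous_FTC2 R (derive1 f) f a b ab.
rewrite /Rintegral => -> //.
- by apply: continuous_subspaceT; apply: smooth_continuous; exact: smooth_derive1.
- split; first by move=> x _; exact: (sf 0%N).
    by apply: cvg_at_right_filter; exact: cf.
  by apply: cvg_at_left_filter; exact: cf.
Qed.

Lemma prim_derive1 U phi x : test_function U phi -> prim (derive1 phi) x = phi x.
Proof.
move=> tphi; have [L L0 phiL] := test_supp tphi.
have [L' L'0 dphiL] := test_supp (test_derive1 tphi).
(* To the left of a both phi and its derivative vanish, so the integral over []-oo, x]] is one over
   [[a, x]]. *)
pose a := - (L + L' + `|x| + 1).
have La : L < `|a|.
  by rewrite normrN ger0_norm; have := normr_ge0 x; lra.
have ax : a <= x.
  by rewrite /a lerNl; have := ler_norm (- x); rewrite normrN; lra.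
rewrite -[RHS]subr0 -(phiL _ La) -FTC_smooth//; last exact: test_smooth tphi.
rewrite /prim [LHS]Rintegral_mkcond [RHS]Rintegral_mkcond; apply: eq_Rintegral => t _.
rewrite !patchE; case: ifPn => tx.
  case: ifPn => // ta; apply: dphiL.
  move: tx ta; rewrite inE notin_setE/= !in_itv/= => tx; rewrite tx andbT => /negP.
  rewrite -ltNge /a => h; have := ler_norm (- t); rewrite normrN.
  by have := normr_ge0 x; lra.
rewrite ifF//; apply/negbTE; move: tx; rewrite !notin_setE/= !in_itv/= => tx.
by move=> /andP[_ xt]; exact: tx.
Qed.

Lemma Rintegral_derive1 U phi : test_function U phi -> \int[mu]_x derive1 phi x = 0.
Proof.
move=> tphi; have [L L0 phiL] := test_supp tphi.
have [L' L'0 dphiL] := test_supp (test_derive1 tphi).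
have LL : L < `|L + L'| by rewrite ger0_norm; lra.
rewrite -(phiL _ LL) -(prim_derive1 _ tphi) /prim [RHS]Rintegral_mkcond.
apply: eq_Rintegral => t _; rewrite patchE; case: ifPn => //.
rewrite notin_setE/= in_itv/= => /negP; rewrite -ltNge => h.
by apply: dphiL; rewrite (lt_le_trans _ (ler_norm _))//; lra.
Qed.

End TestFunctions.

(** * Second primitives *)

Section SecondPrimitives.
Variable R : realType.
Implicit Types (f g h phi psi z : R -> R) (x y a b c C L e : R) (A U V : set R).
Local Notation mu := (@lebesgue_measure R).

(** Removes approximation errors: c collects the constants of an estimate valid for every error
    e. *)
Lemma le0_eps x c : 0 <= c -> (forall e, 0 < e -> x <= c * e) -> x <= 0.
Proof.
move=> c0 H; rewrite leNgt; apply/negP => x0.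
have := H (x / (c + 1) / 2).
have c1 : 0 < c + 1 by lra.
rewrite !divr_gt0// => /(_ isT); rewrite leNgt => /negP; apply.
rewrite mulrA ltr_pdivrMr// mulrCA mulrA ltr_pdivrMr//; nra.
Qed.

Lemma dct (f_ : nat -> R -> R) f g : (forall n, measurable_fun setT (f_ n)) ->
  measurable_fun setT f -> L1 g ->
  {ae mu, forall x, f_ n x @[n --> \oo] --> f x} ->
  {ae mu, forall x, forall n, `|f_ n x| <= g x} ->
  L1 f /\ nrm1 (fun x => f_ n x - f x) @[n --> \oo] --> 0.
Proof.
move=> mf_ mf g1 ff fg.
have [] := @dominated_convergence _ _ R mu _ measurableT (fun n => EFin \o f_ n) (EFin \o f) (EFin \o g).
- by move=> n; apply/measurable_EFinP; exact: mf_.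
- exact/measurable_EFinP.
- by apply: (aeS ff) => x fx _; apply: cvg_EFin => //; exact: nearW.
- exact: g1.
- by apply: (aeS fg) => x fx n _; rewrite /= lee_fin.
- by move=> f1 cv _; split=> //; exact: (fine_cvg cv).
Qed.

Lemma cvg0_le (u : nat -> R) e : u n @[n --> \oo] --> 0 -> 0 < e ->
  exists N, forall n, (N <= n)%N -> `|u n| <= e.
Proof.
move=> /cvgrPdist_le cu e0; have [N _ HN] := cu _ e0.
by exists N => n Nn; have := HN n Nn; rewrite /= sub0r normrN.
Qed.

Lemma plateau_L1 f c d e : L1 f -> 0 < e -> exists n,
  nrm1 (fun x => f x * plateau c d n x - (f \_ `]c, d[) x) <= e.
Proof.
move=> f1 e0.
have mp n : measurable_fun setT (plateau c d n).
  by apply: continuous_measurable_fun; apply: smooth_continuous; exact: smooth_plateau.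
have [|||||_ cv] := @dct (fun n x => f x * plateau c d n x) (f \_ `]c, d[) (fun x => `|f x|).
- by move=> n; apply: measurable_funM => //; exact: L1_measurable.
- by apply: L1_measurable; exact: L1_patch.
- exact: L1_norm.
- apply: aeW => x; rewrite (_ : (f \_ `]c, d[) x = f x * \1_`]c, d[ x).
    by apply: cvgM; [exact: cvg_cst|exact: plateau_cvg].
  by rewrite patchE indicE; case: ifP => _; rewrite ?mulr1 ?mulr0.
- apply: aeW => x n; rewrite normrM ler_piMr// ger0_norm ?plateau_ge0//.
  exact: plateau_le1.
- have [N HN] := cvg0_le cv e0; exists N.
  by have := HN N (leqnn N); rewrite ger0_norm ?nrm1_ge0.
Qed.

(** The interval is exhausted from inside, so that supports in [[c, d]] are compact in []a, b[];
    [a0] and [b0] keep room for a fixed bump. *)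
Lemma itv_L1 f a b a0 b0 e : L1 f -> 0 < e -> a < a0 -> b0 < b ->
  exists c d, [/\ a < c <= a0, b0 <= d < b & nrm1 (fun x => (f \_ `]c, d[) x - (f \_ `]a, b[) x) <= e].
Proof.
move=> f1 e0 aa0 b0b.
pose c (n : nat) := a + (a0 - a) / n.+1%:R; pose d (n : nat) := b - (b - b0) / n.+1%:R.
have hc n : a < c n <= a0.
  rewrite ltrDl divr_gt0 ?subr_gt0//= -lerBrDl ler_pdivrMr// ler_pMr ?subr_gt0//.
  by rewrite ler1n.
have hd n : b0 <= d n < b.
  rewrite gtrBl divr_gt0 ?subr_gt0// andbT lerBrDl -lerBrDr ler_pdivrMr// ler_pMr ?subr_gt0//.
  by rewrite ler1n.
have cc : c n @[n --> \oo] --> a.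
  rewrite -[X in _ --> X]addr0; apply: cvgD; first exact: cvg_cst.
  rewrite -[X in _ --> X](mulr0 (a0 - a)); apply: cvgM; first exact: cvg_cst.
  exact: cvg_harmonic.
have cd : d n @[n --> \oo] --> b.
  rewrite -[X in _ --> X]subr0; apply: cvgB; first exact: cvg_cst.
  rewrite -[X in _ --> X](mulr0 (b - b0)); apply: cvgM; first exact: cvg_cst.
  exact: cvg_harmonic.
have [|||||_ cv] := @dct (fun n => f \_ `]c n, d n[) (f \_ `]a, b[) (fun x => `|f x|).
- by move=> n; apply: L1_measurable; exact: L1_patch.
- by apply: L1_measurable; exact: L1_patch.
- exact: L1_norm.
- apply: aeW => x; rewrite patchE; case: ifPn => [xab|xab]; last first.
    rewrite (_ : (fun _ => _) = fun=> 0); first exact: cvg_cst.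
    apply/funext => n; rewrite patchE ifF//; apply: contraNF xab; rewrite !inE/= !in_itv/=.
    by have /andP[h1 _] := hc n; have /andP[_ h2] := hd n; move=> /andP[]; lra.
  move: xab; rewrite inE/= in_itv/= => /andP[ax xb].
  apply: cvg_near_cst; near=> n; rewrite patchE ifT// inE/= in_itv/=; apply/andP; split.
    by near: n; exact: (cvgr_lt _ cc).
  by near: n; exact: (cvgr_gt _ cd).
- by apply: aeW => x n; rewrite patchE; case: ifP => _; rewrite ?normr0.
- have [N HN] := cvg0_le cv e0; exists (c N), (d N); split => //.
  by have := HN N (leqnn N); rewrite ger0_norm ?nrm1_ge0.
Unshelve. all: by end_near. Qed.

Lemma prim_continuous f : L1 f -> continuous f ->
  forall x, is_derive x 1 (prim f) (f x).
Proof.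
move=> f1 cf x.
have [] := @continuous_FTC1 R f -oo%O x (x + 1) _ _ _ (cf x).
- by rewrite ltrDl.
- exact: L1S.
- by rewrite ltNyr.
- by move=> d1 d2; apply: DeriveDef; [exact: d1|rewrite -derive1E; exact: d2].
Qed.

(* The elements of [sobolev0 2 1 U] are, for U bounded, the second primitives
   of the [z] satisfying this predicate. *)
Definition der2_0 U z := L1 z /\ forall e, 0 < e ->
  exists2 phi, test_function U phi & nrm1 (fun x => derive1 (derive1 phi) x - z x) <= e.

Lemma test_der2_0 U phi : test_function U phi -> der2_0 U (derive1 (derive1 phi)).
Proof.
move=> tphi; split; first exact/(test_L1 (U := U))/test_derive1/test_derive1.
move=> e e0; exists phi => //; rewrite (_ : nrm1 _ = 0) ?ltW//.
rewrite (@eq_nrm1 _ _ (fun=> 0)); last by move=> x; rewrite subrr.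
by rewrite /nrm1; under eq_Rintegral do rewrite normr0; rewrite Rintegral_cst// mul0r.
Qed.

Lemma der2_0_L1 U z : der2_0 U z -> L1 z.
Proof. by case. Qed.

Lemma der2_0S U V z : U `<=` V -> der2_0 U z -> der2_0 V z.
Proof.
move=> UV [z1 Jz]; split=> // e /Jz[phi tphi ephi]; exists phi => //.
exact: testS tphi.
Qed.

Lemma derive1_lin c phi psi U : test_function U phi -> test_function U psi ->
  derive1 (fun x => c * phi x + psi x) = fun x => c * derive1 phi x + derive1 psi x.
Proof.
move=> tphi tpsi; apply: is_derive_derive1 => x; apply: is_derive_lin.
- exact: smooth_is_derive (test_smooth tphi) x.
- exact: smooth_is_derive (test_smooth tpsi) x.
Qed.

Lemma der2_0_lim U z : L1 z ->
  (forall e, 0 < e -> exists2 w, der2_0 U w & nrm1 (fun x => w x - z x) <= e) -> der2_0 U z.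
Proof.
move=> z1 H; split=> // e e0.
have e20 : 0 < e / 2 by lra.
have [w [w1 Jw] wz] := H _ e20; have [phi tphi phiw] := Jw _ e20.
exists phi => //; have L1p : L1 (derive1 (derive1 phi)).
  exact/(test_L1 (U := U))/test_derive1/test_derive1.
by have := nrm1_triangle L1p w1 z1; lra.
Qed.

Lemma der2_0_lin c U z w : der2_0 U z -> der2_0 U w -> der2_0 U (fun x => c * z x + w x).
Proof.
move=> [z1 Jz] [w1 Jw]; split; first exact: L1_lin.
move=> e e0; have c0 : 0 < `|c| + 1 by have := normr_ge0 c; lra.
have ec : 0 < e / (`|c| + 1) / 2 by rewrite !divr_gt0.
have e20 : 0 < e / 2 by lra.
have [phi tphi ephi] := Jz _ ec; have [psi tpsi epsi] := Jw _ e20.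
exists (fun x => c * phi x + psi x); first exact: test_lin.
rewrite (derive1_lin c tphi tpsi).
rewrite (derive1_lin c (test_derive1 tphi) (test_derive1 tpsi)).
have p1 : L1 (fun x => derive1 (derive1 phi) x - z x).
  by apply: L1B; [exact/(test_L1 (U := U))/test_derive1/test_derive1|].
have q1 : L1 (fun x => derive1 (derive1 psi) x - w x).
  by apply: L1B; [exact/(test_L1 (U := U))/test_derive1/test_derive1|].
rewrite (@eq_nrm1 _ _ (fun x => c * (derive1 (derive1 phi) x - z x) + (derive1 (derive1 psi) x - w x))); last first.
  by move=> x; move: (derive1 (derive1 phi) x) (derive1 (derive1 psi) x) => p q; ring.
apply: (le_trans (nrm1_add (L1Z c p1) q1)); rewrite nrm1Z//.
have : `|c| * nrm1 (fun x => derive1 (derive1 phi) x - z x) <= e / 2.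
  rewrite (le_trans (ler_wpM2l (normr_ge0 c) ephi))//.
  rewrite [X in X <= _](_ : _ = (e / 2) * (`|c| / (`|c| + 1))); last by ring.
  by rewrite ler_piMr ?ltW// ltr_pdivrMr// mul1r ltrDl.
by lra.
Qed.

Lemma der2_0_0 U : der2_0 U (fun=> 0).
Proof.
have := test_der2_0 (test0 U); congr der2_0.
rewrite (_ : derive1 (fun=> 0) = fun=> 0); last by apply/funext => x; exact: derive1_cst.
by apply/funext => x; exact: derive1_cst.
Qed.

Lemma der2_0B U z w : der2_0 U z -> der2_0 U w -> der2_0 U (fun x => z x - w x).
Proof.
move=> Jz Jw; have := der2_0_lin (-1) Jw Jz; congr der2_0.
by apply/funext => x; rewrite mulN1r addrC.
Qed.

Lemma der2_0_ae U z w : measurable_fun setT w -> {ae mu, forall x, z x = w x} ->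
  der2_0 U z -> der2_0 U w.
Proof.
move=> mw zw [z1 Jz]; have w1 := ae_eq_L1 mw zw z1; split=> // e /Jz[phi tphi ephi].
exists phi => //; rewrite -(@ae_eq_nrm1 _ (fun x => derive1 (derive1 phi) x - z x))//.
- apply: L1_measurable; apply: L1B => //.
  exact/(test_L1 (U := U))/test_derive1/test_derive1.
- apply: L1_measurable; apply: L1B => //.
  exact/(test_L1 (U := U))/test_derive1/test_derive1.
- by apply: (aeS zw) => x ->.
Qed.

(** Convergence of second derivatives in L^1 is uniform convergence of first derivatives, so
    continuity and vanishing outside U pass to [prim z]. *)
Lemma prim_approx U phi z x : test_function U phi -> L1 z ->
  `|derive1 phi x - prim z x| <= nrm1 (fun x => derive1 (derive1 phi) x - z x).
Proof.
move=> tphi z1; have p1 : L1 (derive1 (derive1 phi)).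
  exact/(test_L1 (U := U))/test_derive1/test_derive1.
rewrite -(prim_derive1 x (test_derive1 tphi)) -primB//.
by apply: le_prim; exact: L1B.
Qed.

Lemma unif_lim_continuous f : (forall e, 0 < e -> exists2 g : R -> R, continuous g & forall x, `|g x - f x| <= e) ->
  continuous f.
Proof.
move=> H x; apply/cvgrPdist_le => e e0.
have e3 : 0 < e / 3 by lra.
have [g cg gf] := H _ e3.
have /cvgrPdist_le/(_ _ e3) := cg x; apply: filterS => y gxy.
have := gf x; have := gf y; move: gxy; rewrite /= !ler_norml.
by move=> /andP[? ?] /andP[? ?] /andP[? ?]; apply/andP; split; lra.
Qed.

Lemma der2_0_continuous U z : der2_0 U z -> continuous (prim z).
Proof.
move=> [z1 Jz]; apply: unif_lim_continuous => e /Jz[phi tphi ephi].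
exists (derive1 phi); first exact: test_continuous (test_derive1 tphi).
by move=> x; apply: le_trans ephi; exact: prim_approx tphi z1.
Qed.

Lemma der2_0_prim_eq0 U z x : der2_0 U z -> ~ U x -> prim z x = 0.
Proof.
move=> [z1 Jz] Ux; apply/eqP; rewrite -normr_eq0; apply/eqP/le_anti; rewrite normr_ge0 andbT; apply: (@le0_eps _ 1) => // e /Jz[phi tphi ephi].
have := prim_approx x tphi z1; rewrite (test_eq0 (test_derive1 tphi) Ux) sub0r normrN; lra.
Qed.

Definition inball U L := forall x, U x -> `|x| <= L.

Lemma bounded_inball U : bounded_set (U : set R^o) -> exists2 L : R, 0 < L & inball U L.
Proof.
move=> [C [_ HC]]; exists (`|C| + 1); first by rewrite ltr_wpDl.
by move=> x Ux; apply: (HC (`|C| + 1)) => //; rewrite ltr_pwDr// ler_norm.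
Qed.

Lemma inball_eq0 U L x : inball U L -> L < `|x| -> ~ U x.
Proof. by move=> UL; rewrite ltNge => /negP h /UL. Qed.

Lemma nrm1_sup f C L : 0 <= L -> measurable_fun setT f -> (forall x, `|f x| <= C) ->
  (forall x, L < `|x| -> f x = 0) -> nrm1 f <= 2 * L * C.
Proof.
move=> L0 mf fC fL; have C0 : 0 <= C by apply: le_trans (fC 0).
rewrite /nrm1 (_ : 2 * L * C = \int[mu]_(x in `[- L, L]) C); last first.
  rewrite Rintegral_cst//= lebesgue_measure_itv/= lte_fin.
  case: ifPn => h; first by rewrite -EFinD/=; ring.
  by rewrite (_ : L = 0) ?mulr0 ?mul0r//; lra.
rewrite [leRHS]Rintegral_mkcond; apply: le_Rintegral => //.
- by apply: L1_norm; exact: L1_bounded fL.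
- apply: (proj1 (L1_patchP _ (measurable_itv `[- L, L]))).
  apply: measurable_bounded_integrable => //; first exact: measure_itv_lty.
  exists C; split; first by rewrite num_real.
  by move=> y Cy x _ /=; rewrite ger0_norm// ltW.
- move=> x _; rewrite patchE; case: ifPn => [_|]; first exact: fC.
  rewrite notin_setE/= in_itv/= => /negP; rewrite -ler_norml -ltNge => /fL ->.
  by rewrite normr0.
Qed.

Lemma der2_0_prim_L1 U z L : inball U L -> der2_0 U z -> L1 (prim z).
Proof.
move=> UL Jz; apply: (@L1_bounded _ _ (nrm1 z) L).
- apply: continuous_measurable_fun; exact: der2_0_continuous Jz.
- by move=> x; apply: le_prim; exact: der2_0_L1 Jz.
- by move=> x Lx; apply: (der2_0_prim_eq0 Jz); exact: inball_eq0 Lx.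
Qed.

(** The difference of first derivatives vanishes outside [[-L, L]]; integrating it costs the length
    2 L. *)
Lemma prim2_approx U phi z x L : 0 <= L -> inball U L -> der2_0 U z -> test_function U phi ->
  `|phi x - prim (prim z) x| <= 2 * L * nrm1 (fun x => derive1 (derive1 phi) x - z x).
Proof.
move=> L0 UL Jz tphi; have z1 := der2_0_L1 Jz; have pz1 := der2_0_prim_L1 UL Jz.
have p1 : L1 (derive1 phi) by exact/(test_L1 (U := U))/test_derive1.
rewrite -(prim_derive1 x tphi) -primB//.
apply: le_trans (le_prim x (L1B p1 pz1)) _.
apply: nrm1_sup => //.
- by apply: L1_measurable; exact: L1B.
- by move=> t; exact: prim_approx tphi z1.
- move=> t Lt; have Ut := inball_eq0 UL Lt.
  by rewrite (test_eq0 (test_derive1 tphi) Ut) (der2_0_prim_eq0 Jz Ut) subr0.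
Qed.

Lemma der2_0_prim2_eq0 U z x L : 0 <= L -> inball U L -> der2_0 U z -> ~ U x ->
  prim (prim z) x = 0.
Proof.
move=> L0 UL Jz Ux; have [_ H] := Jz.
apply/eqP; rewrite -normr_eq0; apply/eqP/le_anti; rewrite normr_ge0 andbT.
apply: (@le0_eps _ (2 * L)); first by rewrite mulr_ge0.
move=> e /H[phi tphi ephi]; have := prim2_approx x L0 UL Jz tphi.
rewrite (test_eq0 tphi Ux) sub0r normrN => /le_trans; apply.
by rewrite ler_wpM2l// mulr_ge0.
Qed.

Lemma der2_0_prim2_continuous U z L : 0 <= L -> inball U L -> der2_0 U z ->
  continuous (prim (prim z)).
Proof.
move=> L0 UL Jz; apply: unif_lim_continuous => e e0.
have L1 : 0 < 2 * L + 1 by lra.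
have [_ /(_ (e / (2 * L + 1)))] := Jz; rewrite divr_gt0// => /(_ isT)[phi tphi ephi].
exists phi; first exact: test_continuous tphi.
move=> x; apply: le_trans (prim2_approx x L0 UL Jz tphi) _.
rewrite (le_trans (ler_wpM2l _ ephi)) ?mulr_ge0// mulrA ler_pdivrMr//; nra.
Qed.

Lemma le_prim2 U z x L : 0 <= L -> inball U L -> der2_0 U z ->
  `|prim (prim z) x| <= 2 * L * nrm1 z.
Proof.
move=> L0 UL Jz; have pz1 := der2_0_prim_L1 UL Jz.
apply: le_trans (le_prim x pz1) _; apply: nrm1_sup => //.
- exact: L1_measurable.
- by move=> t; apply: le_prim; exact: der2_0_L1 Jz.
- by move=> t Lt; apply: (der2_0_prim_eq0 Jz); exact: inball_eq0 Lt.
Qed.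

Lemma der2_0_prim2_L1 U z L : 0 <= L -> inball U L -> der2_0 U z -> L1 (prim (prim z)).
Proof.
move=> L0 UL Jz; apply: (@L1_bounded _ _ (2 * L * nrm1 z) L).
- apply: continuous_measurable_fun; exact: (der2_0_prim2_continuous L0 UL Jz).
- by move=> x; exact: (le_prim2 x L0 UL Jz).
- by move=> x Lx; apply: (der2_0_prim2_eq0 L0 UL Jz); exact: inball_eq0 Lx.
Qed.

End SecondPrimitives.

(** * Truncation to an interval *)

Section Cut.
Variable R : realType.
Implicit Types (f g h phi psi z y : R -> R) (x a b c d C L e : R) (A U V : set R).
Local Notation mu := (@lebesgue_measure R).

Lemma ae_exists (P : R -> Prop) a b : a < b -> {ae mu, forall x, P x} ->
  exists2 x, a < x < b & P x.
Proof.
move=> ab [N [mN N0 NP]]; apply: contrapT => H.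
have : (mu `]a, b[ <= mu N)%E.
  apply: le_measure; rewrite ?inE//= => x /=; rewrite in_itv/= => xab.
  by apply: NP => /= Px; apply: H; exists x.
by rewrite N0 lebesgue_measure_itv/= lte_fin ab -EFinD lee_fin; lra.
Qed.

Definition smooth_supp c d f := smooth f /\ forall x, ~~ (c < x < d) -> f x = 0.

Lemma smooth_supp_test c d f U : smooth_supp c d f -> `[c, d] `<=` U -> test_function U f.
Proof. by move=> [sf f0] cdU; exact: test_itv sf cdU f0. Qed.

Lemma smooth_supp_testT c d f : smooth_supp c d f -> test_function setT f.
Proof. by move=> sf; exact: smooth_supp_test sf _. Qed.

Lemma smooth_supp_L1 c d f : smooth_supp c d f -> L1 f.
Proof. by move=> /smooth_supp_testT/test_L1. Qed.

Lemma smooth_supp_lin k c d f g : smooth_supp c d f -> smooth_supp c d g ->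
  smooth_supp c d (fun x => k * f x + g x).
Proof.
move=> [sf f0] [sg g0]; split; first exact: smooth_lin.
by move=> x xcd; rewrite f0// g0// mulr0 addr0.
Qed.

Lemma smooth_supp_B k c d f g : smooth_supp c d f -> smooth_supp c d g ->
  smooth_supp c d (fun x => f x - k * g x).
Proof.
move=> sf sg; have := smooth_supp_lin (- k) sg sf; congr smooth_supp.
by apply/funext => x; rewrite mulNr addrC.
Qed.

Lemma prim_left f c x : (forall t, t <= c -> f t = 0) -> x <= c -> prim f x = 0.
Proof.
move=> f0 xc; rewrite /prim; under eq_Rintegral => t.
  by rewrite inE/= in_itv/= => tx; rewrite f0 ?(le_trans tx)//; over.
rewrite Rintegral_mkcond -[RHS](mul0r (fine (mu setT))) -Rintegral_cst//.
by apply: eq_Rintegral => t _; rewrite patchE; case: ifP.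
Qed.

Lemma prim_right f d x : (forall t, d <= t -> f t = 0) -> d <= x -> prim f x = \int[mu]_t f t.
Proof.
move=> f0 dx; rewrite /prim Rintegral_mkcond; apply: eq_Rintegral => t _.
rewrite patchE; case: ifPn => //; rewrite notin_setE/= in_itv/= => /negP.
by rewrite -ltNge => xt; rewrite f0// ltW// (le_lt_trans dx).
Qed.

Lemma smooth_supp_prim c d f : smooth_supp c d f -> \int[mu]_t f t = 0 ->
  smooth_supp c d (prim f) /\ derive1 (prim f) = f.
Proof.
move=> sbf f0; have [sf fcd] := sbf.
have dF := prim_continuous (smooth_supp_L1 sbf) (smooth_continuous sf).
split; last exact: is_derive_derive1.
split; first exact: smooth_prim dF sf.
move=> x; rewrite negb_and -!leNgt => /orP[xc|dx].
  by apply: (@prim_left _ c) => // t tc; apply: fcd; rewrite negb_and -!leNgt tc.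
rewrite (@prim_right _ d)// => t dt; apply: fcd.
by rewrite negb_and -!leNgt dt orbT.
Qed.

Variables (a0 b0 : R).
Hypothesis a0b0 : a0 < b0.

Let bump_supp : smooth_supp a0 b0 (bump a0 b0).
Proof. by split; [exact: smooth_bump|move=> x; exact: bump_eq0]. Qed.

Let bump_int : 0 < \int[mu]_x bump a0 b0 x.
Proof.
rewrite lt_neqAle Rintegral_ge0 ?andbT; last by move=> x _; exact: bump_ge0.
(* A nonnegative function with zero integral vanishes almost everywhere, which the bump does not. *)
apply/eqP => h; have := @nrm1_eq0 _ _ (smooth_supp_L1 bump_supp).
have -> : nrm1 (bump a0 b0) = 0.
  by rewrite h; apply: eq_Rintegral => x _; rewrite ger0_norm// bump_ge0.
move=> /(_ erefl) /(ae_exists a0b0)[x xab].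
by apply/eqP; rewrite gt_eqF// bump_gt0.
Qed.

Definition unit_bump x := (\int[mu]_x bump a0 b0 x)^-1 * bump a0 b0 x.

Lemma unit_bump_supp : smooth_supp a0 b0 unit_bump.
Proof.
have [sb b0'] := bump_supp; split; first exact: smoothZ.
by move=> x /b0'; rewrite /unit_bump => ->; rewrite mulr0.
Qed.

Lemma unit_bump_int : \int[mu]_x unit_bump x = 1.
Proof.
rewrite /unit_bump RintegralZl//; last exact: smooth_supp_L1 bump_supp.
by rewrite mulVf// gt_eqF.
Qed.

Lemma smooth_supp_S c d c' d' f : c' <= c -> d <= d' -> smooth_supp c d f -> smooth_supp c' d' f.
Proof.
move=> cc dd [sf f0]; split=> // x xcd; apply: f0; apply: contra xcd.
by move=> /andP[? ?]; apply/andP; split; lra.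
Qed.

(* Subtracting multiples of [unit_bump] and of its derivative makes the zeroth
   and first moments vanish. *)
Lemma smooth_supp_correct c d f : c <= a0 -> b0 <= d -> smooth_supp c d f ->
  let m0 := \int[mu]_x f x in
  let F := prim (fun x => f x - m0 * unit_bump x) in
  let m1 := \int[mu]_x F x in
  [/\ smooth_supp c d F & exists2 G, smooth_supp c d G &
    forall x, derive1 (derive1 G) x = f x - m0 * unit_bump x - m1 * derive1 unit_bump x].
Proof.
move=> ca db sf m0 F m1.
have su : smooth_supp c d unit_bump := smooth_supp_S ca db unit_bump_supp.
have su1 := smooth_supp_L1 su.
have sf1 := smooth_supp_B m0 sf su.
have [sF dF] : smooth_supp c d F /\ derive1 F = fun x => f x - m0 * unit_bump x.
  apply: smooth_supp_prim => //.
  rewrite RintegralB//; [|exact: smooth_supp_L1 sf|exact: L1Z].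
  by rewrite RintegralZl// unit_bump_int mulr1 subrr.
split=> //; have sF1 := smooth_supp_B m1 sF su.
have [sG dG] : smooth_supp c d (prim (fun x => F x - m1 * unit_bump x)) /\
    derive1 (prim (fun x => F x - m1 * unit_bump x)) = fun x => F x - m1 * unit_bump x.
  apply: smooth_supp_prim => //.
  rewrite RintegralB//; [|exact: smooth_supp_L1 sF|exact: L1Z].
  by rewrite RintegralZl// unit_bump_int mulr1 subrr.
eexists; first exact: sG.
move=> x; rewrite dG.
have -> : derive1 (fun x => F x - m1 * unit_bump x) = fun x => - m1 * derive1 unit_bump x + derive1 F x.
  rewrite -(derive1_lin (- m1) (smooth_supp_testT su) (smooth_supp_testT sF)).
  by congr derive1; apply/funext => t; rewrite mulNr addrC.
by rewrite dF mulNr addrC.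
Qed.

(** Both moment corrections depend continuously on the function in L^1. Correcting smooth
    approximations of z hence gives second derivatives of test functions converging to the corrected
    z. *)
Lemma der2_0_correct a b z : a < a0 -> b0 < b -> L1 z -> (forall x, ~~ (a < x < b) -> z x = 0) ->
  (forall e, 0 < e -> exists c d f,
     [/\ a < c <= a0, b0 <= d < b, smooth_supp c d f & nrm1 (fun x => f x - z x) <= e]) ->
  let m0 := \int[mu]_x z x in
  let F := prim (fun x => z x - m0 * unit_bump x) in
  let m1 := \int[mu]_x F x in
  der2_0 `]a, b[ (fun x => z x - m0 * unit_bump x - m1 * derive1 unit_bump x).
Proof.
move=> aa0 b0b z1 zab zapp m0 F m1.
have u1 := smooth_supp_L1 unit_bump_supp.
have tu := smooth_supp_testT unit_bump_supp.
have du1 := test_L1 (test_derive1 tu).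
have zu1 : L1 (fun x => z x - m0 * unit_bump x) by apply: L1B => //; exact: L1Z.
have Fb x : `|F x| <= nrm1 (fun x => z x - m0 * unit_bump x) by exact: le_prim.
set K := nrm1 unit_bump; set K' := nrm1 (derive1 unit_bump).
have K0 : 0 <= K by exact: nrm1_ge0.
have K'0 : 0 <= K' by exact: nrm1_ge0.
pose Lm : R := `|a| + `|b|.
have Lm0 : 0 <= Lm by rewrite addr_ge0.
have zu0 x : ~~ (a < x < b) -> z x - m0 * unit_bump x = 0.
  move=> xab; rewrite zab// (proj2 unit_bump_supp) ?mulr0 ?subr0//.
  by apply: contra xab => /andP[? ?]; apply/andP; split; lra.
have Lab x : Lm < `|x| -> ~~ (a < x < b).
  rewrite /Lm ltNge; apply: contra => /andP[ax xb]; rewrite ler_norml.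
  have := ler_norm b; have := ler_norm (- a); have := normr_ge0 a; have := normr_ge0 b.
  by rewrite normrN => ? ? ? ?; apply/andP; split; lra.
have intz : \int[mu]_x (z x - m0 * unit_bump x) = 0.
  rewrite RintegralB//; last exact: L1Z.
  by rewrite RintegralZl// unit_bump_int mulr1 subrr.
have F0 x : Lm < `|x| -> F x = 0.
  move=> /Lab; rewrite negb_and -!leNgt => /orP[xa|bx].
    by apply: (@prim_left _ a) => // t ta; apply: zu0; rewrite negb_and -!leNgt ta.
  rewrite /F (@prim_right _ b)// => t bt.
  by apply: zu0; rewrite negb_and -!leNgt bt orbT.
(* In the factor 1 + K, the 1 stands for the error of f and K for that of its zeroth moment, which
   multiplies the bump. *)
have approx e : 0 < e -> exists c d f,
   [/\ a < c <= a0, b0 <= d < b, smooth_supp c d f, nrm1 (fun x => f x - z x) <= e &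
     forall x, `|prim (fun x => f x - (\int[mu]_x f x) * unit_bump x) x - F x| <= e * (1 + K)].
  move=> e0; have [c [d [f [/andP[ac ca] /andP[bd db] sf fz]]]] := zapp e e0.
  exists c, d, f; split => //; rewrite ?ac ?bd//.
  have f1 := smooth_supp_L1 sf; set n0 := \int[mu]_x f x.
  have n0m0 : `|n0 - m0| <= e.
    rewrite /n0 /m0 -RintegralB//; apply: le_trans fz.
    by apply: le_Rintegral_nrm1 => //; exact: L1B.
  have fu1 : L1 (fun x => f x - n0 * unit_bump x) by apply: L1B => //; exact: L1Z.
  move=> x; rewrite /F -primB//.
  have dfz : L1 (fun t => f t - z t) by exact: L1B.
  have dnu : L1 (fun t => (m0 - n0) * unit_bump t) by exact: L1Z.
  apply: (le_trans (le_prim x _)); first exact: L1B.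
  rewrite (@eq_nrm1 _ _ (fun t => (f t - z t) + (m0 - n0) * unit_bump t)); last first.
    by move=> t; move: (f t) (z t) (unit_bump t) => p q r; ring.
  apply: (le_trans (nrm1_add dfz dnu)); rewrite nrm1Z// mulrDr mulr1 lerD//.
  by rewrite distrC ler_wpM2r.
have K1 : 0 < 1 + K by lra.
have mF : measurable_fun setT F.
  apply: continuous_measurable_fun; apply: unif_lim_continuous => e e0.
  have [c [d [f [/andP[ac ca] /andP[bd db] sf _ FF]]]] := approx (e / (1 + K)) (divr_gt0 e0 K1).
  have [sF' _] := smooth_supp_correct ca bd sf.
  eexists; first exact: (smooth_continuous (proj1 sF')).
  by move=> x; apply: le_trans (FF x) _; rewrite divfK// gt_eqF.
have F1 : L1 F by exact: (L1_bounded mF Fb F0).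
split; first by apply: L1B; [exact: zu1|exact: L1Z].
move=> e e0.
(* The summands are the errors of f, of the zeroth and of the first moment correction; an error e /
   k in f thus gives e in total. *)
pose k : R := 1 + K + 2 * Lm * (1 + K) * K'.
have k0 : 0 < k by rewrite /k; have := mulr_ge0 Lm0 K'0; nra.
have [c [d [f [/andP[ac ca] /andP[bd db] sf fz FF']]]] := approx (e / k) (divr_gt0 e0 k0).
have [] := smooth_supp_correct ca bd sf.
set n0 := \int[mu]_x f x; set F' := prim _; set n1 := \int[mu]_x F' x => sF' [G sG dG].
exists G.
  apply: (smooth_supp_test sG) => x /=; rewrite !in_itv/= => /andP[? ?]; apply/andP; split; lra.
have f1 := smooth_supp_L1 sf.
set del := e / k in fz FF'.
have n0m0 : `|n0 - m0| <= del.
  rewrite /n0 /m0 -RintegralB//; apply: le_trans fz.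
  by apply: le_Rintegral_nrm1 => //; exact: L1B.
have F'1 := smooth_supp_L1 sF'.
have n1m1 : `|n1 - m1| <= 2 * Lm * (del * (1 + K)).
  have FF1 : L1 (fun x => F' x - F x) by exact: L1B.
  rewrite /n1 /m1 -RintegralB//; apply: le_trans (le_Rintegral_nrm1 _ FF1) _ => //.
  apply: nrm1_sup => //; first exact: L1_measurable.
  move=> x Lx; rewrite F0// subr0; apply: (proj2 sF').
  apply: contra (Lab _ Lx) => /andP[? ?]; apply/andP; split; lra.
have dfz : L1 (fun t => f t - z t) by exact: L1B.
have dnu : L1 (fun t => (m0 - n0) * unit_bump t) by exact: L1Z.
have dnu' : L1 (fun t => (m1 - n1) * derive1 unit_bump t) by exact: L1Z.
rewrite (@eq_nrm1 _ _ (fun t => ((f t - z t) + (m0 - n0) * unit_bump t) + (m1 - n1) * derive1 unit_bump t)); last first.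
  move=> t; rewrite dG -/n0 -/n1.
  by move: (f t) (z t) (unit_bump t) (derive1 unit_bump t) => p q r s; ring.
apply: (le_trans (nrm1_add (L1D dfz dnu) dnu')).
apply: (le_trans (lerD (nrm1_add dfz dnu) (lexx _))).
rewrite (nrm1Z (m0 - n0) u1) (nrm1Z (m1 - n1) du1) -/K -/K' (distrC m0) (distrC m1).
have -> : e = del + del * K + 2 * Lm * (del * (1 + K)) * K'.
  rewrite -[LHS](divfK (x := k)) ?gt_eqF// -/del /k; ring.
by rewrite !lerD// ler_wpM2r.
Qed.

End Cut.

(** * Cut-off of a second primitive with small boundary values *)

Section Cut2.
Variable R : realType.
Implicit Types (f g h phi psi z y : R -> R) (x a b c d C L e : R) (A U V : set R).
Local Notation mu := (@lebesgue_measure R).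

Lemma measure_itvoo_lty a b : (mu `]a, b[ < +oo)%E.
Proof. by rewrite lebesgue_measure_itv/=; case: ifP => _; rewrite -?EFinD ?ltry. Qed.

Lemma Rintegral_itv_le h a x C : L1 h -> a <= x -> (forall t, a < t < x -> `|h t| <= C) ->
  `|\int[mu]_(t in `]a, x]) h t| <= (x - a) * C.
Proof.
move=> h1 ax hC; rewrite -Rintegral_itv_bndo_bndc; last exact: L1S.
apply: (le_trans (le_normr_Rintegral _ _)) => //; first exact: L1S.
have -> : (x - a) * C = \int[mu]_(t in `]a, x[) C.
  rewrite Rintegral_cst//= lebesgue_measure_itv/= lte_fin mulrC.
  case: ltP => h'; first by rewrite -EFinD.
  by rewrite (_ : x = a) ?subrr//; apply/le_anti; rewrite ax h'.
apply: le_Rintegral => //.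
- by apply: L1S => //; exact: L1_norm.
- apply: measurable_bounded_integrable => //.
    exact: measure_itvoo_lty.
  exists `|C|; split; first by rewrite num_real.
  by move=> y Cy t _ /=; rewrite ltW.
Qed.

Lemma prim_patch z a b x : L1 z -> a <= x -> x < b ->
  prim (z \_ `]a, b[) x = prim z x - prim z a.
Proof.
move=> z1 ax xb; rewrite prim_sub// /prim [LHS]Rintegral_mkcond [RHS]Rintegral_mkcond.
apply: eq_Rintegral => t _; rewrite !patchE.
have [tx|tx] := leP t x; last first.
  rewrite !memNset//= in_itv/= ?leNgt ?tx//= andbF//.
rewrite mem_set ?in_itv//= .
have [at_|ta] := ltP a t; last first.
  by rewrite !memNset//= in_itv/= ltNge ta.
by rewrite !mem_set//= in_itv/= at_//= (le_lt_trans tx).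
Qed.

Lemma Rintegral_patch_itv z a b : L1 z -> a <= b ->
  \int[mu]_x (z \_ `]a, b[) x = prim z b - prim z a.
Proof.
move=> z1 ab; rewrite -Rintegral_mkcond prim_sub// Rintegral_itv_bndo_bndc//.
exact: L1S.
Qed.

(** One third of e each for replacing z by phi'', shrinking the interval, and smoothing its
    indicator. The product with a plateau need not be the second derivative of a test function; the
    moment corrections restore this. *)
Lemma der2_0_approx_itv U z a b a0 b0 e : der2_0 U z -> a < a0 -> b0 < b -> 0 < e ->
  exists c d f, [/\ a < c <= a0, b0 <= d < b, smooth_supp c d f &
    nrm1 (fun x => f x - (z \_ `]a, b[) x) <= e].
Proof.
move=> [z1 Jz] aa0 b0b e0; have e3 : 0 < e / 3 by lra.
have [phi tphi ephi] := Jz _ e3; set f := derive1 (derive1 phi) in ephi.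
have tf : test_function U f by exact/test_derive1/test_derive1.
have f1 := test_L1 tf.
have [c [d [hc hd fcd]]] := itv_L1 f1 e3 aa0 b0b.
have [n fn] := plateau_L1 c d f1 e3.
exists c, d, (fun x => f x * plateau c d n x); split => //.
  split; first by apply: smooth_mul; [exact: test_smooth tf|exact: smooth_plateau].
  by move=> x /plateau_eq0 ->; rewrite mulr0.
have p1 : L1 (fun x => f x * plateau c d n x).
  apply: (@L1_mul _ _ _ 1) => //.
    by apply: continuous_measurable_fun; apply: smooth_continuous; exact: smooth_plateau.
  by move=> x; rewrite ger0_norm ?plateau_ge0// plateau_le1.
have q1 : L1 (f \_ `]c, d[) by exact: L1_patch.
have q2 : L1 (f \_ `]a, b[) by exact: L1_patch.
have q3 : L1 (z \_ `]a, b[) by exact: L1_patch.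
have : nrm1 (fun x => (f \_ `]a, b[) x - (z \_ `]a, b[) x) <= e / 3.
  apply: le_trans ephi; apply: nrm1_le; [exact: L1B|exact: L1B|].
  by move=> x; rewrite !patchE; case: ifP => _; rewrite ?subrr ?normr0.
by have := nrm1_triangle p1 q1 q3; have := nrm1_triangle q1 q2 q3; lra.
Qed.

(* By Taylor's formula the zeroth and first moments of [z] over [`]a, b[] are of
   order [e]; a bump and its derivative correct them after truncation. *)
Lemma der2_0_cut a b : a < b -> exists2 C : R, 0 <= C & forall U L z e,
  0 <= L -> inball U L -> der2_0 U z ->
  `|prim z a| <= e -> `|prim z b| <= e ->
  `|prim (prim z) a| <= e -> `|prim (prim z) b| <= e ->
  exists w, [/\ der2_0 `]a, b[ w, forall x, ~~ (a < x < b) -> w x = 0 &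
    forall x, a < x < b -> [/\ `|w x - z x| <= C * e,
      `|prim w x - prim z x| <= C * e &
      `|prim (prim w) x - prim (prim z) x| <= C * e]].
Proof.
move=> ab.
have H3 (p q r : R) : 0 <= p -> 0 <= q -> 0 <= r ->
    [/\ p <= p + q + (1 + r), q <= p + q + (1 + r) & 1 + r <= p + q + (1 + r)].
  by move=> *; split; lra.
(* The bump is placed in the middle third, away from both end points. *)
pose a0 := (2 * a + b) / 3; pose b0 := (a + 2 * b) / 3.
have aa0 : a < a0 by rewrite /a0; lra.
have a0b0 : a0 < b0 by rewrite /a0 /b0; lra.
have b0b : b0 < b by rewrite /b0; lra.
have sub x : ~~ (a < x < b) -> ~~ (a0 < x < b0).
  by apply: contra => /andP[ax xb]; rewrite (lt_trans aa0 ax) (lt_trans xb b0b).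
have iab : inball `]a, b[ (`|a| + `|b|).
  move=> x /=; rewrite in_itv/= => /andP[ax xb]; rewrite ler_norml.
  have := ler_norm b; have := ler_norm (- a); have := normr_ge0 a; have := normr_ge0 b.
  by rewrite normrN => ? ? ? ?; apply/andP; split; lra.
have ba0 : 0 <= b - a by lra.
clearbody a0 b0.
pose be := unit_bump a0 b0; have sbe : smooth_supp a0 b0 be by exact: unit_bump_supp.
have tbe := smooth_supp_testT sbe; have be1 := test_L1 tbe.
have tbe' := test_derive1 tbe; have be'1 := test_L1 tbe'.
have [Kb Kb0 HKb] := test_bounded tbe; have [Kd Kd0 HKd] := test_bounded tbe'.
set K := nrm1 be; have K0 : 0 <= K by exact: nrm1_ge0.
(* In units of e, [K1] bounds the first moment and [K2] the error of the first derivative; C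
   dominates all three estimates of the conclusion. *)
pose K1 : R := 2 + (b - a) * (1 + 2 * K).
have K10 : 0 <= K1 by rewrite /K1 addr_ge0// mulr_ge0// addr_ge0// mulr_ge0.
pose K2 : R := 1 + 2 * K + K1 * Kb.
have K1b : 0 <= K1 * Kb by rewrite mulr_ge0.
have K1d : 0 <= K1 * Kd by rewrite mulr_ge0.
have K20 : 0 <= K2 by rewrite /K2 !addr_ge0// mulr_ge0.
have baK2 : 0 <= (b - a) * K2 by rewrite mulr_ge0.
pose C : R := (2 * Kb + K1 * Kd) + K2 + (1 + (b - a) * K2).
have KbKd : 0 <= 2 * Kb + K1 * Kd by rewrite addr_ge0// mulr_ge0.
have [C1 C2 C3] := H3 _ _ _ KbKd K20 baK2; rewrite -/C in C1 C2 C3.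
exists C; first exact: le_trans C2.
move=> U L z e L0 UL Jz za zb pza pzb.
have e0 : 0 <= e by apply: le_trans za.
have z1 := der2_0_L1 Jz; have pz1 := der2_0_prim_L1 UL Jz.
have zc1 : L1 (z \_ `]a, b[) by exact: L1_patch.
have zc0 x : ~~ (a < x < b) -> (z \_ `]a, b[) x = 0.
  by move=> xab; rewrite patchE memNset//= in_itv/=; exact/negP.
have app e' : 0 < e' -> _ := @der2_0_approx_itv U z a b a0 b0 e' Jz aa0 b0b.
have /= := der2_0_correct a0b0 aa0 b0b zc1 zc0 app.
rewrite -/be; set m0 := \int[mu]_x _ x; set F := prim _; set m1 := \int[mu]_x F x => Jw.
set w := (fun x : R => _ - _) in Jw.
have m0e : `|m0| <= 2 * e.
  rewrite /m0 (Rintegral_patch_itv z1 (ltW ab)); by apply: (le_trans (ler_normB _ _)); rewrite mulr2n mulrDl mul1r lerD.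
have Lab0 : 0 <= `|a| + `|b| by rewrite addr_ge0.
have mbe1 : L1 (fun x => m0 * be x) by exact: L1Z.
have zm1 : L1 (fun x => (z \_ `]a, b[) x - m0 * be x) by exact: L1B.
have pw x : prim w x = F x - m1 * be x.
  rewrite /w primB//; last exact: L1Z.
  by rewrite primZ// (prim_derive1 _ tbe).
have Fx x : a <= x -> x < b -> F x = prim z x - prim z a - m0 * prim be x.
  by move=> ax xb; rewrite /F primB// prim_patch// primZ.
have F0 x : ~~ (a < x < b) -> F x = 0.
  move=> xab; have : prim w x = 0.
    by apply: (der2_0_prim_eq0 Jw) => /=; rewrite in_itv/=; exact/negP.
  by rewrite pw (proj2 sbe) ?mulr0 ?subr0//; exact: sub.
have pbe x : `|prim be x| <= K by exact: le_prim.
have m0be x : `|m0 * prim be x| <= 2 * e * K.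
  by rewrite normrM ler_pM.
have m1e : `|m1| <= K1 * e.
  (* Splitting off [prim z] expresses the first moment by the boundary values of the second
     primitive and the integral of a function of order e. *)
  have -> : m1 = \int[mu]_(x in `]a, b]) (prim z x - (prim z x - F x)).
    rewrite /m1 [RHS]Rintegral_mkcond; apply: eq_Rintegral => x _; rewrite patchE.
    case: ifPn => [_|]; first by rewrite subKr.
    rewrite notin_setE/= in_itv/= => /negP xab; apply: F0.
    by apply: contra xab => /andP[-> /ltW ->].
  have F1 : L1 F.
    have := L1D (der2_0_prim_L1 iab Jw) (L1Z m1 be1).
    by congr L1; apply/funext => x; rewrite pw subrK.
  rewrite RintegralB//; [|exact: L1S|by apply: L1S => //; exact: L1B].
  rewrite -(prim_sub pz1 (ltW ab)).
  apply: (le_trans (ler_normB _ _)).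
  have -> : K1 * e = 2 * e + (b - a) * (e + 2 * e * K) by rewrite /K1; ring.
  apply: lerD; first by by apply: (le_trans (ler_normB _ _)); rewrite mulr2n mulrDl mul1r lerD.
  apply: Rintegral_itv_le; [exact: L1B|exact: ltW|].
  move=> t /andP[at_ tb]; rewrite Fx//; last exact: ltW.
  rewrite (_ : _ - _ = prim z a + m0 * prim be t); last by move: (prim z t) (prim z a) (prim be t) => p q r; ring.
  by apply: (le_trans (ler_normD _ _)); rewrite lerD.
exists w; split => //.
  move=> x xab; rewrite /w zc0//.
  rewrite (proj2 sbe) ?sub// (test_eq0 (U := `]a, b[) (test_derive1 (smooth_supp_test sbe _))).
  - by rewrite !mulr0 !subr0.
  - by apply: subset_itv; rewrite bnd_simp.
  - by rewrite /= in_itv/=; exact/negP.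
have pwz x : a < x < b -> `|prim w x - prim z x| <= K2 * e.
  move=> /andP[ax xb]; rewrite pw Fx//; last exact: ltW.
  rewrite (_ : _ - _ = - (prim z a + m0 * prim be x + m1 * be x)); last first.
    by move: (prim z x) (prim z a) (prim be x) (be x) => p q r s; ring.
  rewrite normrN (_ : K2 * e = e + 2 * e * K + (K1 * e) * Kb); last by rewrite /K2; ring.
  apply: (le_trans (ler_normD _ _)); apply: lerD.
    by apply: (le_trans (ler_normD _ _)); rewrite lerD.
  by rewrite normrM ler_pM.
have eC k : k <= C -> k * e <= C * e by move=> kC; rewrite ler_wpM2r.
move=> x /[dup] xab /andP[ax xb]; split.
- have -> : w x - z x = - (m0 * be x + m1 * derive1 be x).
    rewrite /w patchE mem_set ?in_itv//=.
    by move: (z x) (be x) (derive1 be x) => p q r; ring.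
  rewrite normrN; apply: (@le_trans _ _ ((2 * Kb + K1 * Kd) * e)); last exact: eC.
  rewrite mulrDl; apply: (le_trans (ler_normD _ _)); apply: lerD.
    by rewrite normrM mulrAC ler_pM.
  by rewrite normrM mulrAC ler_pM.
- by apply: le_trans (pwz x xab) _; exact: eC.
- have pw1 := der2_0_prim_L1 iab Jw.
  have ppwa : prim (prim w) a = 0.
    by apply: (der2_0_prim2_eq0 Lab0 iab Jw); rewrite /= in_itv/= ltxx.
  (* Integration starts at a, where the second primitive of w vanishes. *)
  have -> : prim (prim w) x - prim (prim z) x =
      (\int[mu]_(t in `]a, x]) (prim w t - prim z t)) - prim (prim z) a.
    rewrite RintegralB//; [|exact: L1S|exact: L1S].
    rewrite -(prim_sub pw1 (ltW ax)) -(prim_sub pz1 (ltW ax)) ppwa.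
    by move: (prim (prim w) x) (prim (prim z) x) (prim (prim z) a) => p q r; ring.
  apply: (@le_trans _ _ ((1 + (b - a) * K2) * e)); last by exact: eC.
  apply: (le_trans (ler_normB _ _)); rewrite mulrDl mul1r addrC lerD//.
  apply: (@le_trans _ _ ((x - a) * (K2 * e))).
    apply: Rintegral_itv_le; [exact: L1B|exact: ltW|].
    by move=> t /andP[at_ tx]; apply: pwz; rewrite at_ (lt_trans tx).
  by rewrite mulrA ler_wpM2r// ler_wpM2r// lerB// ltW.
Qed.

End Cut2.

(** * Uniqueness of weak derivatives *)

Section WeakDerivatives.
Variable R : realType.
Implicit Types (f g h phi psi z y u v w : R -> R) (x a b c d C L e : R) (A U V : set R).
Local Notation mu := (@lebesgue_measure R).

Lemma aeS3 (P Q S T : R -> Prop) : {ae mu, forall x, P x} -> {ae mu, forall x, Q x} ->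
  {ae mu, forall x, S x} ->
  (forall x, P x -> Q x -> S x -> T x) -> {ae mu, forall x, T x}.
Proof.
move=> aP aQ aS H; apply: (aeS2 (aeS2 aP aQ (fun x p q => conj p q)) aS).
by move=> x [p q] s; exact: H.
Qed.

(** Countably many intervals, those with rational end points, cover U, so the exceptional sets can
    be united. *)
Lemma ae_itv U (P : R -> Prop) : open U ->
  (forall a b, a < b -> `[a, b] `<=` U -> {ae mu, forall x, a < x < b -> P x}) ->
  {ae mu, forall x, U x -> P x}.
Proof.
move=> oU H.
pose Q (n : nat) x := if @unpickle (rat * rat)%type n is Some (q, r) then
  (ratr q < ratr r :> R) -> `[(ratr q : R), ratr r] `<=` U -> ratr q < x < ratr r -> P x else True.
have aeQ : {ae mu, forall x, forall n, Q n x}.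
  apply: ae_foralln => n; rewrite /Q; case: unpickle => [[q r]|]; last exact: aeW.
  have [qr|qr] := ltP (ratr q : R) (ratr r); last by apply: aeW.
  have [sub|nsub] := pselect (`[(ratr q : R), ratr r] `<=` U); last by apply: aeW.
  by apply: (aeS (H _ _ qr sub)) => x Px _ _.
apply: (aeS aeQ) => x Qx Ux.
have /nbhs_ballP[e /= e0 xe] : nbhs x U by exact: open_nbhs_nbhs.
have [q] := @rat_in_itvoo _ (x - e) x ltac:(by rewrite gtrBl).
have [r] := @rat_in_itvoo _ x (x + e) ltac:(by rewrite ltrDl).
rewrite !in_itv/= => /andP[xr re] /andP[eq qx].
have := Qx (pickle (q, r)); rewrite /Q pickleK; apply; rewrite ?qx ?xr//.
  exact: lt_trans xr.
move=> t /=; rewrite in_itv/= => /andP[qt tr]; apply: xe.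
rewrite ball_itv/= in_itv/=; apply/andP; split.
  exact: lt_le_trans qt.
exact: le_lt_trans re.
Qed.

Lemma loc_L1 U u K : locally_integrable U u -> compact K -> K `<=` U -> L1 (u \_ K).
Proof.
move=> [mu_ oU uK] cK KU.
have mK : measurable K by exact: compact_measurable.
apply: (proj1 (L1_patchP _ mK)); apply/integrableP; split.
  apply/measurable_EFinP; apply: measurable_funS mu_ => //; exact: open_measurable.
exact: uK.
Qed.

Lemma loc_test_L1 U u phi : locally_integrable U u -> test_function U phi ->
  L1 (fun x => ((fun t => u t * phi t) \_ U) x).
Proof.
move=> lu tphi; have [_ cK KU] := tphi.
set K := closure _ in cK KU; have [C C0 HC] := test_bounded tphi.
have := @L1_mul _ _ phi C (loc_L1 lu cK KU) (test_measurable tphi) HC.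
congr L1; apply/funext => x; rewrite !patchE.
have [xK|xK] := boolP (x \in K).
  by rewrite mem_set//; apply: KU; exact: set_mem.
have -> : phi x = 0.
  apply/eqP/negPn; apply: contra xK => px; apply/mem_set; exact: subset_closure.
by rewrite !mulr0; case: ifP.
Qed.

Lemma test_derive1n U phi j : test_function U phi -> test_function U (derive1n j phi).
Proof. by move=> tphi; elim: j => //= j; exact: test_derive1. Qed.

(** Plateaus as test functions show that v has zero integral over every interval whose closure lies
    in U; the primitive of v truncated to such an interval then vanishes. *)
Lemma weak_unique0 U v : locally_integrable U v ->
  (forall phi, test_function U phi -> \int[mu]_(x in U) (v x * phi x) = 0) ->
  {ae mu, forall x, U x -> v x = 0}.
Proof.
move=> lv Hv; have [_ oU _] := lv.
have int0 a b : a < b -> `[a, b] `<=` U -> \int[mu]_x (v \_ `]a, b[) x = 0.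
  move=> ab abU; set f := v \_ `[a, b].
  have f1 : L1 f by apply: loc_L1 lv _ abU; exact: segment_compact.
  have fE : v \_ `]a, b[ = f \_ `]a, b[.
    apply/funext => x; rewrite /f !patchE; case: ifPn => // xab.
    rewrite mem_set//; move: xab; rewrite inE/= !in_itv/= => /andP[? ?].
    by apply/andP; split; exact: ltW.
  apply/eqP; rewrite -normr_eq0; apply/eqP/le_anti; rewrite normr_ge0 andbT.
  apply: (@le0_eps _ _ 1) => // e e0; rewrite mul1r.
  have [n fn] := plateau_L1 a b f1 e0.
  have p1 : L1 (fun x => f x * plateau a b n x).
    apply: (@L1_mul _ _ _ 1) => //.
      by apply: continuous_measurable_fun; apply: smooth_continuous; exact: smooth_plateau.
    by move=> x; rewrite ger0_norm ?plateau_ge0// plateau_le1.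
  have q1 : L1 (f \_ `]a, b[) by exact: L1_patch.
  have tp : test_function U (plateau a b n).
    apply: (test_itv _ abU); first exact: smooth_plateau.
    by move=> x; exact: plateau_eq0.
  have i0 : \int[mu]_x (f x * plateau a b n x) = 0.
    rewrite -(Hv _ tp) [RHS]Rintegral_mkcond; apply: eq_Rintegral => x _.
    rewrite /f !patchE; have [xab|xab] := boolP (x \in `[a, b]%classic).
      by rewrite mem_set//; apply: abU; exact: set_mem.
    rewrite mul0r plateau_eq0 ?mulr0; first by case: ifP.
    apply: contra xab; rewrite inE/= in_itv/= => /andP[? ?].
    by apply/andP; split; exact: ltW.
  rewrite fE -normrN -sub0r -{1}i0 -RintegralB//.
  by apply: le_trans fn; apply: le_Rintegral_nrm1 => //; exact: L1B.
apply: (ae_itv oU) => a b ab abU.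
have f1 : L1 (v \_ `]a, b[).
  have := L1_patch (A := `]a, b[) _ (loc_L1 lv (@segment_compact _ a b) abU).
  move=> /(_ (measurable_itv _)); congr L1; apply/funext => x; rewrite !patchE.
  case: ifPn => // xab; rewrite mem_set//; move: xab; rewrite inE/= !in_itv/= => /andP[? ?].
  by apply/andP; split; exact: ltW.
have : {ae mu, forall x, (v \_ `]a, b[) x = 0}.
  apply: prim_eq0 => // x.
  have [xa|ax] := leP x a.
    apply: (@prim_left _ _ a) => // t ta; rewrite patchE memNset//= in_itv/=.
    by apply/negP; rewrite negb_and -leNgt ta.
  have [bx|xb] := leP b x.
    rewrite (@prim_right _ _ b) ?int0// => t bt; rewrite patchE memNset//= in_itv/=.
    by apply/negP; rewrite negb_and -!leNgt bt orbT.
  have axU : `[a, x] `<=` U.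
    by apply: subset_trans abU; apply: subset_itvl; rewrite bnd_simp ltW.
  rewrite -(int0 a x ax axU) /prim [LHS]Rintegral_mkcond.
  rewrite -[RHS]Rintegral_mkcond Rintegral_itv_bndo_bndc; last first.
    have := loc_L1 lv (@segment_compact _ a x) axU.
    move=> /(proj2 (L1_patchP _ (measurable_itv _))); apply: integrableS => //.
    by move=> t /=; rewrite !in_itv/= => /andP[/ltW -> /ltW ->].
  rewrite [RHS]Rintegral_mkcond; apply: eq_Rintegral => t _; rewrite !patchE.
  have [tx|tx] := leP t x; last first.
    by rewrite !memNset//= in_itv/= leNgt tx//= andbF.
  rewrite mem_set ?in_itv//=.
  have [at_|ta] := ltP a t; last first.
    by rewrite !memNset//= in_itv/= ltNge ta.
  by rewrite !mem_set//= in_itv/= at_//= (le_lt_trans tx).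
by move=> /aeS; apply => x + xab; rewrite patchE mem_set//= in_itv.
Qed.

Lemma weak_lin j U c u v u' v' : is_weak_derivative j U u v -> is_weak_derivative j U u' v' ->
  is_weak_derivative j U (fun x => c * u x + u' x) (fun x => c * v x + v' x).
Proof.
have lin u1 u2 : locally_integrable U u1 -> locally_integrable U u2 ->
    locally_integrable U (fun x => c * u1 x + u2 x).
  move=> l1 l2; have : locally_integrable U (fun x => c * u1 x).
    have [m1 oU k1] := l1; split => //; first exact: measurable_funM.
    move=> K KU cK; have /integrableP[_] := L1Z c (loc_L1 l1 cK KU).
    rewrite [X in (X < _)%E -> _](_ : _ = \int[mu]_(x in K) `|c * u1 x|%:E)%E//.
    rewrite [RHS]integral_mkcond; apply: eq_integral => x _ /=.
    by rewrite !patchE; case: ifP => // _; rewrite mulr0 normr0.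
  by move=> /locally_integrableD/(_ l2).
move=> [lu lv H] [lu' lv' H']; split; [exact: lin|exact: lin|].
move=> phi tphi; have tj := test_derive1n j tphi.
have [_ oU _] := lu; have mU := open_measurable oU.
have p1 u1 psi : locally_integrable U u1 -> test_function U psi ->
    mu.-integrable U (EFin \o (fun x => u1 x * psi x)).
  by move=> l1 tpsi; apply: (proj2 (L1_patchP _ mU)); exact: loc_test_L1.
have E u1 u2 psi : locally_integrable U u1 -> locally_integrable U u2 -> test_function U psi ->
  \int[mu]_(x in U) ((c * u1 x + u2 x) * psi x) =
  c * \int[mu]_(x in U) (u1 x * psi x) + \int[mu]_(x in U) (u2 x * psi x).
  move=> l1 l2 tpsi; have i1 := p1 _ _ l1 tpsi; have i2 := p1 _ _ l2 tpsi.
  have ci1 : mu.-integrable U (EFin \o (fun x => c * (u1 x * psi x))).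
    apply: (proj2 (L1_patchP _ mU)); have := L1Z c (loc_test_L1 l1 tpsi).
    by congr L1; apply/funext => x; rewrite !patchE; case: ifP; rewrite ?mulr0.
  rewrite -(@RintegralZl _ _ _ mu _ _ c mU i1) -(@RintegralD _ _ _ mu _ _ _ mU ci1 i2).
  by apply: eq_Rintegral => x _; rewrite mulrDl mulrA.
rewrite !E// H// H'//; move: (\int[mu]_(x in U) _) (\int[mu]_(x in U) _) => p q; ring.
Qed.

Lemma weak_unique j U u v u' v' : is_weak_derivative j U u v ->
  is_weak_derivative j U u' v' -> {ae mu, forall x, U x -> u x = u' x} ->
  {ae mu, forall x, U x -> v x = v' x}.
Proof.
move=> wu wu' uu'; have [lw lw' H] := weak_lin (-1) wu wu'.
have [_ oU _] := lw; have mU := open_measurable oU.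
have : {ae mu, forall x, U x -> -1 * v x + v' x = 0}.
  apply: weak_unique0 => // phi tphi.
  have := H phi tphi; rewrite (@ae_eq_Rintegral _ _ (fun=> 0)) => //.
  - rewrite Rintegral_cst// mul0r => /esym/eqP.
    by rewrite mulf_eq0 signr_eq0/= => /eqP.
  - apply: measurable_funM; first by case: lw.
    by apply: measurable_funTS; exact: test_measurable (test_derive1n j tphi).
  - by apply: (aeS uu') => x + Ux => -> //; rewrite mulN1r addNr mul0r.
move=> /aeS; apply => x /[apply]; rewrite mulN1r => /eqP.
by rewrite addrC subr_eq0 => /eqP.
Qed.

Lemma wderivP j U u v : is_weak_derivative j U u v -> is_weak_derivative j U u (wderiv j U u).
Proof. by move=> wu; apply: (@xgetPex _ (fun=> 0) [set v | is_weak_derivative j U u v]); exists v. Qed.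

Lemma wderiv_ae j U u v : is_weak_derivative j U u v ->
  {ae mu, forall x, U x -> wderiv j U u x = v x}.
Proof. by move=> wu; apply: (weak_unique (wderivP wu) wu); exact: aeW. Qed.

Lemma weak_id U u : locally_integrable U u -> is_weak_derivative 0 U u u.
Proof. by move=> lu; split => // phi _; rewrite expr0 mul1r. Qed.

(** The product is a test function, and the derivative of a test function has zero integral. *)
Lemma test_ibp U V phi psi : test_function U phi -> test_function V psi ->
  \int[mu]_x (phi x * derive1 psi x) = - \int[mu]_x (derive1 phi x * psi x).
Proof.
move=> tphi tpsi; have tpp := test_mul (test_smooth tphi) tpsi.
have dpp : derive1 (fun x => phi x * psi x) = fun x => phi x * derive1 psi x + derive1 phi x * psi x.
  apply: is_derive_derive1 => x.
  have h := is_deriveM (smooth_is_derive (test_smooth tphi) x) (smooth_is_derive (test_smooth tpsi) x).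
  by apply: (is_derive_eq h); rewrite /GRing.scale/= [X in _ + X]mulrC.
apply/eqP; rewrite -addr_eq0; apply/eqP.
rewrite -(Rintegral_derive1 tpp) dpp RintegralD//.
  exact: test_L1 (test_mul (test_smooth tphi) (test_derive1 tpsi)).
exact: test_L1 (test_mul (test_smooth (test_derive1 tphi)) tpsi).
Qed.

End WeakDerivatives.

(** * Second primitives as Sobolev functions *)

Section SobolevJets.
Variable R : realType.
Implicit Types (f g h phi psi z y u v w : R -> R) (x a b c d C L e q : R) (A U V : set R).
Local Notation mu := (@lebesgue_measure R).

Definition jet z (j : nat) : R -> R :=
  match j with 0 => prim (prim z) | 1 => prim z | _ => z end.

Lemma Rintegral_mul_le f h C : measurable_fun setT f -> (forall x, `|f x| <= C) -> L1 h ->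
  `|\int[mu]_x (f x * h x)| <= C * nrm1 h.
Proof.
move=> mf fC h1; have fh1 : L1 (fun x => f x * h x).
  by have := L1_mul h1 mf fC; congr L1; apply/funext => x; rewrite mulrC.
apply: (le_trans (le_Rintegral_nrm1 measurableT fh1)).
have C0 : 0 <= C by apply: le_trans (fC 0).
have -> : C * nrm1 h = nrm1 (fun x => C * h x) by rewrite nrm1Z// ger0_norm.
apply: nrm1_le => //; first exact: L1Z.
by move=> x; rewrite !normrM ler_wpM2r// (le_trans (fC x))// ler_norm.
Qed.

Section Jet.
Variables (U : set R) (L : R) (z : R -> R).
Hypotheses (L0 : 0 <= L) (UL : inball U L) (Jz : der2_0 U z).

Let z1 : L1 z := der2_0_L1 Jz.
Let pz1 : L1 (prim z) := der2_0_prim_L1 UL Jz.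
Let ppz1 : L1 (prim (prim z)) := der2_0_prim2_L1 L0 UL Jz.

(** The identity holds for the test functions psi approximating the second primitive; K collects the
    factors of the error made by replacing psi. *)
Lemma prim2_ibp V phi : test_function V phi ->
  \int[mu]_x (prim (prim z) x * derive1 phi x) = - \int[mu]_x (prim z x * phi x).
Proof.
move=> tphi; have phi1 := test_L1 tphi; have dphi1 := test_L1 (test_derive1 tphi).
apply/eqP; rewrite -subr_eq0 opprK -normr_eq0; apply/eqP/le_anti; rewrite normr_ge0 andbT.
pose K := 2 * L * nrm1 (derive1 phi) + nrm1 phi.
have K0 : 0 <= K by rewrite addr_ge0 ?mulr_ge0 ?nrm1_ge0.
apply: (@le0_eps _ _ K K0) => e e0; have [_ /(_ e e0)[psi tpsi epsi]] := Jz.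
have psi1 := test_L1 tpsi; have dpsi1 := test_L1 (test_derive1 tpsi).
have := test_ibp tpsi tphi => /eqP; rewrite -subr_eq0 opprK => /eqP ibp.
have [Cd Cd0 HCd] := test_bounded (test_derive1 tphi).
have [Cp Cp0 HCp] := test_bounded tphi.
have mdphi := test_measurable (test_derive1 tphi).
have mphi := test_measurable tphi.
have L1d f : L1 f -> L1 (fun x => f x * derive1 phi x) by move=> f1; exact: L1_mul HCd.
have L1p f : L1 f -> L1 (fun x => f x * phi x) by move=> f1; exact: L1_mul HCp.
have -> : \int[mu]_x (prim (prim z) x * derive1 phi x) + \int[mu]_x (prim z x * phi x) =
  \int[mu]_x ((prim (prim z) x - psi x) * derive1 phi x) +
  \int[mu]_x ((prim z x - derive1 psi x) * phi x).
  have -> : \int[mu]_x ((prim (prim z) x - psi x) * derive1 phi x) =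
     \int[mu]_x (prim (prim z) x * derive1 phi x) - \int[mu]_x (psi x * derive1 phi x).
    by rewrite -RintegralB//; [apply: eq_Rintegral => x _; rewrite mulrBl|exact: L1d|exact: L1d].
  have -> : \int[mu]_x ((prim z x - derive1 psi x) * phi x) =
     \int[mu]_x (prim z x * phi x) - \int[mu]_x (derive1 psi x * phi x).
    by rewrite -RintegralB//; [apply: eq_Rintegral => x _; rewrite mulrBl|exact: L1p|exact: L1p].
  rewrite addrACA -opprD ibp subr0//.
have b1 : `|\int[mu]_x ((prim (prim z) x - psi x) * derive1 phi x)| <= (2 * L * e) * nrm1 (derive1 phi).
  apply: Rintegral_mul_le => //; first exact: L1_measurable (L1B ppz1 psi1).
  move=> x; rewrite distrC; apply: le_trans (prim2_approx x L0 UL Jz tpsi) _.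
  by rewrite ler_wpM2l// mulr_ge0.
have b2 : `|\int[mu]_x ((prim z x - derive1 psi x) * phi x)| <= e * nrm1 phi.
  apply: Rintegral_mul_le => //; first exact: L1_measurable (L1B pz1 dpsi1).
  by move=> x; rewrite distrC; apply: le_trans (prim_approx x tpsi z1) _.
apply: (le_trans (ler_normD _ _)); rewrite (le_trans (lerD b1 b2))//.
rewrite le_eqVlt; apply/orP; left; apply/eqP; rewrite /K.
by move: (nrm1 _) (nrm1 _) => p r; ring.
Qed.

Lemma prim_ibp V phi : test_function V phi ->
  \int[mu]_x (prim z x * derive1 phi x) = - \int[mu]_x (z x * phi x).
Proof.
move=> tphi; have phi1 := test_L1 tphi; have dphi1 := test_L1 (test_derive1 tphi).
have [Cd Cd0 HCd] := test_bounded (test_derive1 tphi).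
have [Cp Cp0 HCp] := test_bounded tphi.
apply/eqP; rewrite -subr_eq0 opprK -normr_eq0; apply/eqP/le_anti; rewrite normr_ge0 andbT.
pose K := nrm1 (derive1 phi) + Cp.
have K0 : 0 <= K by rewrite addr_ge0 ?nrm1_ge0.
apply: (@le0_eps _ _ K K0) => e e0; have [_ /(_ e e0)[psi tpsi epsi]] := Jz.
have dpsi1 := test_L1 (test_derive1 tpsi); have ddpsi1 := test_L1 (test_derive1 (test_derive1 tpsi)).
have := test_ibp (test_derive1 tpsi) tphi => /eqP; rewrite -subr_eq0 opprK => /eqP ibp.
have mdphi := test_measurable (test_derive1 tphi).
have mphi := test_measurable tphi.
have L1d f : L1 f -> L1 (fun x => f x * derive1 phi x) by move=> f1; exact: L1_mul HCd.
have L1p f : L1 f -> L1 (fun x => f x * phi x) by move=> f1; exact: L1_mul HCp.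
have -> : \int[mu]_x (prim z x * derive1 phi x) + \int[mu]_x (z x * phi x) =
  \int[mu]_x ((prim z x - derive1 psi x) * derive1 phi x) +
  \int[mu]_x ((z x - derive1 (derive1 psi) x) * phi x).
  have -> : \int[mu]_x ((prim z x - derive1 psi x) * derive1 phi x) =
     \int[mu]_x (prim z x * derive1 phi x) - \int[mu]_x (derive1 psi x * derive1 phi x).
    by rewrite -RintegralB//; [apply: eq_Rintegral => x _; rewrite mulrBl|exact: L1d|exact: L1d].
  have -> : \int[mu]_x ((z x - derive1 (derive1 psi) x) * phi x) =
     \int[mu]_x (z x * phi x) - \int[mu]_x (derive1 (derive1 psi) x * phi x).
    by rewrite -RintegralB//; [apply: eq_Rintegral => x _; rewrite mulrBl|exact: L1p|exact: L1p].
  rewrite addrACA -opprD ibp subr0//.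
have b1 : `|\int[mu]_x ((prim z x - derive1 psi x) * derive1 phi x)| <= e * nrm1 (derive1 phi).
  apply: Rintegral_mul_le => //; first exact: L1_measurable (L1B pz1 dpsi1).
  by move=> x; rewrite distrC; apply: le_trans (prim_approx x tpsi z1) _.
have b2 : `|\int[mu]_x ((z x - derive1 (derive1 psi) x) * phi x)| <= Cp * e.
  under eq_Rintegral do rewrite mulrC.
  apply: (le_trans (Rintegral_mul_le mphi HCp (L1B z1 ddpsi1))).
  by rewrite ler_wpM2l// nrm1_sym.
apply: (le_trans (ler_normD _ _)); rewrite (le_trans (lerD b1 b2))//.
by rewrite /K mulrDl [e * _]mulrC.
Qed.

Hypotheses (oU : open U) (z0 : forall x, ~ U x -> z x = 0).

Lemma jet_eq0 j x : ~ U x -> jet z j x = 0.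
Proof.
move=> Ux; case: j => [|[|j]] /=; last exact: z0.
  exact: (der2_0_prim2_eq0 L0 UL Jz Ux).
exact: (der2_0_prim_eq0 Jz Ux).
Qed.

Lemma jet_L1 j : L1 (jet z j).
Proof. by case: j => [|[|j]]. Qed.

Lemma jet_patch j : jet z j \_ U = jet z j.
Proof.
apply/funext => x; rewrite patchE; case: ifPn => // /negP xU.
by rewrite jet_eq0// => Ux; apply: xU; exact/mem_set.
Qed.

Lemma jet_loc j : locally_integrable U (jet z j).
Proof. by apply: open_integrable_locally => //; apply: L1S; [exact: open_measurable|exact: jet_L1]. Qed.

Lemma Rintegral_jet j f : \int[mu]_(x in U) (jet z j x * f x) = \int[mu]_x (jet z j x * f x).
Proof.
rewrite Rintegral_mkcond; apply: eq_Rintegral => x _; rewrite patchE; case: ifPn => // /negP xU.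
by rewrite jet_eq0 ?mul0r// => Ux; apply: xU; exact/mem_set.
Qed.

Lemma jet_weak j : (j <= 2)%N -> is_weak_derivative j U (prim (prim z)) (jet z j).
Proof.
move=> j2; split; [exact: (jet_loc 0)|exact: jet_loc|].
move=> phi tphi; rewrite (Rintegral_jet j) (Rintegral_jet 0).
case: j j2 => [|[|[|//]]] _ /=.
- by rewrite expr0 mul1r.
- by rewrite expr1 mulN1r; exact: prim2_ibp tphi.
- by rewrite expr2 mulrN1 opprK mul1r (prim2_ibp (test_derive1 tphi)) (prim_ibp tphi) opprK.
Qed.

End Jet.

(** The norm of exponent +oo is defined as an essential supremum under this guard. *)
Lemma muT_gt0 : (0 < mu setT)%E.
Proof.
have := @lebesgue_measure_itv R `]0, 1[; rewrite /= lte_fin ltr01 oppr0 adde0 => h.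
apply: (@lt_le_trans _ _ (mu `]0, 1[)); first by rewrite h lte_fin.
by apply: le_measure; rewrite ?inE.
Qed.

Lemma Lnorm_oo_bounded U f : (Lnorm_on +oo%E U f < +oo)%E <->
  exists C, {ae mu, forall x, U x -> `|f x| <= C}.
Proof.
rewrite /Lnorm_on unlock muT_gt0; split.
  set s := ess_sup _ _ => s1.
  exists (fine s); have := ess_sup_ge mu (abse \o (EFin \o f \_ U)); rewrite -/s => /aeS.
  apply => x /=; rewrite patchE => + Ux; rewrite mem_set//.
  case: s s1 => [r| |] //=; rewrite ?lee_fin//.
move=> [C HC]; apply: (@le_lt_trans _ _ `|C|%:E); last exact: ltry.
apply/ess_supP; apply: (aeS HC) => x fx /=; rewrite patchE; case: ifPn => xU.
  by rewrite lee_fin (le_trans (fx _)) ?ler_norm//; exact: set_mem.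
by rewrite normr0 lee_fin.
Qed.

Lemma Lnorm_real q U f : q != 0 -> (Lnorm_on q%:E U f =
  (\int[mu]_x (`|(f \_ U) x| `^ q)%:E) `^ q^-1)%E.
Proof. by move=> q0; rewrite /Lnorm_on unlock; congr (_ `^ _)%E. Qed.

Lemma Lnorm1_on U f : L1 (f \_ U) -> Lnorm_on 1 U f = (nrm1 (f \_ U))%:E.
Proof.
move=> f1; rewrite /Lnorm_on Lnorm1 /nrm1 /Rintegral fineK//.
by apply: integrable_fin_num => //; exact: L1_norm.
Qed.

Lemma Lnorm1_L1 U f : measurable U -> measurable_fun U f -> (Lnorm_on 1 U f < +oo)%E -> L1 (f \_ U).
Proof.
move=> mU mf; rewrite /Lnorm_on Lnorm1 => foo; apply/integrableP; split=> //.
by apply/measurable_EFinP; apply/(measurable_restrictT _ _).1.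
Qed.

Lemma Lnorm_on_ae q U f g : 0 < q -> measurable U -> measurable_fun U f -> measurable_fun U g ->
  {ae mu, forall x, U x -> f x = g x} -> Lnorm_on q%:E U f = Lnorm_on q%:E U g.
Proof.
move=> q0 mU mf mg fg; have q1 : q != 0 by rewrite gt_eqF.
rewrite (Lnorm_real U f q1) (Lnorm_real U g q1).
suff -> : (\int[mu]_x (`|(f \_ U) x| `^ q)%:E = \int[mu]_x (`|(g \_ U) x| `^ q)%:E)%E by [].
have m1 h : measurable_fun U h -> measurable_fun setT (fun x => (`|(h \_ U) x| `^ q)%:E).
  move=> mh; apply/measurable_EFinP.
  apply: (measurableT_comp (measurable_powR q)).
  by apply: measurableT_comp => //; apply/(measurable_restrictT _ _).1.
apply: ge0_ae_eq_integral => //; [exact: m1|exact: m1|].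
  apply: (aeS fg) => x fx _; rewrite !patchE; case: ifPn => // xU.
  by rewrite fx//; exact: set_mem.
Qed.

End SobolevJets.

(** * Bounded second derivatives and the space [W2oo0] *)

Section Admissible.
Variable R : realType.
Implicit Types (f g h phi psi z y u v w : R -> R) (x a b c d C e q : R) (A V : set R).
Local Notation mu := (@lebesgue_measure R).

(** The bound and the vanishing hold everywhere, so that moments and pointwise hulls involve no
    exceptional sets. By [adm_W2oo0] and [W2oo0_adm] the second primitives of such z represent
    [W2oo0 U] when U is open and bounded. *)
Definition adm U z := [/\ measurable_fun setT z, exists C : R, forall x, `|z x| <= C,
  forall x, ~ U x -> z x = 0 & der2_0 U z].

Lemma admS U V z : U `<=` V -> adm U z -> adm V z.
Proof.
move=> UV [mz bz z0 Jz]; split => //; last exact: der2_0S Jz.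
by move=> x Vx; apply: z0 => /UV.
Qed.

Lemma adm_lin U c z y : adm U z -> adm U y -> adm U (fun x => c * z x + y x).
Proof.
move=> [mz [C Cz] z0 Jz] [my [D Dy] y0 Jy]; split.
- by apply: measurable_funD => //; exact: measurable_funM.
- exists (`|c| * C + D) => x; apply: (le_trans (ler_normD _ _)).
  by rewrite normrM lerD// ler_wpM2l.
- by move=> x Ux; rewrite z0// y0// mulr0 addr0.
- exact: der2_0_lin.
Qed.

Lemma adm0 U : adm U (fun=> 0).
Proof. by split => //; [exists 0 => x; rewrite normr0|exact: der2_0_0]. Qed.

Lemma admD U z y : adm U z -> adm U y -> adm U (fun x => z x + y x).
Proof.
move=> az ay; have := adm_lin 1 az ay; congr adm.
by apply/funext => x; rewrite mul1r.
Qed.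

Lemma admB U z y : adm U z -> adm U y -> adm U (fun x => z x - y x).
Proof.
move=> az ay; have := adm_lin (-1) ay az; congr adm.
by apply/funext => x; rewrite mulN1r addrC.
Qed.

Lemma adm_der2_0 U z : adm U z -> der2_0 U z.
Proof. by case. Qed.

Lemma adm_L1 U z : adm U z -> L1 z.
Proof. by move=> /adm_der2_0/der2_0_L1. Qed.

Lemma measurable_le_set f g : measurable_fun setT f -> measurable_fun setT g ->
  measurable [set x | f x <= g x].
Proof. by move=> mf mg; rewrite -[X in measurable X]setTI; exact: measurable_fun_le. Qed.

Lemma cvge0_le (f : nat -> \bar R) (C : R) : (forall n, (0 <= f n)%E) ->
  (forall n, (f n <= (C * n.+1%:R^-1)%:E)%E) -> f n @[n --> \oo] --> 0%E.
Proof.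
move=> f0 fC; apply: (@squeeze_cvge _ _ _ _ (cst 0%E) _ (fun n => (C * n.+1%:R^-1)%:E)).
- by apply: nearW => n; rewrite f0 fC.
- exact: cvg_cst.
- apply: cvg_EFin; first exact: nearW.
  rewrite -[X in _ --> X](mulr0 C); apply: cvgM; [exact: cvg_cst|exact: cvg_harmonic].
Qed.

Variables (U : set R) (L : R).
Hypotheses (L0 : 0 <= L) (UL : inball U L) (oU : open U).

Let mU : measurable U := open_measurable oU.

Lemma measureU_lty : (mu U < +oo)%E.
Proof.
apply: (@le_lt_trans _ _ (mu `[- L, L])); last exact: measure_itv_lty.
by apply: le_measure; rewrite ?inE// => x /UL; rewrite ler_norml /= in_itv.
Qed.

Lemma sobolev_normE q u (v : nat -> R -> R) : 0 < q ->
  (forall j, (j <= 2)%N -> is_weak_derivative j U u (v j)) ->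
  sobolev_norm 2 q%:E U u =
  (Lnorm_on q%:E U (v 0%N) + Lnorm_on q%:E U (v 1%N) + Lnorm_on q%:E U (v 2%N))%E.
Proof.
move=> q0 wv; rewrite /sobolev_norm !big_ord_recr big_ord0 /= add0e.
have E j : (j <= 2)%N -> Lnorm_on q%:E U (wderiv j U u) = Lnorm_on q%:E U (v j).
  move=> j2; have wj := wv j j2; apply: Lnorm_on_ae => //.
  - by have [_ []] := wderivP wj.
  - by have [_ []] := wj.
  - exact: wderiv_ae.
by rewrite !E.
Qed.

Lemma nrm1_prim z : der2_0 U z -> nrm1 (prim z) <= 2 * L * nrm1 z.
Proof.
move=> Jz; apply: nrm1_sup => //.
- exact: L1_measurable (der2_0_prim_L1 UL Jz).
- by move=> x; apply: le_prim; exact: der2_0_L1 Jz.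
- by move=> x Lx; apply: (der2_0_prim_eq0 Jz); exact: inball_eq0 Lx.
Qed.

Lemma nrm1_prim2 z : der2_0 U z -> nrm1 (prim (prim z)) <= 2 * L * (2 * L * nrm1 z).
Proof.
move=> Jz; apply: nrm1_sup => //.
- exact: L1_measurable (der2_0_prim2_L1 L0 UL Jz).
- by move=> x; exact: (le_prim2 x L0 UL Jz).
- by move=> x Lx; apply: (der2_0_prim2_eq0 L0 UL Jz); exact: inball_eq0 Lx.
Qed.

Lemma sobolev_norm1_prim2 z : der2_0 U z -> (forall x, ~ U x -> z x = 0) ->
  sobolev_norm 2 1%E U (prim (prim z)) =
  (nrm1 (prim (prim z)) + nrm1 (prim z) + nrm1 z)%:E.
Proof.
move=> Jz z0; rewrite -[1%E]/(1%:E) (@sobolev_normE _ _ (jet z))//; last first.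
  by move=> j; exact: (jet_weak L0 UL Jz oU z0).
have E j : Lnorm_on 1%:E U (jet z j) = (nrm1 (jet z j))%:E.
  rewrite Lnorm1_on (jet_patch L0 UL Jz z0)//; exact: (jet_L1 L0 UL Jz).
by rewrite !E -!EFinD.
Qed.

Lemma prim2_derive2 phi : test_function U phi -> prim (prim (derive1 (derive1 phi))) = phi.
Proof.
move=> tphi; have -> : prim (derive1 (derive1 phi)) = derive1 phi.
  by apply/funext => x; exact: prim_derive1 (test_derive1 tphi).
by apply/funext => x; exact: prim_derive1 tphi.
Qed.

Lemma prim2B z y : der2_0 U z -> der2_0 U y ->
  prim (prim (fun x => z x - y x)) = fun x => prim (prim z) x - prim (prim y) x.
Proof.
move=> Jz Jy; have -> : prim (fun x => z x - y x) = fun x => prim z x - prim y x.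
  by apply/funext => x; exact: (primB _ (der2_0_L1 Jz) (der2_0_L1 Jy)).
by apply/funext => x; exact: (primB _ (der2_0_prim_L1 UL Jz) (der2_0_prim_L1 UL Jy)).
Qed.

Lemma prim2_lin c z y : der2_0 U z -> der2_0 U y ->
  prim (prim (fun x => c * z x + y x)) = fun x => c * prim (prim z) x + prim (prim y) x.
Proof.
move=> Jz Jy; have -> : prim (fun x => c * z x + y x) = fun x => c * prim z x + prim y x.
  by apply/funext => x; exact: (prim_lin _ _ (der2_0_L1 Jz) (der2_0_L1 Jy)).
by apply/funext => x; exact: (prim_lin _ _ (der2_0_prim_L1 UL Jz) (der2_0_prim_L1 UL Jy)).
Qed.

Lemma jet_bounded z j C : der2_0 U z -> (forall x, `|z x| <= C) ->
  exists D, forall x, `|jet z j x| <= D.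
Proof.
move=> Jz zC; case: j => [|[|j]] /=.
- by exists (2 * L * nrm1 z) => x; exact: (le_prim2 x L0 UL Jz).
- by exists (nrm1 z) => x; apply: le_prim; exact: der2_0_L1 Jz.
- by exists C.
Qed.

Lemma adm_W2oo0 z : adm U z -> W2oo0 U (prim (prim z)).
Proof.
move=> [mz [C zC] z0 Jz]; split.
  move=> j j2; exists (jet z j); first exact: (jet_weak L0 UL Jz oU z0).
  have [D HD] := jet_bounded j Jz zC.
  by apply/Lnorm_oo_bounded; exists D; apply: aeW => x _.
split.
  move=> j j2; exists (jet z j); first exact: (jet_weak L0 UL Jz oU z0).
  rewrite Lnorm1_on ?ltry// (jet_patch L0 UL Jz z0); exact: (jet_L1 L0 UL Jz).
have /choice[phi_ Hphi] : forall n : nat, exists phi, test_function U phi /\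
    nrm1 (fun x => derive1 (derive1 phi) x - z x) <= n.+1%:R^-1.
  by move=> n; have [_ /(_ n.+1%:R^-1)[|phi ? ?]] := Jz; [rewrite invr_gt0|exists phi].
exists phi_; split; first by move=> n; have [] := Hphi n.
have Jd n : der2_0 U (fun x => z x - derive1 (derive1 (phi_ n)) x).
  by apply: der2_0B => //; apply: test_der2_0; have [] := Hphi n.
have E n : prim (prim z) \- phi_ n = prim (prim (fun x => z x - derive1 (derive1 (phi_ n)) x)).
  have [tn _] := Hphi n.
  by rewrite (prim2B Jz (test_der2_0 tn)) (prim2_derive2 tn).
have d0 n x : ~ U x -> z x - derive1 (derive1 (phi_ n)) x = 0.
  move=> Ux; have [tn _] := Hphi n.
  by rewrite z0// (test_eq0 (test_derive1 (test_derive1 tn)) Ux) subr0.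
apply: (@cvge0_le _ (2 * L * (2 * L) + 2 * L + 1)) => n.
  by rewrite E (sobolev_norm1_prim2 (Jd n) (d0 n)) lee_fin !addr_ge0// nrm1_ge0.
rewrite E (sobolev_norm1_prim2 (Jd n) (d0 n)) lee_fin.
have [_] := Hphi n; rewrite nrm1_sym => H.
have h2 := nrm1_prim2 (Jd n); have h1 := nrm1_prim (Jd n).
have A0 : 0 <= 2 * L by rewrite mulr_ge0.
move: (2 * L) A0 h1 h2 => A A0 h1 h2.
rewrite (mulrDl (_ + _)) (mulrDl (A * A)) mul1r !lerD//.
  by apply: le_trans h2 _; rewrite -mulrA !ler_wpM2l.
by apply: le_trans h1 _; rewrite ler_wpM2l.
Qed.

(** Setting z to zero where the bound fails changes it only on a null set. *)
Lemma der2_0_adm z C : der2_0 U z -> (forall x, ~ U x -> z x = 0) ->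
  {ae mu, forall x, `|z x| <= `|C|} -> exists2 y, adm U y & {ae mu, forall x, z x = y x}.
Proof.
move=> Jz z0 zC; pose S := [set x | `|z x| <= `|C|].
have mz := L1_measurable (der2_0_L1 Jz).
have mS : measurable S.
  apply: measurable_le_set; last exact: measurable_cst.
  exact: measurableT_comp.
have zy : {ae mu, forall x, z x = (z \_ S) x}.
  by apply: (aeS zC) => x zx; rewrite patchE mem_set.
have y1 : L1 (z \_ S) by apply: L1_patch => //; exact: der2_0_L1 Jz.
exists (z \_ S) => //; split.
- exact: L1_measurable.
- exists `|C| => x; rewrite patchE; case: ifPn => [|_]; last by rewrite normr0.
  by rewrite inE.
- by move=> x Ux; rewrite patchE z0//; case: ifP.
- by apply: der2_0_ae zy Jz; exact: L1_measurable.
Qed.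

(** The second derivatives of the approximating test functions converge in L^1 to [v2] extended by
    zero, which therefore satisfies [der2_0]. The test functions themselves converge uniformly to
    its second primitive and in L^1 to w. *)
Lemma W2oo0_adm w : W2oo0 U w -> exists2 z, adm U z &
  {ae mu, forall x, U x -> w x = prim (prim z) x}.
Proof.
move=> [Woo [W1 [phi_ [tphi cphi]]]].
have [v0 wv0 n0] := W1 0%N isT; have [v1 wv1 n1] := W1 1%N isT; have [v2 wv2 n2] := W1 2%N isT.
have mv v j : is_weak_derivative j U w v -> measurable_fun U v by move=> [_ []].
pose v j := match j with 0 => v0 | 1 => v1 | _ => v2 end.
pose ph n j := jet (derive1 (derive1 (phi_ n))) j.
have Jphi n : der2_0 U (derive1 (derive1 (phi_ n))) by apply: test_der2_0.
have phi0 n x : ~ U x -> derive1 (derive1 (phi_ n)) x = 0.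
  exact: test_eq0 (test_derive1 (test_derive1 (tphi n))).
have wd n j : (j <= 2)%N -> is_weak_derivative j U (w \- phi_ n) (fun x => -1 * ph n j x + v j x).
  move=> j2; have wphi := jet_weak L0 UL (Jphi n) oU (phi0 n) j2.
  rewrite prim2_derive2// in wphi.
  have wj : is_weak_derivative j U w (v j) by case: j j2 {wphi} => [|[|[|]]].
  have := weak_lin (-1) wphi wj; congr is_weak_derivative.
  by apply/funext => x; rewrite mulN1r addrC.
have L1v j : (j <= 2)%N -> L1 (v j \_ U).
  by case: j => [|[|[|//]]] _ /=; apply: Lnorm1_L1 => //; [exact: mv wv0|exact: mv wv1|exact: mv wv2].
have L1d n j : (j <= 2)%N -> L1 ((fun x => -1 * ph n j x + v j x) \_ U).
  move=> j2; have := L1_lin (-1) (jet_L1 L0 UL (Jphi n) j) (L1v j j2).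
  congr L1; apply/funext => x; rewrite !patchE; case: ifPn => // /negP xU.
  rewrite addr0 (jet_eq0 L0 UL (Jphi n) (phi0 n)) ?mulr0// => Ux.
  by apply: xU; exact/mem_set.
have nE n : sobolev_norm 2 1%E U (w \- phi_ n) =
   (nrm1 ((fun x => -1 * ph n 0%N x + v 0%N x) \_ U) + nrm1 ((fun x => -1 * ph n 1%N x + v 1%N x) \_ U)
    + nrm1 ((fun x => -1 * ph n 2%N x + v 2%N x) \_ U))%:E.
  rewrite -[1%E]/(1%:E) (sobolev_normE ltr01 (wd n)).
  by rewrite !Lnorm1_on ?L1d// -!EFinD.
have small e : 0 < e -> exists n, nrm1 ((fun x => -1 * ph n 0%N x + v 0%N x) \_ U) <= e /\
    nrm1 ((fun x => -1 * ph n 2%N x + v 2%N x) \_ U) <= e.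
  move=> e0; have [N /(_ N (leqnn N))] := cvg0_le (fine_cvg cphi) e0.
  rewrite /= nE /= => /ler_normlW h; exists N.
  have := nrm1_ge0 ((fun x => -1 * ph N 0%N x + v 0%N x) \_ U).
  have := nrm1_ge0 ((fun x => -1 * ph N 1%N x + v 1%N x) \_ U).
  have := nrm1_ge0 ((fun x => -1 * ph N 2%N x + v 2%N x) \_ U).
  by move: h; rewrite /=; lra.
pose z0 := v2 \_ U.
have z01 : L1 z0 by exact: (L1v 2%N).
have d2 n : nrm1 ((fun x => -1 * ph n 2%N x + v 2%N x) \_ U) =
     nrm1 (fun x => derive1 (derive1 (phi_ n)) x - z0 x).
  rewrite nrm1_sym; apply: eq_nrm1 => x; rewrite /z0 !patchE; case: ifPn => [_|/negP xU].
    by rewrite mulN1r addrC.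
  by rewrite phi0 ?subrr// => Ux; apply: xU; exact/mem_set.
have Jz0 : der2_0 U z0.
  split=> // e e0; have [n [_ n2']] := small e e0.
  by exists (phi_ n) => //; rewrite -d2.
have [v2' wv2' /Lnorm_oo_bounded[C HC]] := Woo 2%N isT.
have v2C : {ae mu, forall x, U x -> `|v2 x| <= C}.
  apply: (aeS2 HC (weak_unique wv2 wv2' (aeW (fun x _ => erefl)))).
  by move=> x h1 h2 Ux; rewrite h2// h1.
have [z az zz0] : exists2 z, adm U z & {ae mu, forall x, z0 x = z x}.
  apply: (@der2_0_adm _ C) => //; first by move=> x Ux; rewrite /z0 patchE memNset.
  apply: (aeS v2C) => x vx; rewrite /z0 patchE; case: ifPn => xU.
    by rewrite (le_trans (vx _)) ?ler_norm//; exact: set_mem.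
  by rewrite normr0.
exists z => //; have mz0 := L1_measurable z01; have [mz _ _ Jz] := az.
have ppE x : prim (prim z) x = prim (prim z0) x.
  by congr (prim _ x); apply/funext => t; apply: ae_eq_prim => //; apply: (aeS zz0) => s ->.
have w0 : {ae mu, forall x, ((fun x => v0 x - prim (prim z0) x) \_ U) x = 0}.
  have L1w : L1 ((fun x => v0 x - prim (prim z0) x) \_ U).
    have := L1B (L1v 0%N isT) (L1_patch mU (der2_0_prim2_L1 L0 UL Jz0)).
    by congr L1; apply/funext => x; rewrite !patchE; case: ifP => //; rewrite subr0.
  apply: nrm1_eq0 => //; apply/le_anti; rewrite nrm1_ge0 andbT.
  have K0 : 0 <= 1 + 2 * L * (2 * L) by rewrite addr_ge0// !mulr_ge0.
  apply: (@le0_eps _ _ _ K0) => e e0; have [n [h0 h2]] := small e e0.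
  have Jd : der2_0 U (fun x => derive1 (derive1 (phi_ n)) x - z0 x) by exact: der2_0B.
  have ppd : prim (prim (fun x => derive1 (derive1 (phi_ n)) x - z0 x)) = fun x => phi_ n x - prim (prim z0) x.
    by rewrite prim2B// prim2_derive2.
  have pd1 : L1 (fun x => phi_ n x - prim (prim z0) x).
    by rewrite -ppd; exact: der2_0_prim2_L1 L0 UL Jd.
  apply: (@le_trans _ _ (nrm1 ((fun x => -1 * ph n 0%N x + v 0%N x) \_ U) + nrm1 (fun x => phi_ n x - prim (prim z0) x))).
    apply: le_trans (nrm1_add (L1d n 0%N isT) pd1); apply: nrm1_le => //.
      by apply: L1D => //; exact: L1d.
    move=> x; rewrite !patchE; case: ifPn => xU; last by rewrite normr0.
    have -> : ph n 0%N x = phi_ n x by rewrite /ph /= prim2_derive2.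
    rewrite [X in _ <= `|X|](_ : _ = v0 x - prim (prim z0) x)// /v.
    by move: (phi_ n x) (v0 x) (prim (prim z0) x) => p q r; ring.
  rewrite mulrDl mul1r lerD//.
  rewrite -ppd; apply: (le_trans (nrm1_prim2 Jd)).
  have A0 : 0 <= 2 * L by rewrite mulr_ge0.
  rewrite d2 in h2; move: (2 * L) A0 => A A0.
  by rewrite -[leRHS]mulrA !ler_wpM2l.
have wv : {ae mu, forall x, U x -> w x = v0 x}.
  have [lw _ _] := wv0.
  by apply: weak_unique (weak_id lw) wv0 _; exact: aeW.
apply: (aeS2 w0 wv) => x + h Ux; rewrite patchE mem_set// => /eqP.
by rewrite subr_eq0 h// ppE => /eqP.
Qed.

End Admissible.

(** * Convex combinations of bounded sequences *)

Section Komlos.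
Variable R : realType.
Implicit Types (f g h z y u v w k : R -> R) (x a b c d C L e : R) (A U : set R).
Local Notation mu := (@lebesgue_measure R).

Lemma geometric_half_le n : \sum_(i < n) (2^-1 : R) ^+ i <= 2.
Proof.
have -> : \sum_(i < n) (2^-1 : R) ^+ i = 2 - 2 * 2^-1 ^+ n.
  elim: n => [|n IHn]; first by rewrite big_ord0 expr0 mulr1 subrr.
  rewrite big_ord_recr/= IHn exprS mulrA divff ?mul1r ?pnatr_eq0//; lra.
by rewrite gerBl mulr_ge0// exprn_ge0.
Qed.

(** Riesz-Fischer: the absolute increments have an integrable sum [S]; where [S] is finite the
    telescoping series converges, dominated by |G 0| + S. *)
Lemma L1_complete (G : nat -> R -> R) : (forall n, L1 (G n)) ->
  (forall n, nrm1 (fun x => G n.+1 x - G n x) <= 2^-1 ^+ n) ->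
  exists k, [/\ L1 k, nrm1 (fun x => G n x - k x) @[n --> \oo] --> 0 &
    {ae mu, forall x, G n x @[n --> \oo] --> k x}].
Proof.
move=> G1 Gn; pose D n x : R := `|G n.+1 x - G n x|.
have D0 n x : 0 <= D n x by exact: normr_ge0.
have D1 n : L1 (D n) by apply: L1_norm; exact: L1B.
have mD n : measurable_fun setT (fun x => (D n x)%:E).
  by apply/measurable_EFinP; exact: L1_measurable (D1 n).
pose S x : \bar R := (\sum_(n <oo) (D n x)%:E)%E.
have S0 x : (0 <= S x)%E by apply: nneseries_ge0 => n _ _; rewrite lee_fin ?D0.
have mS : measurable_fun setT S.
  apply: ge0_emeasurable_sum => n; last by move=> _; exact: mD.
  by move=> x _ _; rewrite lee_fin ?D0.
have intS : (\int[mu]_x S x <= 2%:E)%E.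
  rewrite integral_nneseries//; last first.
  - by move=> n x _; rewrite lee_fin ?D0.
  apply: lime_le; first by apply: is_cvg_nneseries => n _ _; apply: integral_ge0 => x _; rewrite lee_fin ?D0.
  apply: nearW => n; rewrite big_mkord.
  have -> : (\sum_(i < n) \int[mu]_x (D i x)%:E = \sum_(i < n) (nrm1 (fun x => G i.+1 x - G i x))%:E)%E.
    apply: eq_bigr => i _; rewrite /nrm1 /Rintegral fineK//.
    by apply: integrable_fin_num => //; exact: D1.
  rewrite sumEFin lee_fin; apply: le_trans (geometric_half_le n).
  by apply: ler_sum => i _; exact: Gn.
have iS : mu.-integrable setT S.
  apply/integrableP; split => //; under eq_integral do rewrite gee0_abs//.
  exact: le_lt_trans intS (ltry _).
have Sfin : {ae mu, forall x, S x \is a fin_num}.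
  by apply: (aeS (integrable_ae measurableT iS)) => x; exact.
have DS n x : (\sum_(i < n) (D i x)%:E <= S x)%E.
  have := @nneseries_lim_ge _ (fun i => (D i x)%:E) xpredT 0%N n.
  by rewrite big_mkord; apply => i _ _; rewrite lee_fin ?D0.
have Gseries n x : G n x = G 0%N x + series (fun i => G i.+1 x - G i x) n.
  by rewrite /series/= telescope_sumr// addrC subrK.
have cvG x : S x \is a fin_num -> cvgn (fun n => G n x).
  move=> Sx; have cs : cvgn (series (fun i => G i.+1 x - G i x)).
    apply: normed_cvg; apply: nondecreasing_is_cvgn.
      by apply: nondecreasing_series => n _ _; exact: normr_ge0.
    exists (fine (S x)) => _ [n _ <-]; rewrite -lee_fin fineK//.
    by apply: le_trans (DS n x); rewrite /normed_series_of seriesEord sumEFin.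
  have -> : (fun n => G n x) = (fun n => G 0%N x + series (fun i => G i.+1 x - G i x) n).
    by apply/funext => n; exact: Gseries.
  by apply: is_cvgD => //; exact: is_cvg_cst.
pose E := [set x | S x \is a fin_num].
have mE : measurable E.
  by rewrite -[E]setTI; apply: emeasurable_fin_num.
pose k x : R := if x \in E then limn (fun n => G n x) else 0.
have mk : measurable_fun setT k.
  apply: (@measurable_fun_cvg _ _ _ _ (fun n => G n \_ E)).
    by move=> n; apply: L1_measurable; exact: L1_patch.
  move=> x _; rewrite /k; case: ifPn => xE.
    have -> : (fun n => (G n \_ E) x) = fun n => G n x by apply/funext => n; rewrite patchE xE.
    by apply: cvG; exact: set_mem.
  have -> : (fun n => (G n \_ E) x) = fun n => 0 by apply/funext => n; rewrite patchE (negbTE xE).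
  exact: cvg_cst.
have Gk : {ae mu, forall x, G n x @[n --> \oo] --> k x}.
  by apply: (aeS Sfin) => x Sx; rewrite /k mem_set//; exact: cvG.
pose B x : R := `|G 0%N x| + fine (S x).
have fS1 : L1 (fun x => fine (S x)).
  apply/integrableP; split.
    by apply/measurable_EFinP; exact: (measurableT_comp (fine_measurable measurableT) mS).
  apply: le_lt_trans (le_lt_trans intS (ltry 2)); apply: ge0_le_integral => //.
  - by do 2 apply: measurableT_comp => //; exact: measurableT_comp.
  - move=> x _ /=; case: (S x) (S0 x) => [r| |] //=; last by rewrite normr0 leey.
    by rewrite !lee_fin => r0; rewrite ger0_norm.
have mG n : measurable_fun setT (G n) by exact: L1_measurable.
have B1 : L1 B by apply: L1D => //; exact: L1_norm.
have GB : {ae mu, forall x, forall n, `|G n x| <= B x}.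
  apply: (aeS Sfin) => x Sx n; rewrite Gseries (le_trans (ler_normD _ _))// lerD2l.
  rewrite -lee_fin fineK//; apply: le_trans (DS n x).
  by rewrite sumEFin lee_fin seriesEord; exact: ler_norm_sum.
by have [L1k cv] := dct mG mk B1 Gk GB; exists k.
Qed.

(** Only midpoints are formed: a property of all terms from n on passes to the hull as soon as one
    midpoint preserves it, and the parallelogram law asks for no other combination. *)
Inductive hull (f : nat -> R -> R) (n : nat) : (R -> R) -> Prop :=
| hull_in m : (n <= m)%N -> hull f n (f m)
| hull_mid g h : hull f n g -> hull f n h -> hull f n (fun x => 2^-1 * g x + 2^-1 * h x).

Lemma hull_le (f : nat -> R -> R) m n g : (m <= n)%N -> hull f n g -> hull f m g.
Proof.
move=> mn; elim=> [p np|u v _ hu _ hv]; first by apply: hull_in; exact: leq_trans np.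
exact: hull_mid.
Qed.

(* Bounded measurable functions supported in [[-L, L]]: all their powers are
   integrable. *)
Definition tame L f := [/\ measurable_fun setT f, exists C : R, forall x, `|f x| <= C &
  forall x, L < `|x| -> f x = 0].

Lemma tame_lin L c f g : tame L f -> tame L g -> tame L (fun x => c * f x + g x).
Proof.
move=> [mf [C fC] f0] [mg [D gD] g0]; split.
- by apply: measurable_funD => //; exact: measurable_funM.
- exists (`|c| * C + D) => x; apply: (le_trans (ler_normD _ _)).
  by rewrite normrM lerD// ler_wpM2l.
- by move=> x Lx; rewrite f0// g0// mulr0 addr0.
Qed.

Lemma tame0 L : tame L (fun=> 0).
Proof. by split => //; exists 0 => x; rewrite normr0. Qed.

Lemma tameZ L c f : tame L f -> tame L (fun x => c * f x).
Proof.
by move=> tf; have := tame_lin c tf (tame0 L); congr tame; apply/funext => x; rewrite addr0.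
Qed.

Lemma tame_L1 L f : tame L f -> L1 f.
Proof. by move=> [mf [C fC] f0]; exact: L1_bounded fC f0. Qed.

Lemma tame_sqr_L1 L f : tame L f -> L1 (fun x => f x ^+ 2).
Proof.
move=> [mf [C fC] f0]; apply: (@L1_bounded _ _ (C ^+ 2) L).
- exact: measurable_funX.
- by move=> x; rewrite normrX lerXn2r ?nnegrE// (le_trans _ (fC x)).
- by move=> x Lx; rewrite f0// expr0n.
Qed.

Lemma hull_tame (f : nat -> R -> R) n g L : (forall n, tame L (f n)) -> hull f n g -> tame L g.
Proof.
move=> tf; elim => // u v _ tu _ tv.
by apply: tame_lin => //; exact: tameZ.
Qed.

Definition sq f := \int[mu]_x (f x ^+ 2).

Lemma sq_ge0 f : 0 <= sq f.
Proof. by apply: Rintegral_ge0 => x _; exact: sqr_ge0. Qed.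

Lemma sq_parallelogram L f g : tame L f -> tame L g ->
  sq (fun x => f x - g x) = 2 * sq f + 2 * sq g - 4 * sq (fun x => 2^-1 * f x + 2^-1 * g x).
Proof.
move=> tf tg.
have tm : tame L (fun x => 2^-1 * f x + 2^-1 * g x) by apply: tame_lin => //; exact: tameZ.
have f2 := tame_sqr_L1 tf; have g2 := tame_sqr_L1 tg; have m2 := tame_sqr_L1 tm.
rewrite /sq -(RintegralZl 2 _ f2)// -(RintegralZl 2 _ g2)// -(RintegralZl 4 _ m2)//.
rewrite -RintegralD//; [|exact: L1Z|exact: L1Z].
rewrite -RintegralB//; [|by apply: L1D; exact: L1Z|exact: L1Z].
by apply: eq_Rintegral => x _; move: (f x) (g x) => p q; field.
Qed.

(** Integrates |f| <= e / 2 + f^2 / e over [[-L, L]]; the free parameter e turns smallness in L^2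
    into smallness in L^1. *)
Lemma nrm1_sq L f e : 0 <= L -> 0 < e -> tame L f -> nrm1 f <= L * e + e^-1 * sq f.
Proof.
move=> L0 e0 tf; have [mf _ f0] := tf; have f2 := tame_sqr_L1 tf.
have c1 : L1 ((fun=> e / 2) \_ `[- L, L]).
  apply: (proj1 (L1_patchP _ (measurable_itv `[- L, L]))).
  apply: measurable_bounded_integrable => //; first exact: measure_itv_lty.
  exists (e / 2); split; first by rewrite num_real.
  by move=> y Cy x _ /=; rewrite ger0_norm ?divr_ge0 ?ltW.
have ->: L * e = \int[mu]_x ((fun=> e / 2) \_ `[- L, L]) x.
  rewrite -Rintegral_mkcond Rintegral_cst//= lebesgue_measure_itv/= lte_fin.
  case: ifPn => h; first by rewrite -EFinD/=; field.
  by rewrite (_ : L = 0) ?mulr0 ?mul0r//; lra.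
rewrite /sq -(RintegralZl _ _ f2)// -RintegralD//; last exact: L1Z.
apply: le_Rintegral => //.
- exact/L1_norm/(tame_L1 tf).
- by apply: L1D => //; exact: L1Z.
- move=> x _; rewrite patchE; case: ifPn => [_|]; last first.
    rewrite notin_setE/= in_itv/= => /negP; rewrite -ler_norml -ltNge => /f0 ->.
    by rewrite normr0 add0r expr0n/= mulr0.
  rewrite -(@ler_pM2l _ (2 * e)) ?mulr_gt0// mulrDr [leRHS](_ : _ = e ^+ 2 + 2 * `|f x| ^+ 2); last first.
    by rewrite -normrX (ger0_norm (sqr_ge0 _)); field; rewrite gt_eqF.
  by have := sqr_ge0 (e - `|f x|); nra.
Qed.

(* In a Hilbert space, almost minimal elements of the convex hulls of the tails
   of a bounded sequence form a Cauchy sequence, by the parallelogram law. *)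
Lemma komlos (f : nat -> R -> R) L C : 0 <= L -> (forall n, tame L (f n)) -> (forall n, sq (f n) <= C) ->
  exists g : nat -> R -> R, exists k, [/\ forall n, hull f n (g n), L1 k,
    nrm1 (fun x => g n x - k x) @[n --> \oo] --> 0 &
    {ae mu, forall x, g n x @[n --> \oo] --> k x}].
Proof.
move=> L0 tf fC.
pose D n := [set r | exists2 h, hull f n h & r = sq h].
have D0 n : D n !=set0 by exists (sq (f n)), (f n) => //; exact: hull_in.
have Dlb n : has_inf (D n) by split=> //; exists 0 => _ [h _ ->]; exact: sq_ge0.
pose d n := inf (D n).
have dle n h : hull f n h -> d n <= sq h.
  by move=> hh; apply: ge_inf; [exact: (proj2 (Dlb n))|exists h].
have dC n : d n <= C by apply: le_trans (fC n); apply: dle; exact: hull_in.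
have dmon : {homo d : m n / (m <= n)%N >-> m <= n}.
  move=> m n mn; apply: lb_le_inf => // _ [h hh ->]; apply: dle; exact: hull_le hh.
have cvd : cvgn d.
  by apply: nondecreasing_is_cvgn => //; exists C => _ [n _ <-].
have /choice[G HG] n : exists h, hull f n h /\ sq h <= d n + n.+1%:R^-1.
  have [_ [h hh ->] sh] := @inf_adherent _ (D n) (n.+1%:R^-1) ltac:(by rewrite invr_gt0) (Dlb n).
  by exists h; split => //; exact: ltW.
have tG n : tame L (G n) by have [h _] := HG n; exact: hull_tame h.
(* The midpoint of [G m] and [G n] is in the hull of the tail at m, so its square integral is at
   least [d m]. Almost minimality contributes 4 e / 8 and twice [d n - d m] another 4 e / 8. *)
have cauchy e : 0 < e -> exists N, forall m n, (N <= m)%N -> (m <= n)%N -> sq (fun x => G m x - G n x) <= e.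
  move=> e0; have e8 : 0 < e / 8 by lra.
  have /cvgrPdist_le/(_ _ e8)[N1 _ HN1] := cvd.
  have [N2 HN2] := cvg0_le (@cvg_harmonic R) e8.
  exists (maxn N1 N2) => m n; rewrite geq_max => /andP[N1m N2m] mn.
  have [hm sm] := HG m; have [hn sn] := HG n.
  rewrite (sq_parallelogram (tG m) (tG n)).
  have := dle m _ (hull_mid hm (hull_le mn hn)).
  have := HN2 m N2m; have := HN2 n (leq_trans N2m mn).
  rewrite !ger0_norm ?harmonic_ge0// /harmonic => h1 h2 h3.
  have := HN1 m N1m; have := HN1 n (leq_trans N1m mn).
  have {}sm : sq (G m) <= d m + e / 8 by apply: le_trans sm _; rewrite lerD2l.
  have {}sn : sq (G n) <= d n + e / 8 by apply: le_trans sn _; rewrite lerD2l.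
  rewrite /= !ler_norml; move: (limn d) (d m) (d n) (sq (G m)) (sq (G n)) (sq _) sm sn h3.
  by clear -e0 => l p q r s t ? ? ? /andP[? ?] /andP[? ?]; lra.
have cauchy1 e : 0 < e -> exists N, forall m n, (N <= m)%N -> (m <= n)%N -> nrm1 (fun x => G m x - G n x) <= e.
  (* With this parameter in [nrm1_sq] the term [L * eta] stays below e / 2. *)
  move=> e0; pose eta := e / (2 * (L + 1)).
  have L1p : 0 < L + 1 by lra.
  have eta0 : 0 < eta by rewrite divr_gt0// mulr_gt0.
  have [N HN] := cauchy (eta * (e / 2)) ltac:(by rewrite mulr_gt0// divr_gt0).
  exists N => m n Nm mn.
  have tmn : tame L (fun x => G m x - G n x).
    have := tame_lin (-1) (tG n) (tG m); congr tame; apply/funext => x.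
    by rewrite mulN1r addrC.
  apply: le_trans (nrm1_sq L0 eta0 tmn) _.
  apply: (@le_trans _ _ (L * eta + e / 2)).
    by rewrite lerD2l ler_pdivrMl//; exact: HN.
  rewrite -lerBrDr; have -> : e - e / 2 = (L + 1) * eta by rewrite /eta; field; rewrite gt_eqF.
  by rewrite ler_wpM2r ?ltW// ltrDl.
have /choice[N HN] i : exists N, forall m n, (N <= m)%N -> (m <= n)%N ->
    nrm1 (fun x => G m x - G n x) <= 2^-1 ^+ i.
  by apply: cauchy1; rewrite exprn_gt0.
(* Summing the thresholds gives a nondecreasing sequence above both [N i] and i. *)
pose P i := (\sum_(j < i.+1) N j + i)%N.
have PN i : (N i <= P i)%N by rewrite /P big_ord_recr/= -addnA addnCA leq_addr.
have Pi i : (i <= P i)%N by rewrite /P leq_addl.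
have PS i : (P i <= P i.+1)%N by rewrite /P [in leqRHS]big_ord_recr/= leq_add// leq_addr.
have [|i|k [k1 ck ak]] := @L1_complete (fun i => G (P i)).
- by move=> i; exact: tame_L1 (tG _).
- rewrite nrm1_sym; apply: HN => //.
- exists (fun i => G (P i)), k; split => // i.
  by apply: hull_le (Pi i) _; have [] := HG (P i).
Qed.

End Komlos.

(** * Compactness and continuity of the integrand *)

Section Compactness.
Variable R : realType.
Implicit Types (f g h : R -> R) (x y a b c d C L e : R) (A U : set R).
Local Notation mu := (@lebesgue_measure R).

(** Tychonoff's theorem for a product of copies of [[-C, C]] indexed by the points of the line: a
    cluster point is approximated on any finite set by arbitrarily late terms. *)
Lemma pointwise_cluster (F : nat -> R -> R) C : (forall n x, `|F n x| <= C) ->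
  exists W : R -> R, forall (N : nat) (s : 'I_N -> R) e (m : nat), 0 < e ->
    exists2 n, (m <= n)%N & forall i, `|F n (s i) - W (s i)| < e.
Proof.
move=> FC.
have cA := @tychonoff R (fun=> R : topologicalType) (fun=> `[- C, C]%classic)
  (fun=> @segment_compact R (- C) C).
have [] := cA (F @ \oo) _.
  by exists 0%N => // n _ /= i; rewrite in_itv/= -ler_norml.
move=> W [_ clW]; exists W => N s e m e0.
have nB : nbhs W (fun f : R -> R => forall i, `|f (s i) - W (s i)| < e).
  apply: (@filter_forall _ _ (fun (i : 'I_N) (f : R -> R) => `|f (s i) - W (s i)| < e) _
    (nbhs_filter W)) => i.
  have := @proj_continuous R (fun=> R : topologicalType) (s i) W.
  move=> /(_ _ (nbhsx_ballx (W (s i)) e e0)); apply: (@filterS _ _ (nbhs_filter W)) => f.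
  by rewrite /= /ball/= /proj distrC.
have nm : (F @ \oo) [set f | exists2 n, (m <= n)%N & f = F n].
  by exists m => // n /= mn; exists n.
by have [_ [[n mn ->] H]] := clW _ _ nm nB; exists n.
Qed.

(** A pointwise cluster point inherits the modulus of continuity, and closeness on a grid finer than
    this modulus is uniform closeness. *)
Lemma ascoli (F : nat -> R -> R) C L : 0 <= L -> (forall n x, `|F n x| <= C) ->
  (forall n x, L < `|x| -> F n x = 0) ->
  (forall e, 0 < e -> exists2 d : R, 0 < d &
     forall n x y, `|x - y| <= d -> `|F n x - F n y| <= e) ->
  exists W : R -> R, exists nu : nat -> nat, (forall j, (nu j < nu j.+1)%N) /\
    forall e, 0 < e -> exists J, forall j, (J <= j)%N -> forall x, `|F (nu j) x - W x| <= e.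
Proof.
move=> L0 FC F0 Feq; have [W HW] := pointwise_cluster FC.
have W2 x y e : 0 < e -> exists n, `|F n x - W x| < e /\ `|F n y - W y| < e.
  move=> e0; have [n _ H] := HW 2%N (fun i => if i == ord0 then x else y) e 0%N e0.
  by exists n; split; [exact: (H ord0)|exact: (H ord_max)].
have Weq e : 0 < e -> exists2 d : R, 0 < d & forall n x y, `|x - y| <= d ->
    `|F n x - F n y| <= e /\ `|W x - W y| <= e.
  move=> e0; have e2 : 0 < e / 2 by lra.
  have [d d0 Hd] := Feq _ e2; exists d => // n x y xy; split.
    by apply: le_trans (Hd n x y xy) _; lra.
  have [m [mx my]] := W2 x y (e / 4) ltac:(by lra).
  have := Hd m x y xy; move: mx my; rewrite !ltr_norml !ler_norml.
  by move=> /andP[? ?] /andP[? ?] /andP[? ?]; apply/andP; split; lra.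
have W0 x : L < `|x| -> W x = 0.
  move=> Lx; apply/eqP; rewrite -normr_eq0; apply/eqP/le_anti; rewrite normr_ge0 andbT.
  apply: (@le0_eps _ _ 1) => // e e0; have [n [+ _]] := W2 x x e e0.
  by rewrite F0// sub0r normrN mul1r => /ltW.
have near_unif (e : R) (m : nat) : 0 < e -> exists2 n, (m <= n)%N & forall x, `|F n x - W x| <= e.
  move=> e0; have e3 : 0 < e / 3 by lra.
  have [d d0 Hd] := Weq _ e3.
  (* The grid points -L + i d with i < N come within d of every point of [[-L, L]] from below. *)
  pose N := (Num.truncn (2 * L / d)).+1.
  have [n mn Hn] := HW N (fun i : 'I_N => - L + i%:R * d) _ m e3.
  exists n => // x; have [Lx|xL] := ltP L `|x|.
    by rewrite F0// W0// subrr normr0 ltW.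
  move: (xL); rewrite ler_norml => /andP[Lx xL'].
  have q0 : 0 <= (x + L) / d by rewrite divr_ge0// ?(ltW d0)//; lra.
  have /andP[ki kS] := truncn_itv q0; set i := Num.truncn _ in ki kS.
  have iN : (i < N)%N.
    by rewrite ltnS; apply: le_truncn; rewrite ler_pM2r ?invr_gt0//; lra.
  have xi : `|x - (- L + i%:R * d)| <= d.
    move: ki kS; rewrite ler_pdivlMr// ltr_pdivrMr// -natr1 mulrDl mul1r => h1 h2.
    by rewrite ler_norml; apply/andP; split; lra.
  have [h1 h2] := Hd n _ _ xi; have := Hn (Ordinal iN); rewrite /=.
  move: h1 h2; rewrite !ltr_norml !ler_norml.
  move: (F n x) (F n _) (W x) (W _) => p q r s.
  by clear -e0 => /andP[? ?] /andP[? ?] /andP[? ?]; apply/andP; split; lra.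
have /choice[c Hc] : forall mj : nat * nat, exists n, (mj.1 <= n)%N /\ forall x, `|F n x - W x| <= mj.2.+1%:R^-1.
  by move=> [m j]; have [n ? ?] := near_unif (j.+1%:R^-1) m ltac:(by rewrite invr_gt0); exists n.
(* Each search starts beyond the previous index, which makes [nu] strictly increasing. *)
pose nu := fix nu (j : nat) : nat := if j is i.+1 then c ((nu i).+1, j) else c (0%N, 0%N).
exists W, nu; split.
  by move=> j; have [] := Hc ((nu j).+1, j.+1).
move=> e e0; have [J HJ] := cvg0_le (@cvg_harmonic R) e0.
exists J => j Jj x.
have nuj : `|F (nu j) x - W x| <= j.+1%:R^-1.
  by case: j Jj => [|j] _; [have [_] := Hc (0%N, 0%N)|have [_] := Hc ((nu j).+1, j.+1)]; exact.
by apply: le_trans nuj _; have := HJ j Jj; rewrite ger0_norm.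
Qed.

(** A power below 1 is at most a small multiple of its argument plus a constant. The slopes are
    chosen to add up to at most 1/2, so y is absorbed on the left. In the application y is the L^1
    norm of a second derivative. *)
Lemma sublinear_bound (a b c d s t : R) : 0 <= a -> 0 <= b -> 0 <= c -> 0 <= d ->
  0 <= s < 1 -> 0 <= t < 1 ->
  exists B : R, forall y, 0 <= y -> y <= a + b * ((c + d * y) `^ s + (c + y) `^ t) -> y <= B.
Proof.
move=> a0 b0 c0 d0 s01 t01.
have sub (r e : R) : 0 <= r < 1 -> 0 < e -> exists2 K : R, 0 <= K & forall x, 0 <= x -> x `^ r <= e * x + K.
  (* Beyond [x0] one has x^(r - 1) <= e, which determines [x0]. *)
  move=> /andP[r0 r1] e0; pose x0 := e^-1 `^ (1 - r)^-1.
  have r10 : 0 < 1 - r by rewrite subr_gt0.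
  exists (x0 `^ r); first exact: powR_ge0.
  move=> x x0'; have [xx|xx] := leP x x0.
    apply: (@le_trans _ _ (x0 `^ r)); last by rewrite lerDr mulr_ge0// ltW.
    by apply: ge0_ler_powR; rewrite ?nnegrE ?powR_ge0.
  have xp : 0 < x by apply: le_lt_trans xx; exact: powR_ge0.
  apply: (@le_trans _ _ (e * x)); last by rewrite lerDl powR_ge0.
  rewrite -[in leLHS](subKr 1 r) powRB ?(gt_eqF xp) ?implybT// powRr1//.
  rewrite mulrC ler_wpM2r// invf_ple ?posrE// ?powR_gt0//.
  have -> : e^-1 = x0 `^ (1 - r).
    by rewrite /x0 -powRrM mulVf ?gt_eqF// powRr1// invr_ge0 ltW.
  by apply: ge0_ler_powR; rewrite ?nnegrE ?powR_ge0// ltW.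
have bd : 0 < 4 * (b * d + 1) by rewrite mulr_gt0// ltr_wpDl// mulr_ge0.
have b4 : 0 < 4 * (b + 1) by lra.
have [K1 K10 H1] := sub s (4 * (b * d + 1))^-1 s01 ltac:(by rewrite invr_gt0).
have [K2 K20 H2] := sub t (4 * (b + 1))^-1 t01 ltac:(by rewrite invr_gt0).
exists (2 * (a + b * ((4 * (b * d + 1))^-1 * c + K1) + b * ((4 * (b + 1))^-1 * c + K2))) => y y0 hy.
have h1 := H1 (c + d * y) ltac:(by rewrite addr_ge0// mulr_ge0).
have h2 := H2 (c + y) ltac:(by rewrite addr_ge0).
have := ler_wpM2l b0 (lerD h1 h2).
have q1 : b * ((4 * (b * d + 1))^-1 * (d * y)) <= y / 4.
  have -> : b * ((4 * (b * d + 1))^-1 * (d * y)) = (b * d / (b * d + 1)) * (y / 4).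
    by field; rewrite gt_eqF// -(pmulr_rgt0 _ (x := 4)).
  rewrite ler_piMl ?divr_ge0// ler_pdivrMr ?mul1r ?lerDl//.
  by rewrite -(pmulr_rgt0 _ (x := 4)).
have q2 : b * ((4 * (b + 1))^-1 * y) <= y / 4.
  have -> : b * ((4 * (b + 1))^-1 * y) = (b / (b + 1)) * (y / 4).
    by field; rewrite gt_eqF//; lra.
  by rewrite ler_piMl ?divr_ge0// ler_pdivrMr ?mul1r ?lerDl//; lra.
move: h1 h2 q1 q2 hy.
move: ((4 * (b * d + 1))^-1) ((4 * (b + 1))^-1) ((c + d * y) `^ s) ((c + y) `^ t).
by clear => u v p q _ _ q1 q2 hy h; nra.
Qed.

End Compactness.

(** * Uniform continuity and measurability of H *)

Section Integrand.
Variables (R : realType) (Om : set R) (H : R -> R -> R -> R -> R).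
Hypothesis oO : open Om.
Hypothesis Hc : {within [set z : R * R * R * R | Om z.1.1.1],
     continuous (fun z : R * R * R * R => H z.1.1.1 z.1.1.2 z.1.2 z.2)}.
Local Notation mu := (@lebesgue_measure R).
Implicit Types (x y a b c p X e eta d : R) (K : set R).

Lemma integrand_continuous x a b c e : Om x -> 0 < e -> exists2 d : R, 0 < d &
  forall x' a' b' c', `|x' - x| < d -> `|a' - a| < d -> `|b' - b| < d -> `|c' - c| < d ->
  `|H x' a' b' c' - H x a b c| < e.
Proof.
move=> Ox e0.
have oD : open [set z : R * R * R * R | Om z.1.1.1].
  rewrite (_ : [set z : R * R * R * R | Om z.1.1.1] = (fun z => z.1.1.1) @^-1` Om)//.
  apply: open_comp => // z _.
  by apply: (@cvg_comp _ _ _ fst (fun z => z.1.1)); [exact: cvg_fst|apply: (@cvg_comp _ _ _ fst fst); exact: cvg_fst].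
move: Hc; rewrite continuous_open_subspace// => /(_ (x, a, b, c)).
rewrite inE /= => /(_ Ox) /cvgrPdist_lt /(_ _ e0) /nbhs_ballP[d d0 dP].
exists d => // x' a' b' c' hx ha hb hc.
rewrite distrC; apply: (dP (x', a', b', c')).
by split; [split; [split|]|]; rewrite /ball/= distrC.
Qed.

(** The point with primes may leave the compact box, so uniform continuity on the box is not enough;
    a near-covering argument over the box gives a common radius. *)
Lemma integrand_unif K (B e : R) : compact K -> K `<=` Om -> 0 < e -> exists2 d : R, 0 < d &
  forall x a b c a' b' c', K x -> `|a| <= B -> `|b| <= B -> `|c| <= B ->
  `|a' - a| <= d -> `|b' - b| <= d -> `|c' - c| <= d ->
  `|H x a' b' c' - H x a b c| <= e.
Proof.
move=> cK KO e0.
have cB := @segment_compact R (- B) B.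
have cKB : compact (((K `*` `[- B, B]) `*` `[- B, B]) `*` `[- B, B])%classic.
  by do 3! (apply: compact_setX => //).
have HU := (compact_near_coveringP _).1 cKB R (0^'+)
  (fun d z => forall a' b' c', `|a' - z.1.1.2| <= d -> `|b' - z.1.2| <= d ->
    `|c' - z.2| <= d ->
  `|H z.1.1.1 a' b' c' - H z.1.1.1 z.1.1.2 z.1.2 z.2| <= e).
have [[[[x a] b] c] [[[/= Kx Ba] Bb] Bc]|d /= d0 dU] := HU.
  have e2 : 0 < e / 2 by lra.
  have [d d0 dP] := integrand_continuous a b c (KO _ Kx) e2.
  have d2 : 0 < d / 2 by lra.
  exists (ball (x, a, b, c) (d / 2), [set r | r < d / 2]).
    by split; [exact: nbhsx_ballx|exact: nbhs_right_lt].
  move=> [[[[x' a'] b'] c'] r] [/= [[[hx ha] hb] hc] rd] a1 b1 c1 h1 h2 h3.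
  move: hx ha hb hc; rewrite /ball/= => hx ha hb hc.
  have tri (u v w : R) : `|v - w| <= r -> `|u - w| < d / 2 -> `|v - u| < d.
    move: rd; rewrite /= ler_norml !ltr_norml; clear.
    by move=> ? /andP[? ?] /andP[? ?]; apply/andP; split; lra.
  have half : d / 2 < d by lra.
  have q1 : `|H x' a1 b1 c1 - H x a b c| < e / 2.
    by apply: dP; [rewrite distrC; exact: lt_trans half|exact: tri h1 ha|exact: tri h2 hb|exact: tri h3 hc].
  have q2 : `|H x' a' b' c' - H x a b c| < e / 2.
    by apply: dP; rewrite distrC; exact: lt_trans half.
  move: q1 q2; move: (H _ _ _ _) (H _ _ _ _) (H _ _ _ _) => u v w.
  clear; rewrite ler_norml !ltr_norml => /andP[? ?] /andP[? ?].
  by apply/andP; split; lra.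
exists (d / 2); first lra.
move=> x a b c a' b' c' Kx ha hb hc h1 h2 h3.
apply: (dU (d / 2) _ _ (x, a, b, c)) => //=.
- by rewrite /ball_/= sub0r normrN gtr0_norm; lra.
- lra.
- by split; [split; [split|]|] => //=; rewrite in_itv/= -ler_norml.
Qed.

End Integrand.

(** c is approximated by step functions with values in the multiples of 1 / (n + 1), on whose steps
    the second argument of [G] is constant; continuity in that argument gives the pointwise
    limit. *)
Lemma caratheodory (R : realType) (D : set R) (G : R -> R -> R) (c : R -> R) :
  measurable D -> (forall y, measurable_fun D (G ^~ y)) ->
  (forall x y (e : R), D x -> 0 < e -> exists2 d : R, 0 < d & forall y', `|y' - y| < d -> `|G x y' - G x y| < e) ->
  measurable_fun D c -> measurable_fun D (fun x => G x (c x)).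
Proof.
move=> mD mG cG mc.
pose f (n : nat) x : R := G x ((Num.floor (c x * n.+1%:R))%:~R / n.+1%:R).
have mf n : measurable_fun D (f n).
  move=> _ B mB.
  have -> : D `&` f n @^-1` B = \bigcup_(i : int)
    ((D `&` c @^-1` `[i%:~R / n.+1%:R, (i + 1)%:~R / n.+1%:R[) `&`
     (D `&` (G ^~ (i%:~R / n.+1%:R)) @^-1` B)).
    apply/seteqP; split => x.
      move=> [Dx fB]; exists (Num.floor (c x * n.+1%:R)) => //; split; split => //=.
      have /andP[h1 h2] := floor_itv (c x * n.+1%:R).
      by rewrite in_itv/= ler_pdivrMr// ltr_pdivlMr// h1 h2.
    move=> [i _ [[Dx /= hi] [_ /= Gi]]]; split => //=.
    move: hi; rewrite in_itv/= ler_pdivrMr// ltr_pdivlMr// => hi.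
    by rewrite /f (_ : Num.floor _ = i)//; apply/eqP; rewrite floor_eq.
  apply: countable_bigcupT_measurable => // i; apply: measurableI; [exact: mc|exact: mG].
apply: (@measurable_fun_cvg _ _ _ _ f) => // x Dx.
apply/cvgrPdist_lt => e e0.
have [d d0 Hd] := cG x (c x) e Dx e0.
have d2 : 0 < d / 2 by rewrite divr_gt0.
have [N HN] := cvg0_le (@cvg_harmonic R) d2.
exists N => // n /= Nn; rewrite distrC; apply: Hd.
have := HN n Nn; rewrite ger0_norm// => hn.
have /andP[h1 h2] := floor_itv (c x * n.+1%:R).
have n0 : 0 < n.+1%:R :> R by [].
have h3 : c x - n.+1%:R^-1 < (Num.floor (c x * n.+1%:R))%:~R / n.+1%:R.
  by rewrite ltr_pdivlMr// mulrBl mulVf ?gt_eqF// ltrBlDr -intrD1.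
have h4 : (Num.floor (c x * n.+1%:R))%:~R / n.+1%:R <= c x.
  by rewrite ler_pdivrMr//.
have : d / 2 < d by lra.
move: h3 h4 hn; move: (d / 2) (c x) (n.+1%:R^-1) ((Num.floor (c x * n.+1%:R))%:~R / n.+1%:R); clear => d2 r q p h3 h4 hn hd.
by rewrite ltr_norml; apply/andP; split; lra.
Qed.

Section Integrand_measurable.
Variables (R : realType) (Om : set R) (H : R -> R -> R -> R -> R).
Hypothesis oO : open Om.
Hypothesis Hc : {within [set z : R * R * R * R | Om z.1.1.1],
     continuous (fun z : R * R * R * R => H z.1.1.1 z.1.1.2 z.1.2 z.2)}.

(** Three applications of [caratheodory] free the last argument, then the third, then the second
    from constants; what remains is continuous in x. *)
Lemma integrand_measurable (a b c : R -> R) : measurable_fun Om a ->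
  measurable_fun Om b -> measurable_fun Om c ->
  measurable_fun Om (fun x => H x (a x) (b x) (c x)).
Proof.
have mO := open_measurable oO.
move=> ma mb mc.
apply: (@caratheodory _ Om (fun x y => H x (a x) (b x) y)) => //; last first.
  move=> x y e Ox e0; have [d d0 Hd] := integrand_continuous oO Hc (a x) (b x) y Ox e0.
  by exists d => // y' yd; apply: Hd; rewrite // subrr normr0.
move=> r; apply: (@caratheodory _ Om (fun x y => H x (a x) y r)) => //; last first.
  move=> x y e Ox e0; have [d d0 Hd] := integrand_continuous oO Hc (a x) y r Ox e0.
  by exists d => // y' yd; apply: Hd; rewrite // subrr normr0.
move=> q; apply: (@caratheodory _ Om (fun x y => H x y q r)) => //; last first.
  move=> x y e Ox e0; have [d d0 Hd] := integrand_continuous oO Hc y q r Ox e0.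
  by exists d => // y' yd; apply: Hd; rewrite // subrr normr0.
move=> p; apply: open_continuous_measurable_fun => // x; rewrite inE => Ox.
apply/cvgrPdist_lt => e e0; have [d d0 Hd] := integrand_continuous oO Hc p q r Ox e0.
apply/nbhs_ballP; exists d => //= y xy; rewrite distrC.
by apply: Hd; rewrite ?subrr ?normr0// distrC.
Qed.

End Integrand_measurable.

(** * Power energies *)

Section Integrand_class.
Variable R : realType.
Local Notation mu := (@lebesgue_measure R).

(* [F x a b c] stands for [M + H x (g x + a) (g' x + b) (g'' x + c)], so that a competitor
   enters only through its deviation from the boundary datum. *)
Record integrand (Om : set R) (F : R -> R -> R -> R -> R) (d A G C s t : R) : Prop := {
  int_meas : forall a b c : R -> R, measurable_fun Om a -> measurable_fun Om b ->
    measurable_fun Om c -> measurable_fun Om (fun x => F x (a x) (b x) (c x));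
  int_gt0 : 0 < d;
  int_ge : forall x a b c, Om x -> d <= F x a b c;
  int_conv : forall x a b c c' e, Om x -> F x a b c <= e -> F x a b c' <= e ->
    F x a b (2^-1 * c + 2^-1 * c') <= e;
  int_cont : forall x a b B e, Om x -> 0 < e -> exists2 r : R, 0 < r &
    forall a' b' c c', `|a' - a| <= r -> `|b' - b| <= r -> `|c| <= B -> `|c' - c| <= r ->
      `|F x a' b' c' - F x a b c| <= e;
  int_unif : forall u v B e, `[u, v] `<=` Om -> 0 < e -> exists2 r : R, 0 < r &
    {ae mu, forall x, u <= x <= v -> forall a b c a' b' c',
      `|a| <= B -> `|b| <= B -> `|c| <= B -> `|a' - a| <= r -> `|b' - b| <= r ->
      `|c' - c| <= r -> `|F x a' b' c' - F x a b c| <= e};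
  int_A : 0 <= A; int_G : 0 <= G; int_C : 0 <= C;
  int_s : 0 <= s < 1; int_t : 0 <= t < 1;
  int_coer : {ae mu, forall x, Om x -> forall a b c,
    `|c| <= A + C * F x a b c + C * ((G + `|a|) `^ s + (G + `|b|) `^ t)} }.

End Integrand_class.

Section Energies.
Variables (R : realType) (Om : set R) (L : R) (F : R -> R -> R -> R -> R).
Variables (d A G C s t : R).
Hypotheses (L0 : 0 <= L) (UL : inball Om L) (oU : open Om).
Hypothesis I : integrand Om F d A G C s t.
Implicit Types (z y f g h k : R -> R) (x a b c e p r B K Y : R) (O : set R).
Local Notation mu := (@lebesgue_measure R).
Local Notation V := (fine (mu Om)).

Let mU : measurable Om := open_measurable oU.

Definition hf z x := F x (prim (prim z) x) (prim z x) (z x).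

Lemma measureUE : mu Om = V%:E.
Proof. by rewrite fineK// ge0_fin_numE//; exact: (measureU_lty UL oU). Qed.

Lemma V_ge0 : 0 <= V.
Proof. by rewrite fine_ge0. Qed.

Lemma hf_measurable z : der2_0 Om z -> measurable_fun Om (hf z).
Proof.
move=> Jz; apply: (int_meas I); apply: measurable_funTS.
- by apply: continuous_measurable_fun; exact: der2_0_prim2_continuous L0 UL Jz.
- by apply: continuous_measurable_fun; exact: der2_0_continuous Jz.
- exact: L1_measurable (der2_0_L1 Jz).
Qed.

Lemma hf_gt0 z x : Om x -> 0 < hf z x.
Proof. by move=> Ox; apply: lt_le_trans (int_ge I _ _ _ Ox); exact: int_gt0 I. Qed.

(** Leaving out the mean value and the root keeps the energy additive over disjoint sets. *)
Definition Ip p O z := (\int[mu]_(x in O) ((hf z x) `^ p)%:E)%E.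

Lemma Ip_ge0 p O z : (0 <= Ip p O z)%E.
Proof. by apply: integral_ge0 => x _; rewrite lee_fin powR_ge0. Qed.

Lemma hfp_measurable p O z : measurable O -> O `<=` Om -> der2_0 Om z ->
  measurable_fun O (fun x => ((hf z x) `^ p)%:E).
Proof.
move=> mO OU Jz; apply/measurable_EFinP; apply: (measurableT_comp (measurable_powR p)).
exact: measurable_funS (hf_measurable Jz).
Qed.

Lemma Ip_le p O z c : measurable O -> O `<=` Om -> der2_0 Om z -> 0 <= p -> 0 <= c ->
  {ae mu, forall x, O x -> hf z x <= c} -> (Ip p O z <= (V * c `^ p)%:E)%E.
Proof.
move=> mO OU Jz p0 c0 zc.
apply: (@le_trans _ _ (\int[mu]_(x in O) (c `^ p)%:E)%E).
  apply: ae_ge0_le_integral => //.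
  - by move=> x _; rewrite lee_fin powR_ge0.
  - exact: hfp_measurable.
  - by move=> x _; rewrite lee_fin powR_ge0.
  apply: (aeS zc) => x xc Ox; rewrite lee_fin; apply: ge0_ler_powR => //; rewrite ?nnegrE//.
    by apply/ltW/hf_gt0/OU.
  exact: xc.
rewrite integral_cst// EFinM muleC -measureUE lee_wpmul2r ?lee_fin ?powR_ge0//.
by apply: le_measure => //; rewrite inE.
Qed.

Lemma superlevel_measurable O z c : measurable O -> O `<=` Om -> der2_0 Om z ->
  measurable (O `&` [set x | c < hf z x]).
Proof.
move=> mO OU Jz.
have -> : O `&` [set x | c < hf z x] = O `&` (hf z) @^-1` `]c, +oo[.
  by apply/seteqP; split => x [Ox /=]; rewrite in_itv/= andbT.
exact: (measurable_funS mU OU (hf_measurable Jz) mO (measurable_itv _)).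
Qed.

Lemma chebyshev_hf p O z c : measurable O -> O `<=` Om -> der2_0 Om z -> 0 <= p -> 0 < c ->
  ((c `^ p)%:E * mu (O `&` [set x | (c < hf z x)%R]) <= Ip p O z)%E.
Proof.
move=> mO OU Jz p0 c0; set S := _ `&` _.
have mS : measurable S by exact: superlevel_measurable.
rewrite -integral_cst// /Ip.
apply: (@le_trans _ _ (\int[mu]_(x in S) ((hf z x) `^ p)%:E)%E).
  apply: ge0_le_integral => //.
  - by move=> x _; rewrite lee_fin powR_ge0.
  - by apply: hfp_measurable => // x [/OU].
  - move=> x [_ /= /ltW cz]; rewrite lee_fin ge0_ler_powR// ?nnegrE//; first exact: ltW.
    exact: le_trans (ltW c0) cz.
apply: ge0_subset_integral => //; first exact: hfp_measurable.
- by move=> x _; rewrite lee_fin powR_ge0.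
- by move=> x [].
Qed.

(** A competitor with bounded integrand makes the infimum a real number, which can then be
    approached up to e. *)
Lemma almost_minimiser p e : 0 <= p -> 0 < e ->
  (exists2 y, adm Om y & exists c, {ae mu, forall x, Om x -> hf y x <= c}) ->
  exists2 z, adm Om z & forall y, adm Om y -> (Ip p Om z <= Ip p Om y + e%:E)%E.
Proof.
move=> p0 e0 [y ay [c yc]].
pose S := [set r | exists2 z, adm Om z & r = Ip p Om z].
have Iy : (Ip p Om y < +oo)%E.
  apply: (@le_lt_trans _ _ (V * `|c| `^ p)%:E); last exact: ltry.
  apply: Ip_le => //; first exact: adm_der2_0.
  by apply: (aeS yc) => x xc Ox; apply: le_trans (xc Ox) (ler_norm _).
have iS : ereal_inf S \is a fin_num.
  rewrite fin_numE; apply/andP; split.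
    have : (0 <= ereal_inf S)%E by apply: le_ereal_inf_tmp => _ [z _ ->]; exact: Ip_ge0.
    by case: (ereal_inf S).
  have : (ereal_inf S <= Ip p Om y)%E by apply: ereal_inf_lbound; exists y.
  by move: Iy; case: (ereal_inf S) => //; case: (Ip p Om y).
have [_ [z az ->] zS] := lb_ereal_inf_adherent e0 iS.
exists z => // w aw; apply: le_trans (ltW zS) _; rewrite leeD2r//.
by apply: ereal_inf_lbound; exists w.
Qed.

End Energies.

(** * Bounds along a family of almost minimisers *)

Section Family.
Variables (R : realType) (Om : set R) (L : R) (F : R -> R -> R -> R -> R).
Variables (d A G C s t : R).
Hypotheses (L0 : 0 <= L) (UL : inball Om L) (oU : open Om).
Hypothesis I : integrand Om F d A G C s t.
Implicit Types (z y f g h k : R -> R) (x a b c e p r Y : R) (O : set R).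
Local Notation mu := (@lebesgue_measure R).
Local Notation V := (fine (mu Om)).
Local Notation hf := (hf F).
Local Notation Ip := (Ip F).

Let mU : measurable Om := open_measurable oU.

Lemma nrm1_UE z : adm Om z -> (nrm1 z)%:E = (\int[mu]_(x in Om) `|z x|%:E)%E.
Proof.
move=> az; have z1 := adm_L1 az; have [_ _ z0 _] := az.
rewrite /nrm1 /Rintegral fineK; last first.
  by apply: integrable_fin_num => //; exact: L1_norm.
rewrite [RHS]integral_mkcond; apply: eq_integral => x _; rewrite patchE.
by case: ifPn => // /negP; rewrite inE => /z0 ->; rewrite normr0.
Qed.

Lemma powRD_le x (y : R) r : 0 <= r -> 0 <= x -> 0 <= y ->
  (x + y) `^ r <= (2 * x) `^ r + (2 * y) `^ r.
Proof.
move=> r0 x0 y0; have [xy|yx] := leP x y.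
  apply: (@le_trans _ _ ((2 * y) `^ r)); last by rewrite lerDr powR_ge0.
  by apply: ge0_ler_powR => //; rewrite ?nnegrE; lra.
apply: (@le_trans _ _ ((2 * x) `^ r)); last by rewrite lerDl powR_ge0.
by apply: ge0_ler_powR => //; rewrite ?nnegrE; lra.
Qed.

Variables (z_ : R -> R -> R) (K : R).
Hypothesis K1 : 1 <= K.
Hypothesis zK : exists2 y, adm Om y & {ae mu, forall x, Om x -> hf y x <= K}.
Hypothesis zadm : forall p, 1 < p -> adm Om (z_ p).
Hypothesis zmin : forall p, 1 < p -> forall y, adm Om y ->
  (Ip p Om (z_ p) <= Ip p Om y + (V * 2 `^ (- (p * p)))%:E)%E.

Let V0 : 0 <= V := V_ge0 Om.

(** The bounded competitor costs V K^p, and the error is at most V, hence at most V K^p because K >=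
    1. *)
Lemma Ip_family p : 1 < p -> (Ip p Om (z_ p) <= (2 * V * K `^ p)%:E)%E.
Proof.
move=> p1; have p0 : 0 <= p by lra.
have [y ay yK] := zK; apply: le_trans (zmin p1 ay) _.
have K0 : 0 <= K by exact: le_trans ler01 K1.
have := Ip_le L0 UL oU I mU (@subset_refl _ Om) (adm_der2_0 ay) p0 K0 yK.
move=> /(leeD2r (V * 2 `^ (- (p * p)))%:E) /le_trans; apply.
rewrite -EFinD lee_fin -mulrA (mulrDl 1 1) mul1r lerD2l ler_wpM2l//.
apply: (@le_trans _ _ 1).
  rewrite powRN invf_le1 ?powR_gt0// -[leLHS](powRr0 2) ler_powR//; first lra.
  exact: mulr_ge0.
rewrite -[leLHS](powRr0 K) ler_powR//.
Qed.

(** In place of Hoelder's inequality: h^r is at most K^r where h <= K, and at most K^(r - p) h^p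
    elsewhere. The factor 3 is 1 + 2. *)
Lemma Ip_low r p : 0 <= r <= p -> 1 < p -> (Ip r Om (z_ p) <= (3 * V * K `^ r)%:E)%E.
Proof.
move=> /andP[r0 rp] p1; have Kp : 0 < K by exact: lt_le_trans ltr01 K1.
have Jz := adm_der2_0 (zadm p1).
have mh q : measurable_fun Om (fun x => (hf (z_ p) x `^ q)%:E).
  exact: (hfp_measurable L0 UL oU I q mU (@subset_refl _ Om) Jz).
apply: (@le_trans _ _ (\int[mu]_(x in Om) ((K `^ r)%:E + (K `^ (r - p))%:E * ((hf (z_ p) x) `^ p)%:E))%E).
  apply: ge0_le_integral => //.
  - by move=> x _; rewrite lee_fin powR_ge0.
  - exact: mh.
  - by apply: emeasurable_funD => //; apply: emeasurable_funM => //; exact: mh.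
  - move=> x Ox; rewrite -EFinM -EFinD lee_fin; have h0 := hf_gt0 I (z_ p) Ox.
    have [hK|Kh] := leP (hf (z_ p) x) K.
      apply: (@le_trans _ _ (K `^ r)); last by rewrite lerDl mulr_ge0 ?powR_ge0.
      by apply: ge0_ler_powR => //; rewrite nnegrE ltW.
    apply: (@le_trans _ _ (K `^ (r - p) * hf (z_ p) x `^ p)); last by rewrite lerDr powR_ge0.
    rewrite (_ : hf (z_ p) x `^ r = hf (z_ p) x `^ (r - p) * hf (z_ p) x `^ p); last first.
      by rewrite -powRD ?subrK// (gt_eqF h0) implybT.
    rewrite ler_wpM2r ?powR_ge0//.
    rewrite -(opprB p r) !powRN lef_pV2 ?posrE ?powR_gt0//.
    by apply: ge0_ler_powR; rewrite ?nnegrE ?subr_ge0// ltW.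
rewrite ge0_integralD//; last 3 first.
- by move=> x _; rewrite lee_fin powR_ge0.
- by move=> x _; rewrite -EFinM lee_fin mulr_ge0 ?powR_ge0.
- by apply: emeasurable_funM => //; exact: mh.
rewrite integral_cst// ge0_integralZl_EFin ?powR_ge0//; last 2 first.
- by move=> x _; rewrite lee_fin powR_ge0.
- exact: mh.
apply: (@le_trans _ _ ((K `^ r)%:E * V%:E + (K `^ (r - p))%:E * (2 * V * K `^ p)%:E)%E).
  apply: leeD; first by rewrite -(measureUE UL oU).
  by rewrite lee_wpmul2l ?lee_fin ?powR_ge0//; exact: Ip_family.
rewrite -!EFinM -EFinD lee_fin powRB ?(gt_eqF Kp) ?implybT//.
have : K `^ p != 0 by rewrite gt_eqF// powR_gt0.
move: (K `^ p) (K `^ r) => a b a0.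
by rewrite (_ : b * V + _ = 3 * V * b)//; field.
Qed.

(** The lower-order terms are replaced by their uniform bounds 2 L n and n, so that apart from a
    constant the integrand alone controls z. *)
Lemma coercive_le z n : der2_0 Om z -> nrm1 z <= n -> {ae mu, forall x, Om x ->
  `|z x| <= A + C * ((G + 2 * L * n) `^ s + (G + n) `^ t) + C * hf z x}.
Proof.
move=> Jz zn; apply: (aeS (int_coer I)) => x coer Ox.
have n0 : 0 <= n by apply: le_trans (nrm1_ge0 z) zn.
apply: le_trans (coer Ox (prim (prim z) x) (prim z x) (z x)) _.
rewrite addrAC lerD2r lerD2l ler_wpM2l ?(int_C I)//.
have G0 := int_G I; have [/andP[s0 _] /andP[t0 _]] := (int_s I, int_t I).
have z2 := le_prim2 x L0 UL Jz; have z1 := le_prim x (der2_0_L1 Jz).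
have Ln : 2 * L * nrm1 z <= 2 * L * n by rewrite ler_wpM2l// mulr_ge0.
apply: lerD; apply: ge0_ler_powR; rewrite ?nnegrE ?lerD2l ?addr_ge0// ?mulr_ge0//.
- exact: le_trans z2 Ln.
- exact: le_trans z1 zn.
Qed.

(** Integrating the coercivity bounds the L^1 norm by a constant plus powers of itself with
    exponents below 1. *)
Lemma nrm1_family : exists Y, forall p, 1 < p -> nrm1 (z_ p) <= Y.
Proof.
have C0 := int_C I; have A0 := int_A I.
have K0 : 0 <= K by exact: le_trans ler01 K1.
have [Y YP] := @sublinear_bound R (A * V + C * (3 * V * K)) (C * V) G (2 * L) s t
  ltac:(by rewrite addr_ge0 ?mulr_ge0) ltac:(by rewrite mulr_ge0) (int_G I)
  ltac:(by rewrite mulr_ge0) (int_s I) (int_t I).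
exists Y => p p1; apply: YP; first exact: nrm1_ge0.
have Jz := adm_der2_0 (zadm p1).
set n := nrm1 (z_ p).
have D0 : 0 <= (G + 2 * L * n) `^ s + (G + n) `^ t by rewrite addr_ge0 ?powR_ge0.
have mh : measurable_fun Om (fun x => (hf (z_ p) x)%:E).
  by apply/measurable_EFinP; exact: (hf_measurable L0 UL I Jz).
have h0 x : Om x -> (0 <= (hf (z_ p) x)%:E)%E by move=> Ox; rewrite lee_fin; apply/ltW/(hf_gt0 I).
rewrite -lee_fin nrm1_UE//; last exact: zadm.
apply: (@le_trans _ _ (\int[mu]_(x in Om)
   ((A + C * ((G + 2 * L * n) `^ s + (G + n) `^ t))%:E + C%:E * (hf (z_ p) x)%:E))%E).
  apply: ae_ge0_le_integral => //.
  - apply/measurable_EFinP/measurable_funTS; apply: measurableT_comp => //.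
    exact: L1_measurable (der2_0_L1 Jz).
  - move=> x Ox; apply: adde_ge0; first by rewrite lee_fin addr_ge0 ?mulr_ge0.
    by apply: mule_ge0; [rewrite lee_fin|exact: h0].
  - by apply: emeasurable_funD => //; exact: emeasurable_funM.
  apply: (aeS (coercive_le Jz (lexx _))) => x h Ox.
  by rewrite -EFinM -EFinD lee_fin; exact: h.
rewrite ge0_integralD//; last 3 first.
- by move=> x _; rewrite lee_fin addr_ge0 ?mulr_ge0.
- by move=> x Ox; apply: mule_ge0; [rewrite lee_fin|exact: h0].
- exact: emeasurable_funM.
rewrite integral_cst// ge0_integralZl_EFin//.
apply: (@le_trans _ _ ((A + C * ((G + 2 * L * n) `^ s + (G + n) `^ t))%:E * V%:E + C%:E * (3 * V * K)%:E)%E).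
  apply: leeD; first by rewrite -(measureUE UL oU).
  rewrite lee_wpmul2l ?lee_fin//.
  have := @Ip_low 1 p; rewrite powRr1// => /(_ _ p1); rewrite ler01 (ltW p1) => /(_ isT).
  apply: le_trans; rewrite le_eqVlt; apply/orP; left; apply/eqP; apply: eq_integral => x.
  by rewrite inE => Ox; rewrite powRr1//; apply/ltW/(hf_gt0 I).
by rewrite -!EFinM -EFinD lee_fin; lra.
Qed.

(** With the lower-order terms bounded through Y, moments of the second derivative are controlled by
    those of the integrand, uniformly in p >= r. *)
Lemma moment_family Y r : (forall p, 1 < p -> nrm1 (z_ p) <= Y) -> 0 <= r ->
  exists D : R, forall p, r <= p -> 1 < p ->
    (\int[mu]_(x in Om) (`|z_ p x| `^ r)%:E <= D%:E)%E.
Proof.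
move=> nY r0; have C0 := int_C I; have A0 := int_A I.
pose a := A + C * ((G + 2 * L * Y) `^ s + (G + Y) `^ t).
have a0 : 0 <= a by rewrite addr_ge0 ?mulr_ge0 ?addr_ge0 ?powR_ge0.
exists ((2 * a) `^ r * V + (2 * C) `^ r * (3 * V * K `^ r)) => p rp p1.
have Jz := adm_der2_0 (zadm p1).
have mh : measurable_fun Om (fun x => (hf (z_ p) x `^ r)%:E).
  exact: (hfp_measurable L0 UL oU I r mU (@subset_refl _ Om) Jz).
have h0 x : Om x -> 0 <= hf (z_ p) x by move=> Ox; apply/ltW/(hf_gt0 I).
apply: (@le_trans _ _ (\int[mu]_(x in Om)
   (((2 * a) `^ r)%:E + ((2 * C) `^ r)%:E * (hf (z_ p) x `^ r)%:E))%E).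
  apply: ae_ge0_le_integral => //.
  - apply/measurable_EFinP/measurable_funTS; apply: (measurableT_comp (measurable_powR r)).
    apply: measurableT_comp => //; exact: L1_measurable (der2_0_L1 Jz).
  - by move=> x Ox; rewrite -EFinM -EFinD lee_fin addr_ge0 ?mulr_ge0 ?powR_ge0.
  - by apply: emeasurable_funD => //; exact: emeasurable_funM.
  apply: (aeS (coercive_le Jz (nY p p1))) => x h Ox.
  rewrite -EFinM -EFinD lee_fin -powRM ?mulr_ge0 ?h0//.
  rewrite -mulrA; apply: le_trans (powRD_le r0 a0 _); last by rewrite mulr_ge0 ?h0.
  apply: ge0_ler_powR; rewrite ?nnegrE//; last exact: h.
  by rewrite addr_ge0// mulr_ge0 ?h0.
rewrite ge0_integralD//; last 3 first.
- by move=> x _; rewrite lee_fin powR_ge0.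
- by move=> x Ox; rewrite -EFinM lee_fin mulr_ge0 ?powR_ge0.
- exact: emeasurable_funM.
rewrite integral_cst// ge0_integralZl_EFin ?powR_ge0//; last first.
  by move=> x _; rewrite lee_fin powR_ge0.
rewrite EFinD !EFinM; apply: leeD; first by rewrite -(measureUE UL oU).
rewrite lee_wpmul2l ?lee_fin ?powR_ge0//; rewrite -!EFinM.
by apply: Ip_low => //; rewrite r0.
Qed.

End Family.

(** * Equicontinuity of first primitives *)

Section Modulus.
Variable R : realType.
Implicit Types (f g z : R -> R) (x y c C L : R) (U : set R).
Local Notation mu := (@lebesgue_measure R).

Lemma adm_tame U L z : inball U L -> adm U z -> tame L z.
Proof.
move=> UL [mz Cz z0 _]; split => // x Lx; apply: z0; exact: inball_eq0 UL Lx.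
Qed.

(** Integrates |z| <= c + z^2 / c. In [equicontinuous_sq] the free c is taken large enough for the
    second term, and then the distance of the points small enough for the first. *)
Lemma prim_modulus L z c x y : tame L z -> 0 < c -> x <= y ->
  `|prim z y - prim z x| <= c * (y - x) + c^-1 * sq z.
Proof.
move=> tz c0 xy; have z1 := tame_L1 tz; have z2 := tame_sqr_L1 tz.
have mA : measurable (`]x, y] : set R) by exact: measurable_itv.
rewrite prim_sub//; apply: (le_trans (le_normr_Rintegral _ _)) => //; first exact: L1S.
have c1 : mu.-integrable `]x, y] (EFin \o (fun=> c)).
  apply: measurable_bounded_integrable => //.
    by rewrite /= lebesgue_measure_itv/= lte_fin; case: ifP => _; rewrite -?EFinB ltry.
  exists c; split; first by rewrite num_real.
  by move=> r cr t _ /=; rewrite ger0_norm ltW.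
have zA : mu.-integrable `]x, y] (EFin \o (fun t => c^-1 * z t ^+ 2)).
  by apply: L1S => //; exact: L1Z.
apply: (@le_trans _ _ (\int[mu]_(t in `]x, y]) (c + c^-1 * z t ^+ 2))).
  apply: le_Rintegral => //.
  - by apply: L1S => //; exact: L1_norm.
  - have := @integrableD _ _ _ mu _ mA _ _ c1 zA; exact: eq_integrable.
  - move=> t _; rewrite -(@ler_pM2l _ c)// mulrDr mulrA divff ?gt_eqF// mul1r.
    have -> : z t ^+ 2 = `|z t| ^+ 2 by rewrite -normrX ger0_norm ?sqr_ge0.
    by have := normr_ge0 (z t); move: (`|z t|) c0 => w; clear; nra.
rewrite RintegralD// Rintegral_cst//= lebesgue_measure_itv/= lte_fin.
apply: lerD.
  by case: ltP => h; rewrite ?mulr0 ?mulr_ge0 ?(ltW c0) ?subr_ge0.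
rewrite RintegralZl//; last exact: L1S.
rewrite ler_wpM2l ?invr_ge0 ?(ltW c0)//.
apply: (le_trans (ler_norm _)); apply: (le_trans (le_Rintegral_nrm1 mA z2)).
rewrite le_eqVlt; apply/orP; left; apply/eqP; rewrite /nrm1 /sq.
by apply: eq_Rintegral => t _; rewrite ger0_norm ?sqr_ge0.
Qed.

Lemma equicontinuous_sq L C (e : R) : 0 < e -> exists2 r : R, 0 < r & forall z x y, tame L z ->
  sq z <= C -> `|x - y| <= r -> `|prim z x - prim z y| <= e.
Proof.
move=> e0; pose D : R := `|C| + 1; have D0 : 0 < D by rewrite /D ltr_pwDr.
pose c : R := 2 * D / e; have c0 : 0 < c by rewrite divr_gt0 ?mulr_gt0.
have r0 : 0 < e / (2 * c) by apply: divr_gt0 => //; exact: mulr_gt0.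
exists (e / (2 * c)) => // z + + tz zC.
have key x y : x <= y -> `|x - y| <= e / (2 * c) -> `|prim z x - prim z y| <= e.
  move=> xy xyr; rewrite distrC; apply: (le_trans (prim_modulus tz c0 xy)).
  have h1 : c * (y - x) <= e / 2.
    have -> : e / 2 = c * (e / (2 * c)) by field; rewrite gt_eqF.
    by rewrite ler_pM2l// -[y - x]ger0_norm ?subr_ge0// distrC.
  have h2 : c^-1 * sq z <= e / 2.
    have -> : e / 2 = c^-1 * D by rewrite /c; field; rewrite !gt_eqF.
    rewrite ler_pM2l ?invr_gt0//; apply: (le_trans zC); apply: (le_trans (ler_norm _)).
    by rewrite /D lerDl.
  by clear -h1 h2; lra.
move=> x y xyr; have [xy|yx] := leP x y; first exact: key.
by rewrite distrC; apply: key; [exact: ltW|rewrite distrC].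
Qed.

End Modulus.

(** * Exceptional sets and hulls along subsequences *)

Section Subsequences.
Variable R : realType.
Implicit Types (f : nat -> R -> R) (x y c C L e : R) (U : set R).
Local Notation mu := (@lebesgue_measure R).

Lemma borel_cantelli_ae (B : nat -> set R) : (forall n, measurable (B n)) ->
  (forall n, (mu (B n) <= ((2^-1 : R) ^+ n)%:E)%E) ->
  {ae mu, forall x, exists N, forall n, (N <= n)%N -> ~ B n x}.
Proof.
move=> mB B2; exists (lim_sup_set B); split.
- by apply: bigcap_measurable => // k _; apply: bigcup_measurable => m _; exact: mB.
- apply: lim_sup_set_cvg0 => //; apply: (@le_lt_trans _ _ 2%:E); last exact: ltry.
  apply: lime_le; first exact: is_cvg_nneseries.
  apply: nearW => n /=; rewrite big_mkord.
  apply: (@le_trans _ _ (\sum_(i < n) ((2^-1 : R) ^+ i)%:E)%E).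
    by apply: lee_sum => i _; exact: B2.
  by rewrite sumEFin lee_fin; exact: geometric_half_le.
- move=> x /= nx n _; apply: contrapT => nB; apply: nx; exists n => m nm Bm.
  by apply: nB; exists m.
Qed.

Lemma hull_adm f U (g : R -> R) n : (forall m, adm U (f m)) -> hull f n g -> adm U g.
Proof.
move=> fU; elim=> [m _|u v _ hu _ hv]; first exact: fU.
apply: adm_lin => //.
have -> : (fun x => 2^-1 * v x) = (fun x => 2^-1 * v x + 0) by apply/funext => x; rewrite addr0.
exact: adm_lin hv (adm0 U).
Qed.

(** Closed balls are convex, so a bound on the terms of a tail passes to its hull. *)
Lemma hull_prim_near f U (g : R -> R) n (w e x : R) : (forall m, adm U (f m)) ->
  (forall m, (n <= m)%N -> `|prim (f m) x - w| <= e) -> hull f n g ->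
  `|prim g x - w| <= e.
Proof.
move=> fU fw; elim=> [m nm|u v hu IHu hv IHv]; first exact: fw.
have u1 := adm_L1 (hull_adm fU hu); have v1 := adm_L1 (hull_adm fU hv).
rewrite prim_lin//; last exact: L1Z.
rewrite primZ//; move: IHu IHv; move: (prim u x) (prim v x) => p q; clear.
by rewrite !ler_norml => /andP[? ?] /andP[? ?]; apply/andP; split; lra.
Qed.

Lemma prim2_near U L (z k : R -> R) e x : 0 <= L -> inball U L -> der2_0 U z -> der2_0 U k ->
  (forall x, `|prim z x - prim k x| <= e) -> `|prim (prim z) x - prim (prim k) x| <= 2 * L * e.
Proof.
move=> L0 UL Jz Jk zk.
have z1 := der2_0_prim_L1 UL Jz; have k1 := der2_0_prim_L1 UL Jk.
rewrite -primB//; apply: (le_trans (le_prim _ (L1B z1 k1))).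
apply: nrm1_sup => //; first exact: L1_measurable (L1B z1 k1).
move=> y Ly; rewrite (der2_0_prim_eq0 Jz) ?(der2_0_prim_eq0 Jk) ?subrr//;
  exact: inball_eq0 UL Ly.
Qed.

End Subsequences.

Lemma dist_trans (R : realType) (a b u v w : R) : `|v - u| <= a -> `|v - w| <= b -> `|u - w| <= a + b.
Proof. by move=> va wb; apply: (le_trans (ler_distD v _ _)); rewrite lerD// distrC. Qed.

Lemma dist_le (R : realType) (u v c e : R) : `|u - v| <= e -> u <= c -> v <= c + e.
Proof. by rewrite ler_norml => /andP[? ?] ?; lra. Qed.

(** * Lower semicontinuity *)

Section Limit.
Variables (R : realType) (Om : set R) (L : R) (zs : nat -> R -> R) (S : R).
Hypotheses (L0 : 0 <= L) (UL : inball Om L) (oU : open Om).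
Implicit Types (z y f g h k : R -> R) (x a b c e p r : R).
Local Notation mu := (@lebesgue_measure R).

Hypothesis zadm : forall j, adm Om (zs j).
Hypothesis zsq : forall j, sq (zs j) <= S.
Hypothesis zW : exists W : R -> R, forall e, 0 < e -> exists J, forall j, (J <= j)%N ->
  forall x, `|prim (zs j) x - W x| <= e.

(* [cofinal ts]: ts is, up to order and repetitions, a subsequence of zs. *)
Definition cofinal (ts : nat -> R -> R) := forall n, exists2 j, (n <= j)%N & ts n = zs j.

(** Whichever subsequence the hulls are taken from, the primitive of their limit is the uniform
    limit [W]; by injectivity of [prim] all these limits agree almost everywhere with one k, which
    is set to zero outside [Om]. *)
Lemma hull_limit : exists k, [/\ der2_0 Om k, forall x, ~ Om x -> k x = 0,
  forall e, 0 < e -> exists J, forall j, (J <= j)%N -> forall x,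
    `|prim (zs j) x - prim k x| <= e /\ `|prim (prim (zs j)) x - prim (prim k) x| <= e &
  forall ts, cofinal ts -> exists g : nat -> R -> R, [/\ forall n, hull ts n (g n),
    nrm1 (fun x => g n x - k x) @[n --> \oo] --> 0 &
    {ae mu, forall x, g n x @[n --> \oo] --> k x}]].
Proof.
have [W HW] := zW.
have tadm ts : cofinal ts -> forall n, adm Om (ts n) by move=> ct n; have [j _ ->] := ct n.
have K ts : cofinal ts -> exists (g : nat -> R -> R) k, [/\ forall n, hull ts n (g n), L1 k,
    nrm1 (fun x => g n x - k x) @[n --> \oo] --> 0,
    {ae mu, forall x, g n x @[n --> \oo] --> k x} & forall x, prim k x = W x].
  move=> ct; have ta := tadm ts ct.
  have tt n : tame L (ts n) by exact: adm_tame UL (ta n).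
  have t2 n : sq (ts n) <= S by have [j _ ->] := ct n.
  have [g [k [hg k1 gk aegk]]] := komlos L0 tt t2.
  exists g, k; split => // x; apply/eqP; rewrite -subr_eq0 -normr_eq0; apply/eqP/le_anti.
  rewrite normr_ge0 andbT; apply: (@le0_eps _ _ 2) => // e e0.
  have [J HJ] := HW e e0; have [N HN] := cvg0_le gk e0.
  pose n := maxn J N.
  have ga := hull_adm ta (hg n).
  have h1 : `|prim (g n) x - W x| <= e.
    apply: (hull_prim_near ta _ (hg n)) => m nm; have [j mj ->] := ct m.
    by apply: HJ; apply: leq_trans mj; apply: leq_trans nm; exact: leq_maxl.
  have h2 : `|prim (g n) x - prim k x| <= e.
    rewrite -primB ?(adm_L1 ga)//; apply: (le_trans (le_prim _ (L1B (adm_L1 ga) k1))).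
    by apply: (le_trans (ler_norm _)); exact/HN/leq_maxr.
  by rewrite mulrDl mul1r; exact: dist_trans h2 h1.
have [g0 [k1 [hg0 k1L gk0 aegk0 pk1]]] := K zs (fun n => ex_intro2 _ _ n (leqnn n) erefl).
have Jk1 : der2_0 Om k1.
  apply: der2_0_lim => // e e0; have [N HN] := cvg0_le gk0 e0.
  exists (g0 N); first exact: adm_der2_0 (hull_adm zadm (hg0 N)).
  by apply: (le_trans (ler_norm _)); exact: HN.
have kk : {ae mu, forall x, k1 x = (k1 \_ Om) x}.
  apply: (aeS aegk0) => x cv; rewrite patchE; case: ifPn => //; rewrite notin_setE => Ox.
  have gx n : g0 n x = 0 by have [_ _ /(_ x Ox) ->] := hull_adm zadm (hg0 n).
  change (k1 x = 0); move: cv; rewrite (_ : (fun n => g0 n x) = cst 0); last by apply/funext.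
  by move=> /cvg_lim <- //; rewrite lim_cst.
have mk1 := L1_measurable k1L.
have mk : measurable_fun setT (k1 \_ Om).
  by apply: L1_measurable; apply: L1_patch => //; exact: open_measurable.
have Jk : der2_0 Om (k1 \_ Om) by exact: der2_0_ae Jk1.
have pk x : prim (k1 \_ Om) x = W x by rewrite -pk1; apply/esym; exact: ae_eq_prim.
exists (k1 \_ Om); split => //.
- by move=> x Ox; rewrite patchE; case: ifPn => //; rewrite inE.
(* A distance r of the first derivatives costs 2 L r for the functions, hence the minimum. *)
- move=> e e0; pose r : R := Num.min e (e / (2 * L + 1)).
  have L21 : 0 < 2 * L + 1 by rewrite ltr_wpDl// mulr_ge0.
  have r0 : 0 < r by rewrite lt_min e0 divr_gt0.
  have re : r <= e by rewrite ge_min lexx.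
  have rL : 2 * L * r <= e.
    apply: (@le_trans _ _ ((2 * L + 1) * r)); first by rewrite ler_pM2r// lerDl.
    by rewrite mulrC -ler_pdivlMr// ge_min lexx orbT.
  have [J HJ] := HW r r0; exists J => j Jj x.
  have h (y : R) : `|prim (zs j) y - prim (k1 \_ Om) y| <= r by rewrite pk; exact: HJ.
  split; first exact: le_trans (h x) re.
  by apply: le_trans rL; exact: prim2_near (adm_der2_0 (zadm j)) Jk h.
- move=> ts ct; have [g [k' [hg k'1 gk aegk pk']]] := K ts ct.
  have k'k : {ae mu, forall x, k' x = (k1 \_ Om) x}.
    by apply: prim_inj => //; [exact: der2_0_L1 Jk|move=> x; rewrite pk pk'].
  exists g; split => //.
    rewrite (_ : (fun n => _) = (fun n => nrm1 (fun x => g n x - k' x)))//.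
    apply/funext => n; apply: ae_eq_nrm1.
    + by apply: measurable_funB => //; exact: L1_measurable (adm_L1 (hull_adm (tadm _ ct) (hg n))).
    + apply: measurable_funB; first exact: L1_measurable (adm_L1 (hull_adm (tadm _ ct) (hg n))).
      exact: L1_measurable k'1.
    + by apply: (aeS k'k) => x ->.
  by apply: (aeS2 aegk k'k) => x cv <-.
Qed.

End Limit.

Section LSC.
Variables (R : realType) (Om : set R) (L : R) (F : R -> R -> R -> R -> R).
Variables (d A G C s t : R).
Hypotheses (L0 : 0 <= L) (UL : inball Om L) (oU : open Om).
Hypothesis I : integrand Om F d A G C s t.
Implicit Types (z y f g h : R -> R) (x a b c e p r B : R) (O : set R).
Local Notation mu := (@lebesgue_measure R).
Local Notation V := (fine (mu Om)).
Local Notation hf := (hf F).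
Local Notation Ip := (Ip F).

Let mU : measurable Om := open_measurable oU.

Variables (zs : nat -> R -> R) (k : R -> R).
Hypothesis zadm : forall j, adm Om (zs j).
Hypothesis zsk : forall e, 0 < e -> exists J, forall j, (J <= j)%N -> forall x,
    `|prim (zs j) x - prim k x| <= e /\ `|prim (prim (zs j)) x - prim (prim k) x| <= e.
Hypothesis zshull : forall ts, cofinal zs ts -> exists g : nat -> R -> R,
  [/\ forall n, hull ts n (g n), nrm1 (fun x => g n x - k x) @[n --> \oo] --> 0 &
    {ae mu, forall x, g n x @[n --> \oo] --> k x}].

(* At almost every x, eventually all [zs j x] lie in a sublevel set of
   [F x (u x) (u' x)]; being convex, it also contains the hulls and their limit. *)
Lemma level_limit O c : measurable O -> O `<=` Om ->
  (forall e, 0 < e -> exists J, forall j, (J <= j)%N ->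
    (mu (O `&` [set x | (c < hf (zs j) x)%R]) <= e%:E)%E) ->
  {ae mu, forall x, O x -> hf k x <= c}.
Proof.
move=> mO OU Oc.
(* Passing to a subsequence makes the measures of the superlevel sets summable, as Borel-Cantelli
   requires. *)
have /choice[q Hq] : forall n, exists j, (n <= j)%N /\
    (mu (O `&` [set x | (c < hf (zs j) x)%R]) <= ((2^-1 : R) ^+ n)%:E)%E.
  move=> n; have [|J HJ] := Oc (2^-1 ^+ n); first by rewrite exprn_gt0.
  by exists (maxn n J); split; [exact: leq_maxl|exact/HJ/leq_maxr].
pose ts n := zs (q n).
have [|g [hg _ aeg]] := zshull (ts := ts).
  by move=> n; exists (q n) => //; have [] := Hq n.
have bc : {ae mu, forall x, exists N, forall n, (N <= n)%N -> ~ (O `&` [set x | c < hf (ts n) x]) x}.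
  apply: borel_cantelli_ae => n; last by have [] := Hq n.
  by apply: (superlevel_measurable L0 UL oU I _ mO OU); exact: adm_der2_0 (zadm _).
apply: (aeS3 aeg bc (int_coer I)) => x gk [N0 HN0] coer Ox.
have OUx := OU _ Ox; have hN0 n : (N0 <= n)%N -> hf (ts n) x <= c.
  by move=> /HN0 h; rewrite leNgt; apply/negP => ch; apply: h.
pose a := prim (prim k) x; pose b := prim k x.
have near e : 0 < e -> exists N, forall n, (N <= n)%N ->
    `|prim (ts n) x - b| <= e /\ `|prim (prim (ts n)) x - a| <= e.
  move=> e0; have [J HJ] := zsk e0; exists J => n Jn; apply: HJ.
  by have [nq _] := Hq n; exact: leq_trans nq.
have C0 := int_C I; have G0 := int_G I.
(* By coercivity this bounds [ts n x] when its integrand is at most c and the lower-order terms are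
   within 1 of those of k; [int_cont] is uniform only over bounded last arguments. *)
pose B : R := A + C * c + C * ((G + (`|a| + 1)) `^ s + (G + (`|b| + 1)) `^ t).
have [N1 HN1] := near 1 ltr01.
have tB n : (maxn N0 N1 <= n)%N -> `|ts n x| <= B.
  rewrite geq_max => /andP[n0 n1].
  apply: le_trans (coer OUx (prim (prim (ts n)) x) (prim (ts n) x) (ts n x)) _.
  have [h1 h2] := HN1 n n1.
  have up u v : `|u - v| <= 1 -> `|u| <= `|v| + 1.
    by move=> uv; rewrite -lerBlDl; apply: le_trans uv; exact: lerB_dist.
  have [/andP[s0 _] /andP[t0 _]] := (int_s I, int_t I).
  rewrite lerD// ?lerD2l ?ler_wpM2l// ?hN0//.
  by apply: lerD; apply: ge0_ler_powR; rewrite ?nnegrE ?lerD2l ?addr_ge0 ?up.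
have key e : 0 < e -> F x a b (k x) <= c + e + e.
  (* One e pays for moving the lower-order arguments of the terms to those of k, the other for the
     convergence of the hulls at x. *)
  move=> e0; have [r r0 Hr] := int_cont I a b B OUx e0.
  have [r' r'0 Hr'] := int_cont I a b `|k x| OUx e0.
  have [N2 HN2] := near r r0.
  have [N3 HN3] : exists N, forall n, (N <= n)%N -> `|g n x - k x| <= r'.
    move/cvgrPdist_le : gk => /(_ r' r'0)[N _ HN].
    by exists N => n /HN; rewrite distrC.
  pose N := maxn (maxn N0 N1) (maxn N2 N3).
  have gN : F x a b (g N x) <= c + e.
    elim: (hg N) => [m Nm|u v _ hu _ hv]; last exact: (int_conv I).
    have mN2 : (N2 <= m)%N by apply: leq_trans Nm; rewrite !leq_max leqnn !orbT.
    have mN01 : (maxn N0 N1 <= m)%N by apply: leq_trans Nm; exact: leq_maxl.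
    have [h1 h2] := HN2 m mN2.
    have := Hr _ _ (ts m x) (ts m x) h2 h1 (tB _ mN01); rewrite subrr normr0 => /(_ (ltW r0)).
    by move=> h; apply: (dist_le h); exact: hN0 m (leq_trans (leq_maxl _ _) mN01).
  have := Hr' a b (k x) (g N x); rewrite !subrr !normr0 => /(_ (ltW r'0) (ltW r'0) (lexx _)).
  move=> /(_ (HN3 _ (leq_trans (leq_maxr _ _) (leq_maxr _ _)))).
  by move=> h; exact: dist_le h gN.
rewrite -subr_le0; apply: (@le0_eps _ _ 2) => // e e0.
by rewrite lerBlDl mulrDl mul1r addrA; exact: key.
Qed.

End LSC.

Lemma powR_small (R : realType) (r e : R) : 0 < r < 1 -> 0 < e -> exists B : R,
  forall p, B <= p -> r `^ p <= e.
Proof.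
move=> /andP[r0 r1] e0; exists (ln e / ln r) => p Bp.
have lr : ln r < 0 by rewrite -ln1 ltr_ln ?posrE.
rewrite /powR (gt_eqF r0) -[leRHS](lnK e0) ler_expR.
by move: Bp; rewrite ler_ndivrMr.
Qed.

Lemma powR_half (R : realType) (p : R) : 2 `^ (- p) = 2^-1 `^ p.
Proof. by rewrite -powR_inv1// -powRrM mulN1r. Qed.

(** * Pointwise bounds from bounds on power energies *)

Section Energy_limit.
Variables (R : realType) (Om : set R) (L : R) (F : R -> R -> R -> R -> R).
Variables (d A G C s t : R).
Hypotheses (L0 : 0 <= L) (UL : inball Om L) (oU : open Om).
Hypothesis I : integrand Om F d A G C s t.
Implicit Types (z y f g h : R -> R) (x a b c e p r B : R) (O : set R).
Local Notation mu := (@lebesgue_measure R).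
Local Notation V := (fine (mu Om)).
Local Notation hf := (hf F).
Local Notation Ip := (Ip F).

Let mU : measurable Om := open_measurable oU.

Variables (zs : nat -> R -> R) (k : R -> R) (p_ : nat -> R).
Hypothesis zadm : forall j, adm Om (zs j).
Hypothesis zsk : forall e, 0 < e -> exists J, forall j, (J <= j)%N -> forall x,
    `|prim (zs j) x - prim k x| <= e /\ `|prim (prim (zs j)) x - prim (prim k) x| <= e.
Hypothesis zshull : forall ts, cofinal zs ts -> exists g : nat -> R -> R,
  [/\ forall n, hull ts n (g n), nrm1 (fun x => g n x - k x) @[n --> \oo] --> 0 &
    {ae mu, forall x, g n x @[n --> \oo] --> k x}].
Hypothesis poo : forall B, exists J, forall j, (J <= j)%N -> B <= p_ j.

(** By Chebyshev the superlevel set at c has measure at most 2 V (c1 / c)^p, which tends to zero.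
    Here the exponent p^2 of the error matters: once 2^(-p) <= c1, also 2^(-p^2) <= c1^p, however
    small c1 is. *)
Lemma energy_level O c c1 : measurable O -> O `<=` Om -> 0 < c1 < c ->
  (exists J, forall j, (J <= j)%N ->
    (Ip (p_ j) O (zs j) <= (V * c1 `^ p_ j + V * 2 `^ (- (p_ j * p_ j)))%:E)%E) ->
  {ae mu, forall x, O x -> hf k x <= c}.
Proof.
move=> mO OU /andP[c10 c1c] [J0 HJ0]; have c0 : 0 < c by exact: lt_trans c1c.
apply: (level_limit L0 UL oU I zadm zsk zshull mO OU) => e e0.
have V0 : 0 <= V by exact: V_ge0.
have V1 : 0 < 2 * V + 1 by rewrite ltr_wpDl// mulr_ge0.
have [B1 HB1] : exists B, forall p, B <= p -> 2^-1 `^ p <= c1.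
  by apply: powR_small => //; rewrite invr_gt0 ltr0n invf_lt1 ?ltr1n.
have [B2 HB2] : exists B, forall p, B <= p -> (c1 / c) `^ p <= e / (2 * V + 1).
  by apply: powR_small; rewrite ?divr_gt0//= ltr_pdivrMr ?mul1r.
have [J1 HJ1] := poo B1; have [J2 HJ2] := poo B2; have [J3 HJ3] := poo 0.
exists (maxn (maxn J0 J1) (maxn J2 J3)) => j; rewrite !geq_max.
move=> /andP[/andP[j0 j1] /andP[j2 j3]]; set S := _ `&` _.
have mS : measurable S by exact: (superlevel_measurable L0 UL oU I _ mO OU (adm_der2_0 (zadm j))).
have Sfin : mu S \is a fin_num.
  rewrite ge0_fin_numE//; apply: le_lt_trans (measureU_lty UL oU).
  by apply: le_measure; rewrite ?inE// => x [/OU].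
have := chebyshev_hf L0 UL oU I mO OU (adm_der2_0 (zadm j)) (HJ3 j j3) c0.
move=> /le_trans/(_ (HJ0 j j0)); rewrite -/S -(fineK Sfin) -EFinM !lee_fin => h.
have cp : 0 < c `^ p_ j by exact: powR_gt0.
have h2 : 2 `^ (- (p_ j * p_ j)) <= c1 `^ p_ j.
  rewrite powR_half powRrM; apply: ge0_ler_powR; rewrite ?nnegrE ?powR_ge0 ?HJ3//.
    exact: ltW.
  exact/HB1/HJ1.
have h3 : c1 `^ p_ j = c `^ p_ j * (c1 / c) `^ p_ j.
  by rewrite -powRM ?divr_ge0 ?(ltW c0) ?(ltW c10)//; congr (_ `^ _); field; rewrite gt_eqF.
have h4 := HB2 _ (HJ2 j j2).
have h5 : fine (mu S) <= 2 * V * (c1 / c) `^ p_ j.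
  rewrite -(ler_pM2l cp); apply: (le_trans h).
  rewrite (_ : _ * (2 * V * _) = V * c1 `^ p_ j + V * c1 `^ p_ j); last by rewrite h3; ring.
  by rewrite lerD2l ler_wpM2l.
apply: (le_trans h5); apply: (@le_trans _ _ ((2 * V + 1) * (e / (2 * V + 1)))).
  apply: ler_pM => //; rewrite ?mulr_ge0 ?powR_ge0//; lra.
by rewrite mulrC divfK ?gt_eqF.
Qed.

Lemma energy_limit O c : measurable O -> O `<=` Om -> 0 < c ->
  (forall c1, c < c1 -> exists J, forall j, (J <= j)%N ->
    (Ip (p_ j) O (zs j) <= (V * c1 `^ p_ j + V * 2 `^ (- (p_ j * p_ j)))%:E)%E) ->
  {ae mu, forall x, O x -> hf k x <= c}.
Proof.
move=> mO OU c0 Hc.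
have H n : {ae mu, forall x, O x -> hf k x <= c + n.+1%:R^-1}.
  have n0 : 0 < n.+1%:R^-1 :> R by rewrite invr_gt0.
  have n2 : c < c + n.+1%:R^-1 / 2 by rewrite ltrDl divr_gt0.
  apply: (energy_level mO OU (c1 := c + n.+1%:R^-1 / 2)); last exact: Hc.
  by rewrite (lt_trans c0 n2) ltrD2l ltr_pdivrMr// ltr_pMr// ltr1n.
apply: (aeS (ae_foralln H)) => x Hx Ox; rewrite -subr_le0.
apply: (@le0_eps _ _ 1) => // e e0; have [N HN] := cvg0_le (@cvg_harmonic R) e0.
rewrite mul1r lerBlDl; apply: le_trans (Hx N Ox) _; rewrite lerD2l.
by apply: le_trans (HN N (leqnn N)); exact: ler_norm.
Qed.

End Energy_limit.

(** * Minimality of the limit *)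

Section Minimising_limit.
Variables (R : realType) (Om : set R) (L : R) (F : R -> R -> R -> R -> R).
Variables (d A G C s t : R).
Hypotheses (L0 : 0 <= L) (UL : inball Om L) (oU : open Om).
Hypothesis I : integrand Om F d A G C s t.
Implicit Types (z y f g h : R -> R) (x a b c e p r B : R) (O : set R).
Local Notation mu := (@lebesgue_measure R).
Local Notation V := (fine (mu Om)).
Local Notation hf := (hf F).
Local Notation Ip := (Ip F).

Let mU : measurable Om := open_measurable oU.

Variables (zs : nat -> R -> R) (p_ : nat -> R) (K : R).
Hypothesis zadm : forall j, adm Om (zs j).

Definition jets_to k := forall e, 0 < e -> exists J, forall j, (J <= j)%N -> forall x,
    `|prim (zs j) x - prim k x| <= e /\ `|prim (prim (zs j)) x - prim (prim k) x| <= e.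
Definition hulls_to k := forall ts, cofinal zs ts -> exists g : nat -> R -> R,
  [/\ forall n, hull ts n (g n), nrm1 (fun x => g n x - k x) @[n --> \oo] --> 0 &
    {ae mu, forall x, g n x @[n --> \oo] --> k x}].

Hypothesis p1 : forall j, 1 < p_ j.
Hypothesis poo : forall B, exists J, forall j, (J <= j)%N -> B <= p_ j.
Hypothesis K1 : 1 <= K.
Hypothesis zK : forall j, (Ip (p_ j) Om (zs j) <= (2 * V * K `^ p_ j)%:E)%E.

(** The limit of the hulls is so far only integrable. As 2 V K^p <= V (2 K)^p, its integrand is at
    most 3 K almost everywhere, and coercivity then bounds the limit itself, up to a null set. *)
Lemma limit_bounded k : der2_0 Om k -> (forall x, ~ Om x -> k x = 0) -> jets_to k -> hulls_to k ->
  exists2 z, adm Om z & jets_to z /\ hulls_to z.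
Proof.
move=> Jk k0 jk hk; have K0 : 0 < K by exact: lt_le_trans ltr01 K1.
have V0 : 0 <= V by exact: V_ge0.
have h3 : {ae mu, forall x, Om x -> hf k x <= 3 * K}.
  apply: (energy_level (c1 := 2 * K) L0 UL oU I zadm jk hk poo mU (@subset_refl _ Om)).
    by rewrite mulr_gt0//= ltr_pM2r// ltr_nat.
  exists 0%N => j _; apply: (le_trans (zK j)); rewrite lee_fin.
  apply: (@le_trans _ _ (V * (2 * K) `^ p_ j)); last by rewrite lerDl mulr_ge0 ?powR_ge0.
  rewrite powRM ?(ltW K0)// -mulrA mulrCA ler_wpM2l// ler_wpM2r ?powR_ge0//.
  by rewrite -[leLHS](powRr1 (ler0n R 2)) ler_powR ?ler1n// ltW.
pose D : R := A + C * ((G + 2 * L * nrm1 k) `^ s + (G + nrm1 k) `^ t) + C * (3 * K).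
have kD : {ae mu, forall x, `|k x| <= `|D|}.
  apply: (aeS2 h3 (coercive_le L0 UL I Jk (lexx _))) => x h kx.
  have [Ox|Ox] := pselect (Om x); last by rewrite k0// normr0.
  apply: le_trans (kx Ox) (le_trans _ (ler_norm _)).
  by rewrite lerD2l ler_wpM2l ?(int_C I)//; exact: h.
have [z az kz] := der2_0_adm Jk k0 kD.
have mk := L1_measurable (der2_0_L1 Jk); have mz := L1_measurable (adm_L1 az).
have pz : prim z = prim k by apply/funext => x; apply/esym; exact: ae_eq_prim.
have jz : jets_to z by rewrite /jets_to pz.
exists z => //; split => //.
move=> ts ct; have [g [hg gk aeg]] := hk ts ct; exists g; split => //.
  have ga n : adm Om (g n) by apply: hull_adm (hg n) => m; have [j _ ->] := ct m.
  rewrite (_ : (fun n => _) = (fun n => nrm1 (fun x => g n x - k x)))//.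
  apply/funext => n; have mg := L1_measurable (adm_L1 (ga n)).
  by apply: ae_eq_nrm1; [exact: measurable_funB|exact: measurable_funB|apply: (aeS kz) => x ->].
by apply: (aeS2 aeg kz) => x cv <-.
Qed.

Variable k : R -> R.
Hypotheses (kadm : adm Om k) (jk : jets_to k) (hk : hulls_to k).
Hypothesis zmin : forall j y, adm Om y ->
  (Ip (p_ j) Om (zs j) <= Ip (p_ j) Om y + (V * 2 `^ (- (p_ j * p_ j)))%:E)%E.

Lemma limit_global y c : adm Om y -> 0 < c -> {ae mu, forall x, Om x -> hf y x <= c} ->
  {ae mu, forall x, Om x -> hf k x <= c}.
Proof.
move=> ay c0 yc; apply: (energy_limit L0 UL oU I zadm jk hk poo mU (@subset_refl _ Om) c0).
move=> c1 cc1; exists 0%N => j _; apply: (le_trans (zmin j ay)).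
rewrite EFinD leeD2r//.
have pj : 0 <= p_ j by apply: ltW; exact: lt_trans ltr01 (p1 j).
apply: (Ip_le L0 UL oU I mU (@subset_refl _ Om) (adm_der2_0 ay)) => //.
  exact: ltW (lt_trans c0 cc1).
by apply: (aeS yc) => x h Ox; exact: le_trans (h Ox) (ltW cc1).
Qed.

(** The variation y has zero value and slope at a and b, which lie outside U. The boundary mismatch
    between k + y and [zs j] is therefore the one between k and [zs j]. *)
Lemma limit_local (U : set R) y a b c : a < b -> `[a, b] `<=` Om -> U `<=` Om -> ~ U a -> ~ U b ->
  adm U y -> 0 < c -> {ae mu, forall x, a < x < b -> hf (fun x => k x + y x) x <= c} ->
  {ae mu, forall x, a < x < b -> hf k x <= c}.
Proof.
move=> ab abO UO Ua Ub ayU c0 yc.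
pose v x := k x + y x; have ay := admS UO ayU.
have av : adm Om v by exact: admD.
have abO' : `]a, b[ `<=` Om.
  by move=> x /=; rewrite in_itv/= => /andP[ax xb]; apply: abO; rewrite /= in_itv/= !ltW.
have mab : measurable (`]a, b[%classic : set R) by exact: measurable_itv.
suff H : {ae mu, forall x, `]a, b[%classic x -> hf k x <= c}.
  by apply: (aeS H) => x h xab; apply: h; rewrite /= in_itv.
apply: (energy_limit L0 UL oU I zadm jk hk poo mab abO' c0) => c1 cc1.
have e0 : 0 < c1 - c by rewrite subr_gt0.
have [_ [Bv vB] _ Jv] := av; have v1 := adm_L1 av.
pose B : R := `|Bv| + nrm1 v + 2 * L * nrm1 v.
have n0 := nrm1_ge0 v; have Ln0 : 0 <= 2 * L * nrm1 v by rewrite !mulr_ge0.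
have B0 x : `|v x| <= B.
  by apply: (le_trans (vB x)); apply: (le_trans (ler_norm _)); rewrite /B -addrA lerDl addr_ge0.
have B1 x : `|prim v x| <= B.
  by apply: (le_trans (le_prim x v1)); rewrite /B addrAC lerDr addr_ge0.
have B2 x : `|prim (prim v) x| <= B.
  by apply: (le_trans (le_prim2 x L0 UL Jv)); rewrite /B lerDr addr_ge0.
have [r r0 aer] := int_unif I B abO e0.
have [C0 C00 cut] := der2_0_cut ab.
have C1 : 0 < C0 + 1 by rewrite ltr_wpDl.
(* A mismatch of this size changes the jet by at most r, the tolerance of the integrand around the
   jet of v. *)
have eps0 : 0 < r / (C0 + 1) by rewrite divr_gt0.
have epsr : C0 * (r / (C0 + 1)) <= r.
  by rewrite mulrCA ler_piMr ?(ltW r0)// ler_pdivrMr ?mul1r ?lerDl.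
have [J HJ] := jk eps0; exists J => j Jj.
have Jz := adm_der2_0 (zadm j).
have Jf : der2_0 Om (fun x => v x - zs j x) by exact: der2_0B.
have pB x : prim (fun x => v x - zs j x) x = prim v x - prim (zs j) x.
  exact: (primB x v1 (adm_L1 (zadm j))).
have pf x : ~ U x -> `|prim (fun x => v x - zs j x) x| <= r / (C0 + 1) /\
    `|prim (prim (fun x => v x - zs j x)) x| <= r / (C0 + 1).
  move=> Ux; have [h1 h2] := HJ j Jj x.
  rewrite (prim2B UL Jv Jz) pB (primD x (adm_L1 kadm) (adm_L1 ay)) (der2_0_prim_eq0 (adm_der2_0 ayU) Ux) addr0.
  have -> : prim (prim (fun x => k x + y x)) = fun x => prim (prim k) x + prim (prim y) x.
    have := prim2_lin UL 1 (adm_der2_0 kadm) (adm_der2_0 ay).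
    by under eq_fun do rewrite mul1r; move=> ->; apply/funext => u; rewrite mul1r.
  rewrite (der2_0_prim2_eq0 L0 _ (adm_der2_0 ayU) Ux) ?addr0; last by move=> u /UO/UL.
  by split; rewrite distrC.
have [[fa ffa] [fb ffb]] := (pf a Ua, pf b Ub).
have [w [Jw w0 wf]] := cut Om L _ _ L0 UL Jf fa fb ffa ffb.
have hfE z x : hf z x = F x (prim (prim z) x) (prim z x) (z x) by [].
have IpE p O z : Ip p O z = (\int[mu]_(x in O) ((hf z x) `^ p)%:E)%E by [].
have inab x : `]a, b[%classic x = (a < x < b) :> Prop by rewrite /= in_itv.
have aw : adm (`]a, b[%classic : set R) w.
  split => //; first exact: L1_measurable (der2_0_L1 Jw).
    have [_ [Bz zB] _ _] := zadm j.
    exists (r + (`|Bv| + `|Bz|)) => x; have [xab|xab] := boolP (a < x < b).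
      have [h _ _] := wf x xab.
      rewrite -[w x](subrK (v x - zs j x)); apply: (le_trans (ler_normD _ _)).
      apply: lerD; first exact: le_trans h epsr.
      apply: (le_trans (ler_normB _ _)).
      by apply: lerD; [apply: (le_trans (vB x))|apply: (le_trans (zB x))]; exact: ler_norm.
    by rewrite w0// normr0 !addr_ge0// ltW.
  by move=> x; rewrite inab => /negP/w0.
have awO := admS abO' aw; have JwO := adm_der2_0 awO.
(* Outside [`]a, b[] the competitor Z has the same jet as [zs j], so these parts of
   the energies cancel in the minimality inequality. *)
pose Z x := zs j x + w x; have aZ : adm Om Z by exact: admD.
have pZ x : prim Z x = prim (zs j) x + prim w x by rewrite /Z primD ?(adm_L1 (zadm j)) ?(adm_L1 aw).
have ppZ x : prim (prim Z) x = prim (prim (zs j)) x + prim (prim w) x.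
  have := prim2_lin UL 1 Jz JwO; rewrite /Z.
  by under eq_fun do rewrite mul1r; move=> ->; rewrite mul1r.
have Zc : {ae mu, forall x, `]a, b[%classic x -> hf Z x <= c1}.
  apply: (aeS2 yc aer) => x vc Fr; rewrite inab => xab.
  have [h0 h1 h2] := wf x xab; have /andP[ax xb] := xab.
  have axb : a <= x <= b by rewrite !ltW.
  move: h1 h2; rewrite (prim2B UL Jv Jz) pB => h1 h2.
  have near (u q q' : R) : `|q - (u - q')| <= C0 * (r / (C0 + 1)) -> `|(q' + q) - u| <= r.
    by move=> h; apply: le_trans epsr; apply: le_trans h; rewrite opprB addrCA addrA.
  have := Fr axb (prim (prim v) x) (prim v x) (v x) (prim (prim Z) x) (prim Z x) (Z x)
    (B2 x) (B1 x) (B0 x).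
  rewrite pZ ppZ => /(_ (near _ _ _ h2) (near _ _ _ h1) (near _ _ _ h0)).
  rewrite distrC => h; rewrite -(subrKC c c1).
  by rewrite hfE pZ ppZ; apply: (dist_le h); exact: vc xab.
have Zz x : ~ `]a, b[%classic x -> hf Z x = hf (zs j) x.
  move=> xab; rewrite !hfE pZ ppZ /Z.
  rewrite (der2_0_prim_eq0 Jw xab) (der2_0_prim2_eq0 L0 _ Jw xab); last by move=> u /abO'/UL.
  by have [_ _ /(_ x xab) -> _] := aw; rewrite !addr0.
have pj : 0 <= p_ j by apply: ltW; exact: lt_trans ltr01 (p1 j).
have split_Ip z : adm Om z -> (Ip (p_ j) Om z = Ip (p_ j) `]a, b[ z + Ip (p_ j) (Om `\` `]a, b[) z)%E.
  move=> az; rewrite !IpE -{1}(setDUK abO') ge0_integral_setU//.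
  - exact: measurableD.
  - by rewrite setDUK//; exact: (hfp_measurable L0 UL oU I _ mU (@subset_refl _ Om) (adm_der2_0 az)).
  - by move=> x _; rewrite lee_fin powR_ge0.
  - by apply/disj_setPS => x [? [_]].
have rest : (Ip (p_ j) (Om `\` `]a, b[) Z = Ip (p_ j) (Om `\` `]a, b[) (zs j))%E.
  by apply: eq_integral => x; rewrite inE => -[_ xab]; rewrite Zz.
have := zmin j aZ; rewrite (split_Ip _ (zadm j)) (split_Ip _ aZ) rest.
(* The outer energies may be cancelled because they are finite. *)
have fin_rest : (Ip (p_ j) (Om `\` `]a, b[) (zs j) \is a fin_num)%E.
  rewrite ge0_fin_numE ?Ip_ge0//; apply: le_lt_trans (ltry (2 * V * K `^ p_ j)).
  by apply: le_trans (zK j); rewrite (split_Ip _ (zadm j)) leeDr// Ip_ge0.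
rewrite addeAC leeD2rE// => /le_trans; apply.
rewrite EFinD leeD2r//.
apply: (Ip_le L0 UL oU I mab abO' (adm_der2_0 aZ) pj _ Zc).
exact: ltW (lt_trans c0 cc1).
Qed.

End Minimising_limit.

(** * Extraction of the limit *)

Section Minimising_sequence.
Variables (R : realType) (Om : set R) (L : R) (F : R -> R -> R -> R -> R).
Variables (d A G C s t : R).
Hypotheses (L0 : 0 <= L) (UL : inball Om L) (oU : open Om).
Hypothesis I : integrand Om F d A G C s t.
Implicit Types (z y f g h : R -> R) (x a b c e p r B : R) (O : set R).
Local Notation mu := (@lebesgue_measure R).
Local Notation V := (fine (mu Om)).
Local Notation hf := (hf F).
Local Notation Ip := (Ip F).

Let mU : measurable Om := open_measurable oU.

Lemma sq_UE z : adm Om z -> (sq z)%:E = (\int[mu]_(x in Om) (`|z x| `^ 2)%:E)%E.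
Proof.
move=> az; have [_ _ z0 _] := az.
rewrite /sq /Rintegral fineK; last first.
  by apply: integrable_fin_num => //; exact: tame_sqr_L1 (adm_tame UL az).
rewrite [RHS]integral_mkcond; apply: eq_integral => x _; rewrite patchE.
case: ifPn => [_|]; first by rewrite powR_mulrn// -normrX ger0_norm ?sqr_ge0.
by rewrite notin_setE => /z0 ->; rewrite expr0n.
Qed.

Variables (z_ : R -> R -> R) (K : R).
Hypothesis K1 : 1 <= K.
Hypothesis zK : exists2 y, adm Om y & {ae mu, forall x, Om x -> hf y x <= K}.
Hypothesis zadm : forall p, 1 < p -> adm Om (z_ p).
Hypothesis zmin : forall p, 1 < p -> forall y, adm Om y ->
  (Ip p Om (z_ p) <= Ip p Om y + (V * 2 `^ (- (p * p)))%:E)%E.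

(** The exponents n + 2 exceed 1, as the family demands, and are at least 2, so that the square
    integrals are bounded. *)
Lemma minimising_limit : exists p_ : nat -> R, exists k,
  [/\ forall j, 1 < p_ j, forall B, exists J, forall j, (J <= j)%N -> B <= p_ j, adm Om k,
      jets_to (fun j => z_ (p_ j)) k & hulls_to (fun j => z_ (p_ j)) k].
Proof.
have q1 n : 1 < (n + 2)%:R :> R by rewrite ltr1n addn2.
have q2 n : 2 <= (n + 2)%:R :> R by rewrite ler_nat leq_addl.
have [Y HY] := nrm1_family L0 UL oU I K1 zK zadm zmin.
have [S HS] := moment_family L0 UL oU I K1 zK zadm zmin HY (ler0n R 2).
pose zn n := z_ (n + 2)%:R.
have zna n : adm Om (zn n) by exact: zadm.
have znS n : sq (zn n) <= S by rewrite -lee_fin sq_UE//; exact: HS.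
have znC n x : `|prim (zn n) x| <= Y.
  exact: le_trans (le_prim x (adm_L1 (zna n))) (HY _ (q1 n)).
have zn0 n x : L < `|x| -> prim (zn n) x = 0.
  by move=> Lx; apply: (der2_0_prim_eq0 (adm_der2_0 (zna n))); exact: inball_eq0 UL Lx.
have [e|W [nu [nuS nuW]]] := ascoli L0 znC zn0.
  move=> e0; have [r r0 Hr] := equicontinuous_sq L S e0; exists r => // n x y xy.
  by apply: Hr => //; exact: adm_tame UL (zna n).
have nuj j : (j <= nu j)%N by elim: j => // j IHj; exact: leq_ltn_trans (nuS j).
pose p_ j : R := (nu j + 2)%:R.
have poo B : exists J, forall j, (J <= j)%N -> B <= p_ j.
  have [N BN] : exists N : nat, B <= N%:R.
    by exists (Num.truncn B).+1; apply: ltW; exact: truncnS_gt.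
  exists N => j Nj; apply: (le_trans BN); rewrite ler_nat.
  by apply: leq_trans (leq_addr _ _); exact: leq_trans (nuj j).
have [k [Jk k0 jk hk]] := hull_limit L0 UL oU (fun j => zna (nu j)) (fun j => znS (nu j))
  (ex_intro _ W nuW).
have p1 j : 1 < p_ j by exact: q1.
have [z az [jz hz]] := limit_bounded L0 UL oU I (fun j => zna (nu j)) p1 poo K1
  (fun j => Ip_family L0 UL oU I K1 zK zmin (p1 j)) Jk k0 jk hk.
by exists p_, z.
Qed.

End Minimising_sequence.

(** * Weak convergence *)

Section Moments.
Variables (R : realType) (Om : set R) (L : R).
Hypotheses (L0 : 0 <= L) (UL : inball Om L) (oU : open Om).
Implicit Types (z y f g h : R -> R) (x a b c e p q r B D : R).
Local Notation mu := (@lebesgue_measure R).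
Local Notation V := (fine (mu Om)).

Let mU : measurable Om := open_measurable oU.

Definition mom r f := (\int[mu]_(x in Om) (`|f x| `^ r)%:E)%E.

Lemma mom_measurable r f : measurable_fun Om f -> measurable_fun Om (fun x => (`|f x| `^ r)%:E).
Proof.
move=> mf; apply/measurable_EFinP; apply: (measurableT_comp (measurable_powR r)).
exact: measurableT_comp.
Qed.

Lemma mom_ge0 r f : (0 <= mom r f)%E.
Proof. by apply: integral_ge0 => x _; rewrite lee_fin powR_ge0. Qed.

Lemma Lnorm_onE q f : 0 < q -> Lnorm_on q%:E Om f = (mom q f `^ q^-1)%E.
Proof.
move=> q0; have q00 : q != 0 by rewrite gt_eqF.
rewrite (Lnorm_real Om f q00).
suff -> : (\int[mu]_x (`|(f \_ Om) x| `^ q)%:E)%E = mom q f by [].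
rewrite /mom [RHS]integral_mkcond; apply: eq_integral => x _; rewrite !patchE.
by case: ifP => // _; rewrite normr0 powR0// gt_eqF.
Qed.

Lemma Lnorm_on_le q f e : 0 < q -> 0 <= e -> (mom q f <= (e `^ q)%:E)%E ->
  (Lnorm_on q%:E Om f <= e%:E)%E.
Proof.
move=> q0 e0 fe; rewrite Lnorm_onE//.
have -> : e%:E = ((e `^ q)%:E `^ q^-1)%E.
  by rewrite poweR_EFin -powRrM divff ?gt_eqF// powRr1.
apply: gt0_ler_poweR => //; first by rewrite invr_ge0 ltW.
  by rewrite in_itv/= mom_ge0 leey.
by rewrite in_itv/= lee_fin powR_ge0 leey.
Qed.

Lemma mom_bounded r f c : 0 <= r -> measurable_fun Om f -> 0 <= c ->
  {ae mu, forall x, Om x -> `|f x| <= c} -> (mom r f <= (V * c `^ r)%:E)%E.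
Proof.
move=> r0 mf c0 fc; apply: (@le_trans _ _ (\int[mu]_(x in Om) (c `^ r)%:E)%E).
  apply: ae_ge0_le_integral => //.
  - exact: mom_measurable.
  - by move=> x _; rewrite lee_fin powR_ge0.
  by apply: (aeS fc) => x h Ox; rewrite lee_fin; apply: ge0_ler_powR => //; exact: h.
by rewrite integral_cst// EFinM muleC -(measureUE UL oU).
Qed.

Lemma momZ c r f : 0 <= c -> measurable_fun Om f ->
  (\int[mu]_(x in Om) (c%:E * (`|f x| `^ r)%:E) = c%:E * mom r f)%E.
Proof.
by move=> c0 mf; apply: ge0_integralZl_EFin => //; exact: mom_measurable.
Qed.

Lemma half_convex_powR r a b : 1 <= r -> 0 <= a -> 0 <= b ->
  (2^-1 * a + 2^-1 * b) `^ r <= 2^-1 * a `^ r + 2^-1 * b `^ r.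
Proof.
move=> r1 a0 b0.
have h01 : (0 <= (2^-1 : R) <= 1)%R by rewrite invr_ge0 ler0n invf_le1 ?ler1n.
suff : (2^-1 * a + (1 - 2^-1) * b) `^ r <= 2^-1 * a `^ r + (1 - 2^-1) * b `^ r.
  by rewrite (_ : 1 - 2^-1 = 2^-1)//; field.
have := @convex_powR R r r1 (Itv01 (proj1 (andP h01)) (proj2 (andP h01))) a b.
by rewrite !inE/= !in_itv/= !andbT => /(_ a0 b0).
Qed.

(** Convexity of the power makes moment bounds stable along hulls. *)
Lemma mom_mid r f g D : 1 <= r -> measurable_fun Om f -> measurable_fun Om g ->
  (mom r f <= D%:E)%E -> (mom r g <= D%:E)%E ->
  (mom r (fun x => 2^-1 * f x + 2^-1 * g x)%R <= D%:E)%E.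
Proof.
move=> r1 mf mg fD gD; have i2 : (0 : R) <= 2^-1 by rewrite invr_ge0.
have mm h : measurable_fun Om h -> measurable_fun Om (fun x => (2^-1)%:E * (`|h x| `^ r)%:E)%E.
  by move=> mh; apply: emeasurable_funM => //; exact: mom_measurable.
have m0 h x : (0 <= (2^-1)%:E * (`|h x| `^ r)%:E)%E by rewrite -EFinM lee_fin mulr_ge0 ?powR_ge0.
apply: (@le_trans _ _ (\int[mu]_(x in Om) ((2^-1)%:E * (`|f x| `^ r)%:E + (2^-1)%:E * (`|g x| `^ r)%:E))%E).
  apply: ge0_le_integral => //.
  - by apply: mom_measurable; apply: measurable_funD; exact: measurable_funM.
  - by apply: emeasurable_funD; exact: mm.
  move=> x _; rewrite -!EFinM -EFinD lee_fin; apply: le_trans (half_convex_powR r1 _ _) => //.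
  apply: ge0_ler_powR; rewrite ?nnegrE ?(le_trans ler01 r1)//.
  by apply: (le_trans (ler_normD _ _)); rewrite !normrM (ger0_norm i2).
rewrite ge0_integralD//; [|exact: mm|exact: mm].
rewrite !momZ//.
apply: (@le_trans _ _ ((2^-1)%:E * D%:E + (2^-1)%:E * D%:E)%E).
  by apply: leeD; apply: lee_wpmul2l; [exact: i2|exact: fD|exact: i2|exact: gD].
by rewrite -EFinM -EFinD lee_fin; lra.
Qed.

Lemma mom_diff r f g : 0 <= r -> measurable_fun Om f -> measurable_fun Om g ->
  (mom r (fun x => f x - g x)%R <= (2 `^ r)%:E * mom r f + (2 `^ r)%:E * mom r g)%E.
Proof.
move=> r0 mf mg.
have mm h : measurable_fun Om h -> measurable_fun Om (fun x => (2 `^ r)%:E * (`|h x| `^ r)%:E)%E.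
  by move=> mh; apply: emeasurable_funM => //; exact: mom_measurable.
have m0 h x : (0 <= (2 `^ r)%:E * (`|h x| `^ r)%:E)%E by rewrite -EFinM lee_fin mulr_ge0 ?powR_ge0.
apply: (@le_trans _ _ (\int[mu]_(x in Om) ((2 `^ r)%:E * (`|f x| `^ r)%:E + (2 `^ r)%:E * (`|g x| `^ r)%:E))%E).
  apply: ge0_le_integral => //.
  - by apply: mom_measurable; exact: measurable_funB.
  - by apply: emeasurable_funD; exact: mm.
  move=> x _; rewrite -!EFinM -EFinD lee_fin -!powRM//.
  apply: le_trans (powRD_le r0 (normr_ge0 _) (normr_ge0 _)).
  apply: ge0_ler_powR; rewrite ?nnegrE ?addr_ge0//; exact: ler_normB.
rewrite ge0_integralD//; [|exact: mm|exact: mm].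
by rewrite !momZ ?powR_ge0.
Qed.

(** Splits at |z| = a. Small L^1 norm and bounded moments of order 2 q thus make the moment of order
    q small. *)
Lemma mom_interpolation q a z : 1 < q -> 0 < a -> adm Om z ->
  (mom q z <= (a `^ (q - 1) * nrm1 z)%:E + (a `^ (- q))%:E * mom (2 * q) z)%E.
Proof.
move=> q1 a0 az; have mz : measurable_fun Om z by apply: measurable_funTS; exact: L1_measurable (adm_L1 az).
have m1 : measurable_fun Om (fun x => (a `^ (q - 1))%:E * `|z x|%:E)%E.
  by apply: emeasurable_funM => //; apply/measurable_EFinP; exact: measurableT_comp.
have m2 : measurable_fun Om (fun x => (a `^ (- q))%:E * (`|z x| `^ (2 * q))%:E)%E.
  by apply: emeasurable_funM => //; exact: mom_measurable.
rewrite EFinM (nrm1_UE az).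
rewrite -ge0_integralZl_EFin ?powR_ge0//; last first.
  by apply/measurable_EFinP; exact: measurableT_comp.
rewrite -momZ ?powR_ge0//.
rewrite -ge0_integralD//; last 2 first.
- by move=> x _; rewrite -EFinM lee_fin mulr_ge0 ?powR_ge0.
- by move=> x _; rewrite -EFinM lee_fin mulr_ge0 ?powR_ge0.
apply: ge0_le_integral => //.
- exact: mom_measurable.
- exact: emeasurable_funD.
move=> x _; rewrite -!EFinM -EFinD lee_fin; set w := `|z x|; have w0 : 0 <= w by exact: normr_ge0.
have q0 : 0 < q by exact: lt_trans q1.
have [wa|aw] := leP w a.
  apply: (@le_trans _ _ (a `^ (q - 1) * w)); last by rewrite lerDl mulr_ge0 ?powR_ge0.
  have -> : w `^ q = w `^ (q - 1) * w.
    rewrite -[X in _ * X](powRr1 w0) -powRD ?subrK//; apply/implyP => /eqP q00; lra.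
  rewrite ler_wpM2r// ge0_ler_powR// ?subr_ge0 ?(ltW q1)// nnegrE ltW//.
have wp : 0 < w by exact: lt_trans aw.
apply: (@le_trans _ _ (a `^ (- q) * w `^ (2 * q))); last by rewrite lerDr mulr_ge0 ?powR_ge0.
have -> : 2 * q = q + q by ring.
rewrite powRD ?(gt_eqF wp) ?implybT// mulrA ler_peMl ?powR_ge0// powRN mulrC ler_pdivlMr ?powR_gt0//.
by rewrite mul1r ge0_ler_powR ?(ltW q0)// ?nnegrE ltW.
Qed.

Lemma sobolev_norm_small q D e : 1 < q -> 0 < e -> exists2 r : R, 0 < r &
  forall z, adm Om z -> nrm1 z <= r -> (mom (2 * q) z <= D%:E)%E ->
  (sobolev_norm 2 q%:E Om (prim (prim z)) <= e%:E)%E.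
Proof.
move=> q1 e0; have q0 : 0 < q by exact: lt_trans q1.
pose c : R := e / 3; have c0 : 0 < c by rewrite divr_gt0.
have cq0 : 0 < c `^ q by exact: powR_gt0.
have V0 : 0 <= V by exact: V_ge0.
have V1 : 1 <= V + 1 by rewrite lerDr.
have V10 : 0 < V + 1 by exact: lt_le_trans ltr01 V1.
have D1 : 0 < `|D| + 1 by rewrite ltr_wpDl.
(* This a makes the term of order 2 q contribute at most c^q / 2; r is then chosen so that the L^1
   term contributes the other half. *)
pose a : R := (2 * (`|D| + 1) / c `^ q) `^ q^-1.
have a0 : 0 < a by rewrite powR_gt0// divr_gt0// mulr_gt0.
have aq : a `^ (- q) = c `^ q / (2 * (`|D| + 1)).
  by rewrite powRN -powRrM mulVf ?gt_eqF// powRr1 ?invf_div// ltW// divr_gt0// mulr_gt0.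
have aD : a `^ (- q) * D <= c `^ q / 2.
  apply: (@le_trans _ _ (a `^ (- q) * (`|D| + 1))).
    by rewrite ler_wpM2l ?powR_ge0// (le_trans (ler_norm D))// lerDl.
  by rewrite aq le_eqVlt; apply/orP; left; apply/eqP; field; rewrite gt_eqF.
have aq1 : 0 < a `^ (q - 1) by exact: powR_gt0.
have L1 : 0 < 2 * L + 1 by rewrite ltr_wpDl// mulr_ge0.
pose r : R := Num.min (c `^ q / 2 / a `^ (q - 1)) (c / ((2 * L + 1) * (V + 1))).
have r0 : 0 < r by rewrite lt_min; apply/andP; split; rewrite !divr_gt0// mulr_gt0.
exists r => // z az; rewrite le_min => /andP[zr1 zr2] zD.
have Jz := adm_der2_0 az; have [mz [_ _] z0 _] := az.
rewrite (sobolev_normE oU q0 (v := jet z)); last by move=> j; exact: (jet_weak L0 UL Jz oU z0).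
have jm j : measurable_fun Om (jet z j).
  by apply: measurable_funTS; exact: (L1_measurable (jet_L1 L0 UL Jz j)).
have small f : measurable_fun Om f -> (forall x, `|f x| <= (2 * L + 1) * nrm1 z) ->
    (Lnorm_on q%:E Om f <= c%:E)%E.
  move=> mf fz; apply: Lnorm_on_le => //; first exact: ltW.
  have n0 : 0 <= (2 * L + 1) * nrm1 z by rewrite mulr_ge0 ?(ltW L1)// nrm1_ge0.
  apply: (le_trans (mom_bounded (ltW q0) mf n0 _)); first by apply: aeW => x _.
  rewrite lee_fin; apply: (@le_trans _ _ ((V + 1) `^ q * ((2 * L + 1) * nrm1 z) `^ q)).
    rewrite ler_wpM2r ?powR_ge0//; apply: (@le_trans _ _ (V + 1)); first by rewrite lerDl.
    by rewrite -[leLHS](powRr1 (ltW V10)) ler_powR// ltW.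
  rewrite -powRM ?(ltW V10)//; apply: ge0_ler_powR; rewrite ?nnegrE ?(ltW q0) ?(ltW c0)//.
    by rewrite mulr_ge0// ltW.
  by move: zr2; rewrite ler_pdivlMr ?mulr_gt0// mulrC mulrA (mulrC (V + 1)).
have -> : e%:E = (c%:E + c%:E + c%:E)%E by rewrite -!EFinD; congr EFin; rewrite /c; field.
apply: leeD; first apply: leeD.
- apply: small; first exact: jm 0%N.
  move=> x; apply: (le_trans (le_prim2 x L0 UL Jz)).
  by rewrite ler_wpM2r ?nrm1_ge0// lerDl.
- apply: small; first exact: jm 1%N.
  move=> x; apply: (le_trans (le_prim x (der2_0_L1 Jz))).
  by rewrite ler_peMl ?nrm1_ge0// lerDr mulr_ge0.
- apply: Lnorm_on_le => //; first exact: ltW.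
  apply: (le_trans (mom_interpolation q1 a0 az)).
  apply: (@le_trans _ _ ((c `^ q / 2)%:E + (a `^ (- q))%:E * D%:E)%E).
    apply: leeD; first by rewrite lee_fin mulrC -ler_pdivlMr.
    by apply: lee_wpmul2l => //; rewrite lee_fin powR_ge0.
  by rewrite -EFinM -EFinD lee_fin; move: aD; clear; lra.
Qed.

End Moments.

Lemma mid_ge (R : realType) (o e p q r : R) : e <= o * (p - r) -> e <= o * (q - r) ->
  e <= o * (2^-1 * p + 2^-1 * q - r).
Proof. by rewrite !mulrDr => h1 h2; lra. Qed.

Lemma half_lt (R : realType) (e p q : R) : 0 < e -> e <= p -> p <= q -> q <= e / 2 -> False.
Proof. by move=> *; lra. Qed.

Section Weak_convergence.
Variables (R : realType) (Om : set R) (L : R).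
Hypotheses (L0 : 0 <= L) (UL : inball Om L) (oU : open Om).
Implicit Types (u v w z y f g h : R -> R) (x a b c e p q r B D : R).
Local Notation mu := (@lebesgue_measure R).
Local Notation V := (fine (mu Om)).

Let mU : measurable Om := open_measurable oU.

Lemma W2oo_sobolev q u : 0 < q -> W2oo Om u -> sobolev 2 q%:E Om u.
Proof.
move=> q0 Wu j j2; have [v wv /Lnorm_oo_bounded[C vC]] := Wu j j2; exists v => //.
have mv : measurable_fun Om v by have [_ []] := wv.
rewrite Lnorm_onE//; apply: poweR_lty; apply: le_lt_trans (ltry (V * `|C| `^ q)).
apply: (mom_bounded UL oU (ltW q0) mv (normr_ge0 _)).
by apply: (aeS vC) => x h Ox; apply: le_trans (h Ox) (ler_norm _).
Qed.

Lemma W2ooD u v : W2oo Om u -> W2oo Om v -> W2oo Om (fun x => u x + v x).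
Proof.
move=> Wu Wv j j2; have [u' wu /Lnorm_oo_bounded[C uC]] := Wu j j2.
have [v' wv /Lnorm_oo_bounded[D vD]] := Wv j j2.
exists (fun x => u' x + v' x).
  have := weak_lin 1 wu wv.
  by under eq_fun do rewrite mul1r; under [X in is_weak_derivative _ _ _ X]eq_fun do rewrite mul1r.
apply/Lnorm_oo_bounded; exists (C + D); apply: (aeS2 uC vD) => x hu hv Ox.
by apply: (le_trans (ler_normD _ _)); rewrite lerD ?hu ?hv.
Qed.

Variables (zs : nat -> R -> R) (k g : R -> R) (q : R).
Hypothesis zadm : forall j, adm Om (zs j).
Hypothesis kadm : adm Om k.
Hypothesis hk : hulls_to zs k.
Hypothesis q1 : 1 < q.
Hypothesis zmom : exists D : R, exists J, forall j, (J <= j)%N -> (mom Om (2 * q) (zs j) <= D%:E)%E.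
Hypothesis gW : W2oo Om g.

Let q0 : 0 < q. Proof. exact: lt_trans q1. Qed.
Let q21 : 1 <= 2 * q. Proof. by move: q1 => h; lra. Qed.
Let q20 : 0 <= 2 * q. Proof. exact: le_trans ler01 q21. Qed.

Section Functional.
Variable F : (R -> R) -> R.
Hypothesis Flin : forall a f h, sobolev 2 q%:E Om f -> sobolev 2 q%:E Om h ->
  F (fun x => a * f x + h x) = a * F f + F h.
Hypothesis Fbd : exists C : R, forall f, sobolev 2 q%:E Om f ->
  (`|F f|%:E <= C%:E * sobolev_norm 2 q%:E Om f)%E.

Let Phi z := F (prim (prim z)).

Let sob z : adm Om z -> sobolev 2 q%:E Om (prim (prim z)).
Proof. by move=> az; apply: W2oo_sobolev => //; have [] := adm_W2oo0 L0 UL oU az. Qed.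

Let Phi_lin c z y : adm Om z -> adm Om y -> Phi (fun x => c * z x + y x) = c * Phi z + Phi y.
Proof.
move=> az ay; rewrite /Phi (prim2_lin UL c (adm_der2_0 az) (adm_der2_0 ay)).
by apply: Flin; exact: sob.
Qed.

Let Phi_mid z y : adm Om z -> adm Om y ->
  Phi (fun x => 2^-1 * z x + 2^-1 * y x) = 2^-1 * Phi z + 2^-1 * Phi y.
Proof.
move=> az ay; have a0 := adm0 Om.
have P0 : Phi (fun=> 0) = 0.
  have := Phi_lin 1 a0 a0; under eq_fun do rewrite mulr0 addr0.
  by move=> /eqP; rewrite mul1r -subr_eq subrr eq_sym => /eqP.
have H : (fun x => 2^-1 * y x) = (fun x => 2^-1 * y x + 0) by apply/funext => x; rewrite addr0.
have Py : Phi (fun x => 2^-1 * y x) = 2^-1 * Phi y by rewrite H (Phi_lin 2^-1 ay a0) P0 addr0.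
have ay2 : adm Om (fun x => 2^-1 * y x) by rewrite H; exact: adm_lin.
by rewrite (Phi_lin _ az ay2) Py.
Qed.

Let PhiB z y : adm Om z -> adm Om y -> Phi (fun x => z x - y x) = Phi z - Phi y.
Proof.
move=> az ay; rewrite (_ : (fun x => z x - y x) = (fun x => -1 * y x + z x)).
  by rewrite Phi_lin// mulN1r addrC.
by apply/funext => x; rewrite mulN1r addrC.
Qed.

(* A subsequence along which F stays away from its value at k would, by affinity, have all
   its hulls do so; but these contain a sequence converging strongly to k. *)
Lemma functional_separation (o e : R) (ts : nat -> R -> R) : `|o| = 1 -> 0 < e -> cofinal zs ts ->
  ~ forall n, e <= o * (Phi (ts n) - Phi k).
Proof.
move=> o1 e0 ct Hts; have [g_ [hg gk _]] := hk ct.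
have ta n : adm Om (ts n) by have [j _ ->] := ct n.
have ga n : adm Om (g_ n) by exact: hull_adm ta (hg n).
have [D [J HD]] := zmom; have [C HC] := Fbd.
have madm z : adm Om z -> measurable_fun Om z.
  by move=> az; apply: measurable_funTS; exact: L1_measurable (adm_L1 az).
have gP n : (J <= n)%N -> e <= o * (Phi (g_ n) - Phi k) /\ (mom Om (2 * q) (g_ n) <= D%:E)%E.
  move=> Jn; elim: (hg n) => [m nm|u v hu [IHu Mu] hv [IHv Mv]].
    split; first exact: Hts.
    by have [j mj ->] := ct m; apply: HD; apply: leq_trans mj; exact: leq_trans nm.
  have au := hull_adm ta hu; have av := hull_adm ta hv.
  split; last by apply: mom_mid => //; exact: madm.
  by rewrite (Phi_mid au av); exact: mid_ge.
have [B kB] : exists B, (mom Om (2 * q) k <= B%:E)%E.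
  have [_ [B kB] _ _] := kadm; exists (V * `|B| `^ (2 * q)).
  apply: (mom_bounded UL oU q20 (madm _ kadm) (normr_ge0 _)).
  by apply: aeW => x _; apply: le_trans (kB x) (ler_norm _).
have C1 : 0 < `|C| + 1 by rewrite ltr_wpDl.
have eC : 0 < e / 2 / (`|C| + 1) by rewrite !divr_gt0.
have [r r0 Hr] := sobolev_norm_small L0 UL oU (2 `^ (2 * q) * D + 2 `^ (2 * q) * B) q1 eC.
have [N HN] := cvg0_le gk r0; pose n := maxn J N.
have [h1 h2] := gP n (leq_maxl _ _).
have ad : adm Om (fun x => g_ n x - k x) by exact: admB.
have := Hr _ ad (le_trans (ler_norm _) (HN n (leq_maxr _ _))).
have dm : (mom Om (2 * q) (fun x => g_ n x - k x)%R <= (2 `^ (2 * q) * D + 2 `^ (2 * q) * B)%:E)%E.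
  apply: (le_trans (mom_diff oU q20 (madm _ (ga n)) (madm _ kadm))).
  by rewrite EFinD !EFinM; apply: leeD; apply: lee_wpmul2l; rewrite ?lee_fin ?powR_ge0.
move=> /(_ dm) small.
have : `|Phi (g_ n) - Phi k| <= e / 2.
  rewrite -PhiB// -lee_fin; apply: (le_trans (HC _ (sob ad))).
  apply: (@le_trans _ _ ((`|C| + 1)%:E * (e / 2 / (`|C| + 1))%:E)%E).
    apply: (@le_trans _ _ ((`|C| + 1)%:E * sobolev_norm 2 q%:E Om (prim (prim (fun x => g_ n x - k x)%R)))%E).
      apply: lee_wpmul2r; last by rewrite lee_fin (le_trans (ler_norm C))// lerDl.
      by apply: sume_ge0 => i _; exact: Lnorm_ge0.
    by apply: lee_wpmul2l => //; rewrite lee_fin ltW.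
  by rewrite -EFinM mulrC divfK ?gt_eqF.
have : o * (Phi (g_ n) - Phi k) <= `|Phi (g_ n) - Phi k|.
  by apply: (le_trans (ler_norm _)); rewrite normrM o1 mul1r.
by move=> h3 h4; exact: half_lt e0 h1 h3 h4.
Qed.

(** The signs o = 1 and o = -1 test convergence from above and from below; failure of either
    produces a cofinal sequence that stays away from the limit value. *)
Lemma functional_cvg : Phi (zs j) @[j --> \oo] --> Phi k.
Proof.
have sep o e : `|o| = 1 -> 0 < e -> exists N, forall j, (N <= j)%N -> o * (Phi (zs j) - Phi k) < e.
  move=> o1 e0; apply: contrapT => H.
  have /choice[c Hc] : forall n, exists j, (n <= j)%N /\ e <= o * (Phi (zs j) - Phi k).
    move=> n; apply: contrapT => Hn; apply: H; exists n => j nj.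
    by rewrite ltNge; apply/negP => h; apply: Hn; exists j.
  apply: (functional_separation (ts := fun n => zs (c n)) o1 e0).
    by move=> n; exists (c n) => //; have [] := Hc n.
  by move=> n; have [] := Hc n.
apply/cvgrPdist_lt => e e0.
have [N1 HN1] := sep 1 e (normr1 _) e0.
have [N2 HN2] := sep (-1) e (normrN1 _) e0.
exists (maxn N1 N2) => // j /=; rewrite geq_max => /andP[j1 j2].
move: (HN1 j j1) (HN2 j j2); move: (Phi (zs j)) (Phi k) => p r.
rewrite mul1r mulN1r ltr_norml opprB => h1 h2.
by rewrite h2 andbT ltrNl opprB.
Qed.

End Functional.

Lemma sobolev_weak_cvg_hulls : sobolev_weak_cvg 2 q%:E Om
  (fun j x => g x + prim (prim (zs j)) x) (fun x => g x + prim (prim k) x).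
Proof.
have sob z : adm Om z -> sobolev 2 q%:E Om (fun x => g x + prim (prim z) x).
  by move=> az; apply: W2oo_sobolev => //; apply: W2ooD => //; have [] := adm_W2oo0 L0 UL oU az.
have sob0 z : adm Om z -> sobolev 2 q%:E Om (prim (prim z)).
  by move=> az; apply: W2oo_sobolev => //; have [] := adm_W2oo0 L0 UL oU az.
split; [by move=> n; exact: sob|exact: sob|move=> F Flin Fbd].
have FU z : adm Om z -> F (fun x => g x + prim (prim z) x) = F g + F (prim (prim z)).
  move=> az; have := Flin 1 g _ (W2oo_sobolev q0 gW) (sob0 z az).
  by under eq_fun do rewrite mul1r; rewrite mul1r.
rewrite (FU k kadm) (_ : (fun n => F _) = (fun n => F g + F (prim (prim (zs n))))); last first.
  by apply/funext => n; rewrite FU.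
by apply: cvgD; [exact: cvg_cst|exact: functional_cvg Flin Fbd].
Qed.

End Weak_convergence.

(** * From the abstract integrand to the supremal functional *)

Section Preliminaries.
Variable R : realType.
Implicit Types (f u v : R -> R) (x a b c e p r : R) (U : set R).
Local Notation mu := (@lebesgue_measure R).

(** b is the infimum of the points to the right of x outside U; it is not in U because U is open. *)
Lemma right_end U L x : open U -> inball U L -> U x ->
  exists b, [/\ x < b, ~ U b & forall y, x <= y < b -> U y].
Proof.
move=> oU UL Ux; pose S := [set y | x <= y /\ ~ U y].
have S0 : S !=set0.
  exists (`|L| + `|x| + 1); split.
    by have := ler_norm x; have := normr_ge0 L; lra.
  move=> /UL; rewrite ger0_norm ?addr_ge0// => h.
  by have := ler_norm L; have := normr_ge0 x; lra.
have lbS : has_lbound S by exists x => y [].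
have hS : has_inf S by [].
have xb : x <= inf S by apply: lb_le_inf => // y [].
have nUb : ~ U (inf S).
  move=> Ub; have /nbhs_ballP[e /= e0 He] : nbhs (inf S) U by exact: open_nbhs_nbhs.
  have [y Sy yb] := inf_adherent e0 hS; have [xy nUy] := Sy; apply: nUy; apply: He.
  have by_ := ge_inf lbS Sy.
  by rewrite ball_itv/= in_itv/= yb andbT; apply: lt_le_trans by_; rewrite gtrBl.
exists (inf S); split => //.
  by rewrite lt_neqAle xb andbT; apply/eqP => xS; apply: nUb; rewrite -xS.
move=> y /andP[xy yb]; apply: contrapT => nUy.
by have := ge_inf lbS (conj xy nUy : S y); rewrite leNgt yb.
Qed.

(** The left end is obtained as the right end of the reflected set. *)
Lemma component U L x : open U -> inball U L -> U x -> exists a b,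
  [/\ a < x < b, ~ U a, ~ U b & forall y, a < y < b -> U y].
Proof.
move=> oU UL Ux; have [b [xb nUb Ub]] := right_end oU UL Ux.
pose V : set R := [set y | U (- y)].
have oV : open V.
  by apply: (@open_comp _ _ (fun y : R => - y)) => // y _; exact: continuousN.
have VL : inball V L by move=> y /UL; rewrite normrN.
have Vx : V (- x) by rewrite /V/= opprK.
have [a [xa nVa Va]] := right_end oV VL Vx.
exists (- a), b; split => //; first by rewrite ltrNl xa.
move=> y /andP[ay yb]; have [xy|yx] := leP x y; first by apply: Ub; rewrite xy.
by rewrite -[y]opprK; apply: Va; rewrite lerN2 (ltW yx) ltrNl.
Qed.

Lemma itvcc_closure U a b : a < b -> (forall y, a < y < b -> U y) -> `[a, b] `<=` closure U.
Proof.
move=> ab Uab x /=; rewrite in_itv/= => /andP[ax xb] B /nbhs_ballP[e /= e0 He].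
have [xb'|bx] := ltP x b.
  pose r : R := Num.min (e / 2) ((b - x) / 2).
  have r0 : 0 < r by rewrite lt_min !divr_gt0// subr_gt0.
  have re : r < e by rewrite gt_min; apply/orP; left; lra.
  have rb : r < b - x by rewrite gt_min; apply/orP; right; lra.
  exists (x + r); split; first by apply: Uab; apply/andP; split; lra.
  by apply: He; rewrite ball_itv/= in_itv/=; apply/andP; split; lra.
pose r : R := Num.min (e / 2) ((b - a) / 2).
have r0 : 0 < r by rewrite lt_min !divr_gt0// subr_gt0.
have re : r < e by rewrite gt_min; apply/orP; left; lra.
have rb : r < b - a by rewrite gt_min; apply/orP; right; lra.
exists (x - r); split; first by apply: Uab; apply/andP; split; lra.
by apply: He; rewrite ball_itv/= in_itv/=; apply/andP; split; lra.
Qed.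

(** Follows from superadditivity of the p-th power, that is from (w / (a + b))^p <= w / (a + b). It
    separates the error from the energy under the p-th root. *)
Lemma powR_subadditive (x y : R) p : 1 <= p -> 0 <= x -> 0 <= y ->
  (x + y) `^ p^-1 <= x `^ p^-1 + y `^ p^-1.
Proof.
move=> p1 x0 y0; have p0 : 0 < p by exact: lt_le_trans p1.
pose a := x `^ p^-1; pose b := y `^ p^-1.
have a0 : 0 <= a by exact: powR_ge0.
have b0 : 0 <= b by exact: powR_ge0.
have xE : x = a `^ p by rewrite -powRrM mulVf ?gt_eqF// powRr1.
have yE : y = b `^ p by rewrite -powRrM mulVf ?gt_eqF// powRr1.
have super : x + y <= (a + b) `^ p.
  have [ab0|ab0] := eqVneq (a + b) 0.
    have az : a = 0 by apply/eqP; rewrite eq_le a0 andbT -ab0 lerDl.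
    have bz : b = 0 by apply/eqP; rewrite eq_le b0 andbT -ab0 lerDr.
    by rewrite xE yE az bz !powR0 ?gt_eqF// addr0.
  have s0 : 0 < a + b by rewrite lt_neqAle eq_sym ab0 addr_ge0.
  have H w : 0 <= w -> w <= a + b -> w `^ p <= (w / (a + b)) * (a + b) `^ p.
    move=> w0 ws; have q0 : 0 <= w / (a + b) by rewrite divr_ge0// ltW.
    have q1 : w / (a + b) <= 1 by rewrite ler_pdivrMr// mul1r.
    have {1}-> : w = (w / (a + b)) * (a + b) by rewrite divfK ?gt_eqF.
    rewrite powRM ?(ltW s0)// ler_wpM2r ?powR_ge0//.
    have [->|q00] := eqVneq (w / (a + b)) 0; first by rewrite powR0// gt_eqF.
    have qp : 0 < w / (a + b) by rewrite lt_neqAle eq_sym q00.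
    by rewrite -[leRHS](powRr1 q0) ger_powR// q1 qp.
  rewrite xE yE; apply: (le_trans (lerD (H a a0 _) (H b b0 _))); rewrite ?lerDl ?lerDr//.
  by rewrite -mulrDl -mulrDl divff ?mul1r// gt_eqF.
rewrite -/a -/b -[leRHS]powRr1 ?addr_ge0// -(divff (lt0r_neq0 p0)) powRrM.
by apply: ge0_ler_powR; rewrite ?nnegrE ?invr_ge0 ?powR_ge0 ?addr_ge0 ?(ltW p0).
Qed.

Lemma weak_eq_ae j U u u' v : is_weak_derivative j U u v -> measurable_fun U u' ->
  {ae mu, forall x, U x -> u x = u' x} -> is_weak_derivative j U u' v.
Proof.
move=> [lu lv H] mu' uu'; have [mu_ oU Ku] := lu; have mU := open_measurable oU.
split => //.
  split => // K KU cK; have mK : measurable K by exact: compact_measurable.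
  suff <- : (\int[mu]_(x in K) `|u x|%:E = \int[mu]_(x in K) `|u' x|%:E)%E by exact: Ku.
  apply: ge0_ae_eq_integral => //.
  - by apply/measurable_EFinP; apply: measurableT_comp => //; exact: measurable_funS mu_.
  - by apply/measurable_EFinP; apply: measurableT_comp => //; exact: measurable_funS mu'.
  - by apply: (aeS uu') => x h Kx; rewrite h//; exact: KU.
move=> phi tphi; rewrite -H//.
have mt : measurable_fun U (derive1n j phi).
  by apply: measurable_funTS; exact: test_measurable (test_derive1n j tphi).
apply: ae_eq_Rintegral => //; [exact: measurable_funM|exact: measurable_funM|].
by apply: (aeS uu') => x h Ux; rewrite h.
Qed.

(** Real levels suffice: +oo on the right is trivial, and -oo is treated through the levels -n,
    since no real value lies below all of them. *)
Lemma E_oo_le Om (H : R -> R -> R -> R -> R) u v O :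
  (forall T : R, {ae mu, forall x, O x -> Hjet Om H v x <= T} ->
    {ae mu, forall x, O x -> Hjet Om H u x <= T}) ->
  (E_oo Om H u O <= E_oo Om H v O)%E.
Proof.
move=> HT; have := ess_sup_ge mu (patch (fun=> -oo%E) O (fun x => (Hjet Om H v x)%:E)).
rewrite -/(E_oo Om H v O); case: (E_oo Om H v O) => [T| |] hv; [| by rewrite leey|].
  have hu : {ae mu, forall x, O x -> Hjet Om H u x <= T}.
    by apply: HT; apply: (aeS hv) => x + Ox; rewrite /patch mem_set// lee_fin.
  apply/ess_supP; apply: (aeS hu) => x h; rewrite /patch; case: ifPn => [|_]; last exact: leNye.
  by rewrite inE lee_fin.
have hu n : {ae mu, forall x, O x -> Hjet Om H u x <= - n%:R}.
  by apply: HT; apply: (aeS hv) => x + Ox; rewrite /patch mem_set.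
apply/ess_supP; apply: (aeS (ae_foralln hu)) => x h; rewrite /patch; case: ifPn => //.
rewrite inE => Ox; exfalso.
have := h (Num.truncn `|Hjet Om H u x|).+1 Ox; have := truncnS_gt `|Hjet Om H u x|.
rewrite lerNr => lt_p /le_trans/(_ (ler_norm _)); rewrite normrN => /(lt_le_trans lt_p).
by rewrite ltxx.
Qed.

End Preliminaries.

Lemma le_norm3 (R : realDomainType) (a b c : R) : [/\ a <= `|a| + `|b| + `|c|,
  b <= `|a| + `|b| + `|c| & c <= `|a| + `|b| + `|c|].
Proof.
have := ler_norm a; have := ler_norm b; have := ler_norm c.
by have := normr_ge0 a; have := normr_ge0 b; have := normr_ge0 c; split; lra.
Qed.

(** Absorbs the boundary datum into constants: X, a and b belong to the full function, c, a' and b'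
    to its deviation from g. *)
Lemma coercive_arith (R : realFieldType) (C1 C2 G M X a a' b b' c h : R) : 0 < C1 -> 0 <= C2 ->
  0 <= M -> 0 <= M + h -> C1 * X - C2 * (1 + a + b) <= h -> a <= a' -> b <= b' -> 0 <= a' -> 0 <= b' ->
  c <= G + X ->
  c <= G + C1^-1 * C2 + C1^-1 * (1 + C2) * (M + h) + C1^-1 * (1 + C2) * (a' + b').
Proof.
move=> C10 C20 M0 h0 hX aa bb a0 b0 /le_trans; apply.
have hX' : X <= C1^-1 * (M + h + C2 + C2 * (a' + b')).
  rewrite ler_pdivlMl//.
  have := ler_wpM2l C20 (lerD aa bb); rewrite !mulrDr; move: hX; rewrite !mulrDr.
  by move: (C1 * X) (C2 * a) (C2 * b) (C2 * a') (C2 * b'); clear -M0 => *; lra.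
have i0 : 0 <= C1^-1 by rewrite invr_ge0 ltW.
have r0 : 0 <= C1^-1 * (C2 * (M + h) + (a' + b')).
  by apply: mulr_ge0 => //; apply: addr_ge0; [exact: mulr_ge0|exact: addr_ge0].
rewrite -!addrA lerD2l; apply: (le_trans hX'); rewrite -subr_ge0.
by move: r0; congr (0 <= _); ring.
Qed.

(** * The integrand built from H and the boundary datum *)

Section Instance.
Variables (R : realType) (Om : set R) (L : R) (H : R -> R -> R -> R -> R).
Hypotheses (L0 : 0 <= L) (UL : inball Om L) (oU : open Om).
Hypothesis Hc : {within [set z : R * R * R * R | Om z.1.1.1],
     continuous (fun z : R * R * R * R => H z.1.1.1 z.1.1.2 z.1.2 z.2)}.
Variables (m M : R).
Hypothesis mM : m < M.
Hypothesis Hm : forall x eta p X, Om x -> - m <= H x eta p X.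
Hypothesis Hconv : forall x eta p t, Om x -> convex_set [set X : R^o | H x eta p X <= t].
Variables (C1 C2 s t : R).
Hypotheses (M0 : 0 <= M) (C10 : 0 < C1) (C20 : 0 < C2) (s01 : 0 <= s < 1) (t01 : 0 <= t < 1).
Local Notation mu := (@lebesgue_measure R).
Hypothesis Hcoer : {ae mu, forall x : R, Om x -> forall eta p X,
     C1 * `|X| - C2 * (1 + `|eta| `^ s + `|p| `^ t) <= H x eta p X}.
Variable g : R -> R.
Hypothesis gW : W2oo Om g.
Implicit Types (u v z y : R -> R) (x a b c e p : R) (O : set R).

Let mU : measurable Om := open_measurable oU.

Definition lag x a b c := M + H x (g x + a) (wderiv 1 Om g x + b) (wderiv 2 Om g x + c).

Let gder j : (j <= 2)%N -> is_weak_derivative j Om g (wderiv j Om g).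
Proof. by move=> j2; have [v wv _] := gW j2; exact: wderivP wv. Qed.

Let mg : measurable_fun Om g.
Proof. by have [[]] := gder (leq0n 2). Qed.

Let mgj j : (j <= 2)%N -> measurable_fun Om (wderiv j Om g).
Proof. by move=> j2; have [_ []] := gder j2. Qed.

Lemma boundary_bounded : exists2 G : R, 0 <= G & {ae mu, forall x, Om x ->
  [/\ `|g x| <= G, `|wderiv 1 Om g x| <= G & `|wderiv 2 Om g x| <= G]}.
Proof.
have bd j : (j <= 2)%N -> exists C, {ae mu, forall x, Om x -> `|wderiv j Om g x| <= C}.
  move=> j2; have [v wv /Lnorm_oo_bounded[C vC]] := gW j2; exists C.
  by apply: (aeS2 vC (wderiv_ae wv)) => x h e Ox; rewrite e//; exact: h.
have [G0 h0] := bd 0%N isT; have [G1 h1] := bd 1%N isT; have [G2 h2] := bd 2%N isT.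
have h0' : {ae mu, forall x, Om x -> `|g x| <= G0}.
  have g00 : is_weak_derivative 0 Om g g by apply: weak_id; have [] := gder (leq0n 2).
  by apply: (aeS2 h0 (wderiv_ae g00)) => x h e Ox; rewrite -e//; exact: h.
have [l0 l1 l2] := le_norm3 G0 G1 G2.
exists (`|G0| + `|G1| + `|G2|); first by rewrite !addr_ge0.
apply: (aeS3 h0' h1 h2) => x k0 k1 k2 Ox.
by split; [exact: le_trans (k0 Ox) l0|exact: le_trans (k1 Ox) l1|exact: le_trans (k2 Ox) l2].
Qed.

(** The positive lower bound is M - m. Compactness is applied to the single point x for [int_cont],
    and for [int_unif] to an interval, where g and its derivatives are bounded by G only almost
    everywhere. *)
Lemma lag_integrand : exists d A G C, integrand Om lag d A G C s t.
Proof.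
have [G G0 gG] := boundary_bounded.
exists (M - m), (G + C1^-1 * C2), G, (C1^-1 * (1 + C2)).
have D0 : 0 <= C1^-1 by rewrite invr_ge0 ltW.
split => //.
- move=> a b c ma mb mc; apply: measurable_funD => //.
  by apply: (integrand_measurable oU Hc); apply: measurable_funD => //; exact: mgj.
- by rewrite subr_gt0.
- by move=> x a b c Ox; rewrite lerD2l; exact: Hm.
- move=> x a b c c' e Ox h1 h2.
  have i01 : (0 <= (2^-1 : R) <= 1)%R by rewrite invr_ge0 ler0n invf_le1 ?ler1n.
  have := @Hconv x (g x + a) (wderiv 1 Om g x + b) (e - M) Ox.
  move=> /(_ (wderiv 2 Om g x + c) (wderiv 2 Om g x + c')
    (Itv01 (proj1 (andP i01)) (proj2 (andP i01)))).
  rewrite !inE/= !lerBrDl => /(_ h1 h2); rewrite /lag.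
  by rewrite (_ : wderiv 2 Om g x + (2^-1 * c + 2^-1 * c') =
    2^-1 * (wderiv 2 Om g x + c) + (1 - 2^-1) * (wderiv 2 Om g x + c'))//; field.
- move=> x a b B e Ox e0.
  have K1 : [set x] `<=` Om by move=> _ ->.
  pose B' : R := `|g x + a| + `|wderiv 1 Om g x + b| + (`|wderiv 2 Om g x| + `|B|).
  have [r r0 Hr] := integrand_unif oU Hc B' (@compact_set1 _ x) K1 e0.
  exists r => // a' b' c c' ha hb hc hc'.
  rewrite /lag opprD addrACA subrr add0r; apply: Hr => //.
  + by rewrite /B' -addrA lerDl !addr_ge0.
  + by rewrite /B' addrAC lerDr !addr_ge0.
  + apply: (le_trans (ler_normD _ _)); rewrite /B'.
    by rewrite -[X in X <= _]add0r; apply: lerD; [exact: addr_ge0|rewrite lerD2l (le_trans hc)// ler_norm].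
  + by rewrite opprD addrACA subrr add0r.
  + by rewrite opprD addrACA subrr add0r.
  + by rewrite opprD addrACA subrr add0r.
- move=> u v B e uv e0.
  have [r r0 Hr] := integrand_unif oU Hc (B + G) (@segment_compact R u v) uv e0.
  exists r => //; apply: (aeS gG) => x + xuv a b c a' b' c' Ba Bb Bc ha hb hc.
  have Ix : `[u, v]%classic x by rewrite /= in_itv.
  move=> /(_ (uv _ Ix)) [g0 g1 g2].
  rewrite /lag opprD addrACA subrr add0r.
  by apply: Hr => //; first [by apply: (le_trans (ler_normD _ _)); rewrite addrC lerD |
    by rewrite opprD addrACA subrr add0r].
- by rewrite addr_ge0// mulr_ge0// ltW.
- by rewrite mulr_ge0// addr_ge0// ltW.
- apply: (aeS2 gG Hcoer) => x g3 hx Ox a b c; have [g0 g1 g2] := g3 Ox.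
  have [/andP[s0 _] /andP[t0 _]] := (s01, t01).
  have := hx Ox (g x + a) (wderiv 1 Om g x + b) (wderiv 2 Om g x + c).
  set h := H _ _ _ _; set X := wderiv 2 Om g x + c.
  have F0 : 0 <= M + h.
    by rewrite -(subrr M) lerD2l; apply: le_trans (Hm _ _ _ Ox); rewrite lerN2 ltW.
  have pa : `|g x + a| `^ s <= (G + `|a|) `^ s.
    by apply: ge0_ler_powR; rewrite ?nnegrE ?addr_ge0// (le_trans (ler_normD _ _))// lerD2r.
  have pb : `|wderiv 1 Om g x + b| `^ t <= (G + `|b|) `^ t.
    by apply: ge0_ler_powR; rewrite ?nnegrE ?addr_ge0// (le_trans (ler_normD _ _))// lerD2r.
  have cX : `|c| <= G + `|X|.
    rewrite (_ : c = X - wderiv 2 Om g x); last by rewrite /X addrAC subrr add0r.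
    by apply: (le_trans (ler_normB _ _)); rewrite addrC lerD2r.
  by move=> hX; exact: (coercive_arith C10 (ltW C20) M0 F0 hX pa pb (powR_ge0 _ _) (powR_ge0 _ _) cX).
Qed.

(** Up to null sets the weak derivatives of v are those of g plus the jet of z. *)
Lemma Hjet_lag v z : adm Om z -> measurable_fun Om v ->
  {ae mu, forall x, Om x -> v x = g x + prim (prim z) x} ->
  measurable_fun Om (Hjet Om H v) /\ {ae mu, forall x, Om x -> M + Hjet Om H v x = hf lag z x}.
Proof.
move=> az mv vz; have Jz := adm_der2_0 az; have [_ _ z0 _] := az.
have wd j : (j <= 2)%N -> is_weak_derivative j Om v (fun x => 1 * wderiv j Om g x + jet z j x).
  move=> j2; have w := weak_lin 1 (gder j2) (jet_weak L0 UL Jz oU z0 j2).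
  by apply: (weak_eq_ae w mv); apply: (aeS vz) => x e Ox; rewrite mul1r e.
have mw j : (j <= 2)%N -> measurable_fun Om (wderiv j Om v).
  by move=> j2; have [_ []] := wderivP (wd j j2).
split; first by apply: (integrand_measurable oU Hc) => //; exact: mw.
apply: (aeS3 vz (wderiv_ae (wd 1%N isT)) (wderiv_ae (wd 2%N isT))) => x e0 e1 e2 Ox.
by rewrite /Hjet /hf /lag e0// e1// e2// !mul1r.
Qed.

Lemma E_pE p v z : adm Om z -> measurable_fun Om v ->
  {ae mu, forall x, Om x -> v x = g x + prim (prim z) x} ->
  E_p Om H M p v Om = (((fine (mu Om))^-1%:E * Ip lag p Om z) `^ p^-1 - M%:E)%E.
Proof.
move=> az mv vz; have [mH vH] := Hjet_lag az mv vz.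
have [d [A [G [C I]]]] := lag_integrand.
suff -> : Ip lag p Om z = (\int[mu]_(x in Om) ((M + Hjet Om H v x) `^ p)%:E)%E by [].
apply: ge0_ae_eq_integral => //.
- exact: (hfp_measurable L0 UL oU I p mU (@subset_refl _ Om) (adm_der2_0 az)).
- apply/measurable_EFinP; apply: (measurableT_comp (measurable_powR p)).
  exact: measurable_funD.
- by move=> x _; rewrite lee_fin powR_ge0.
- by move=> x _; rewrite lee_fin powR_ge0.
- by apply: (aeS vH) => x h Ox; rewrite h.
Qed.

Lemma W2oo_bd_prim2 z : adm Om z -> W2oo_bd Om g (fun x => g x + prim (prim z) x).
Proof.
move=> az; rewrite /W2oo_bd (_ : _ \- g = prim (prim z)); first exact: adm_W2oo0 L0 UL oU z az.
by apply/funext => x /=; rewrite addrAC subrr add0r.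
Qed.

Lemma W2oo_bd_adm v : W2oo_bd Om g v -> measurable_fun Om v /\ exists2 z, adm Om z &
  {ae mu, forall x, Om x -> v x = g x + prim (prim z) x}.
Proof.
move=> vg; have [z az vz] := W2oo0_adm L0 UL oU vg; split; last first.
  by exists z => //; apply: (aeS vz) => x h Ox; rewrite -h//= addrC subrK.
have [w [[mw _ _] _ _] _] := vg.1 0%N isT.
have -> : v = (v \- g) \+ g by apply/funext => x /=; rewrite subrK.
exact: measurable_funD.
Qed.

(** The limit lemmas need c > 0; for c <= 0 the bound on y contradicts the positivity of the
    integrand at almost every point of O. *)
Lemma hf_le_pos z y c O : O `<=` Om ->
  (0 < c -> {ae mu, forall x, O x -> hf lag y x <= c} -> {ae mu, forall x, O x -> hf lag z x <= c}) ->
  {ae mu, forall x, O x -> hf lag y x <= c} -> {ae mu, forall x, O x -> hf lag z x <= c}.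
Proof.
move=> OU h yc; have [c0|c0] := ltP 0 c; first exact: h.
have [d [A [G [C I]]]] := lag_integrand.
apply: (aeS yc) => x yx Ox; have := hf_gt0 I y (OU _ Ox).
by rewrite ltNge (le_trans (yx Ox) c0).
Qed.
Hypothesis V0 : 0 < fine (mu Om).
Hypothesis proper : exists2 v, W2oo_bd Om g v & (E_oo Om H v Om < +oo)%E.

Lemma proper_bounded : exists2 K, 1 <= K & exists2 y, adm Om y &
  {ae mu, forall x, Om x -> hf lag y x <= K}.
Proof.
have [v vg voo] := proper; have [mv [z az vz]] := W2oo_bd_adm vg.
have [_ vH] := Hjet_lag az mv vz.
have [T vT] : exists T : R, (E_oo Om H v Om <= T%:E)%E.
  by move: voo; case: (E_oo Om H v Om) => [T| |] // _; [exists T|exists 0; exact: leNye].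
(* The maximum with 1 keeps the powers of K above 1, as [Ip_family] requires. *)
exists (Num.max 1 (M + T)); first by rewrite le_max lexx.
exists z => //; move/ess_supP : vT => vT; apply: (aeS2 vT vH) => x + h Ox.
by rewrite /patch mem_set// lee_fin -h// le_max lerD2l => ->; rewrite orbT.
Qed.

(** After division by the measure of [Om], subadditivity of the p-th root turns the error into
    2^(-p). Competitors of infinite energy are harmless. *)
Lemma E_p_almost_minimiser p z : 1 < p -> adm Om z ->
  (forall y, adm Om y -> (Ip lag p Om z <= Ip lag p Om y + (fine (mu Om) * 2 `^ (- (p * p)))%:E)%E) ->
  (exists2 K, 1 <= K & exists2 y, adm Om y & {ae mu, forall x, Om x -> hf lag y x <= K}) ->
  approximate_minimiser Om H M g p (fun x => g x + prim (prim z) x).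
Proof.
move=> p1 az zmin [K K1 [y0 ay0 y0K]]; have [d [A [G [C I]]]] := lag_integrand.
have p0 : 0 < p by exact: lt_trans p1.
have zbd := W2oo_bd_prim2 az; split => //.
have [mz _] := W2oo_bd_adm zbd.
rewrite (E_pE p az mz); last exact: aeW.
set W := fine (mu Om); have W0 : 0 < W by exact: V0.
have Izfin : Ip lag p Om z \is a fin_num.
  rewrite ge0_fin_numE ?Ip_ge0//; apply: (le_lt_trans (zmin _ ay0)).
  rewrite lte_add_pinfty ?ltry//.
  apply: le_lt_trans (ltry (W * K `^ p)).
  exact: (Ip_le L0 UL oU I mU (@subset_refl _ Om) (adm_der2_0 ay0) (ltW p0) (le_trans ler01 K1) y0K).
set Z := Ip lag p Om z in zmin Izfin *.
have EZ : ((W^-1%:E * Z) `^ p^-1 - M%:E = ((W^-1 * fine Z) `^ p^-1 - M)%:E)%E.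
  by rewrite -(fineK Izfin) -EFinM poweR_EFin EFinB.
rewrite EZ addeC -leeBlDr//; apply: le_ereal_inf_tmp => _ [v vg <-].
have [mv [y ay vy]] := W2oo_bd_adm vg.
rewrite (E_pE p ay mv vy) -/W -EFinB.
have Iy0 := Ip_ge0 lag p Om y; have := zmin y ay.
case: (Ip lag p Om y) Iy0 => [r| |] //.
  rewrite lee_fin => r0; rewrite -(fineK Izfin) -EFinD lee_fin => h.
  rewrite -EFinM poweR_EFin -EFinB lee_fin.
  rewrite lerBlDr addrAC lerD2r.
  have -> : 2 `^ (- p) = (2 `^ (- (p * p))) `^ p^-1.
    by rewrite -powRrM mulNr mulfK ?gt_eqF.
  apply: le_trans (powR_subadditive (ltW p1) _ (powR_ge0 _ _)); last first.
    by rewrite mulr_ge0// invr_ge0 ltW.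
  have Z0 : 0 <= fine Z by rewrite fine_ge0// Ip_ge0.
  have i0 : 0 <= W^-1 by rewrite invr_ge0 ltW.
  apply: ge0_ler_powR; rewrite ?nnegrE ?invr_ge0 ?(ltW p0) ?addr_ge0 ?powR_ge0 ?mulr_ge0//.
  by rewrite ler_pdivrMl// mulrDr mulrA divff ?gt_eqF// mul1r.
move=> _ _; rewrite gt0_muley ?lte_fin ?invr_gt0//.
by rewrite poweRyr ?invr_neq0 ?gt_eqF// leey.
Qed.

Lemma main_nonempty : exists u_oo : R -> R,
  [/\ global_minimiser Om H g u_oo,
      (exists u_ : R -> R -> R,
         (forall p, 1 < p -> approximate_minimiser Om H M g p (u_ p)) /\
         forall q, 1 < q ->
           exists p_ : nat -> R,
           [/\ forall j, 1 < p_ j,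
               p_ j @[j --> \oo] --> +oo &
               sobolev_weak_cvg 2 q%:E Om (fun j => u_ (p_ j)) u_oo]) &
      absolute_minimiser Om H u_oo].
Proof.
have [d [A [G [C I]]]] := lag_integrand.
have [K K1 zK] := proper_bounded.
have [z_ Hz] : exists z_ : R -> R -> R, forall p, 1 < p -> adm Om (z_ p) /\ forall y, adm Om y ->
    (Ip lag p Om (z_ p) <= Ip lag p Om y + (fine (mu Om) * 2 `^ (- (p * p)))%:E)%E.
  have /choice[f Hf] : forall p, exists z, 1 < p -> adm Om z /\ forall y, adm Om y ->
    (Ip lag p Om z <= Ip lag p Om y + (fine (mu Om) * 2 `^ (- (p * p)))%:E)%E.
    move=> p; have [p1|p1] := ltP 1 p; last by exists (fun=> 0).
    have e0 : 0 < fine (mu Om) * 2 `^ (- (p * p)) by rewrite mulr_gt0// powR_gt0.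
    have [|z az zmin] := almost_minimiser L0 UL oU I (ltW (lt_trans ltr01 p1)) e0.
      by have [y ay yK] := zK; exists y => //; exists K.
    by exists z.
  by exists f.
have zadm p : 1 < p -> adm Om (z_ p) by move=> /Hz[].
have zmin p : 1 < p -> forall y, adm Om y ->
    (Ip lag p Om (z_ p) <= Ip lag p Om y + (fine (mu Om) * 2 `^ (- (p * p)))%:E)%E.
  by move=> /Hz[].
have [p_ [k [p1 poo kadm jk hk]]] := minimising_limit L0 UL oU I K1 zK zadm zmin.
have kbd := W2oo_bd_prim2 kadm; have [mk _] := W2oo_bd_adm kbd.
have [_ kH] := Hjet_lag kadm mk (aeW (fun x _ => erefl)).
have zsadm j : adm Om (z_ (p_ j)) by exact: zadm.
have IpK j := Ip_family L0 UL oU I K1 zK zmin (p1 j).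
have zsmin j y (ay : adm Om y) := zmin _ (p1 j) y ay.
(* Common to both minimality statements: a comparison of [hf lag] at level M + T becomes one of
   [Hjet] at level T, for a variation w with second derivative z. *)
have cmp w z O T : adm Om z -> measurable_fun Om w ->
    {ae mu, forall x, Om x -> w x = prim (prim z) x} -> O `<=` Om ->
    ({ae mu, forall x, O x -> hf lag (fun x => k x + z x) x <= M + T} ->
     {ae mu, forall x, O x -> hf lag k x <= M + T}) ->
    {ae mu, forall x, O x -> Hjet Om H ((fun x => g x + prim (prim k) x) \+ w) x <= T} ->
    {ae mu, forall x, O x -> Hjet Om H (fun x => g x + prim (prim k) x) x <= T}.
  move=> az mw wz OU h uT; have akz : adm Om (fun x => k x + z x) by exact: admD.
  have ppkz : prim (prim (fun x => k x + z x)) = fun x => prim (prim k) x + prim (prim z) x.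
    have := prim2_lin UL 1 (adm_der2_0 kadm) (adm_der2_0 az).
    by under eq_fun do rewrite mul1r; move=> ->; apply/funext => u; rewrite mul1r.
  have [|_ vH] := Hjet_lag akz (measurable_funD mk mw).
    by apply: (aeS wz) => x e Ox; rewrite ppkz /= e// addrA.
  have hk1 : {ae mu, forall x, O x -> hf lag (fun x => k x + z x) x <= M + T}.
    by apply: (aeS2 uT vH) => x uTx e Ox; rewrite -e ?lerD2l ?uTx//; exact: OU.
  apply: (aeS2 (h hk1) kH) => x hx e Ox.
  by have := hx Ox; rewrite -e ?lerD2l//; exact: OU.
have mres U phi : open U -> W2oo0 U phi -> measurable_fun setT (phi \_ U).
  move=> oUU Wphi; apply/(measurable_restrictT _ _).1; first exact: open_measurable.
  by have [w [[]]] := Wphi.1 0%N isT.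
exists (fun x => g x + prim (prim k) x); split.
- split; first exact: kbd.
  move=> phi Wphi; apply: E_oo_le => T.
  have [z az phiz] := W2oo0_adm L0 UL oU Wphi.
  apply: (cmp phi z Om T az _ phiz (@subset_refl _ Om)).
    by have [w [[]]] := Wphi.1 0%N isT.
  apply: hf_le_pos => // c0; apply: (limit_global L0 UL oU I zsadm p1 poo jk hk zsmin) => //.
  exact: admD.
- exists (fun p x => g x + prim (prim (z_ p)) x); split.
    by move=> p p1'; apply: E_p_almost_minimiser => //; [exact: zadm|exact: zmin|exists K].
  (* The exponents do not depend on q; the moments of order 2 q are bounded once [p_ j] >= 2 q. *)
  move=> q q1; exists p_; split; first exact: p1.
    apply/cvgryPge => B; have [J HJ] := poo B; exists J => // j /=; exact: HJ.
  apply: (sobolev_weak_cvg_hulls L0 UL oU zsadm kadm hk q1) => //.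
  have [Y HY] := nrm1_family L0 UL oU I K1 zK zadm zmin.
  have q20 : 0 <= 2 * q by rewrite mulr_ge0// ltW// (lt_trans ltr01).
  have [D HD] := moment_family L0 UL oU I K1 zK zadm zmin HY q20.
  have [J HJ] := poo (2 * q); exists D, J => j Jj.
  by apply: HD => //; exact: HJ.
- move=> U oUU [_ clU] phi Wphi; apply: E_oo_le => T.
  have UO : U `<=` Om by apply: subset_trans clU; exact: subset_closure.
  have UUL : inball U L by move=> x /UO/UL.
  have [z az phiz] := W2oo0_adm L0 UUL oUU Wphi.
  apply: (cmp (phi \_ U) z U T (admS UO az) _ _ UO).
  + by apply: measurable_funTS; exact: mres.
  + apply: (aeS phiz) => x h _; rewrite patchE; case: ifPn; first by rewrite inE => /h.
    by rewrite notin_setE => Ux; rewrite (der2_0_prim2_eq0 L0 UUL (adm_der2_0 az) Ux).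
  (* Each closed interval inside U lies in one component []al, be[], whose end points are outside U
     and whose closure is in [Om]. *)
  + apply: hf_le_pos => // c0 yc; apply: ae_itv => // a b ab abU.
    have [|al [be [/andP[ala abe] nUa nUb Uab]]] := component oUU UUL (x := a).
      by apply: abU; rewrite /= in_itv/= lexx ltW.
    have bbe : b < be.
      rewrite ltNge; apply/negP => beb; apply: nUb; apply: abU.
      by rewrite /= in_itv/= beb (ltW abe).
    have albe : al < be by exact: lt_trans abe.
    have H1 : {ae mu, forall x, al < x < be -> hf lag k x <= M + T}.
      apply: (limit_local L0 UL oU I zsadm p1 poo IpK kadm jk hk zsmin albe _ UO nUa nUb az c0).
        by apply: subset_trans clU; exact: itvcc_closure.
      by apply: (aeS yc) => x h xab; apply: h; exact: Uab.
    apply: (aeS H1) => x h /andP[ax xb]; apply: h.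
    by rewrite (lt_trans ala ax) (lt_trans xb bbe).
Qed.

End Instance.

(** * Nonempty and empty domains *)

Lemma lebesgue_measure_open_gt0 (R : realType) (U : set R) L x : inball U L -> open U -> U x ->
  0 < fine (lebesgue_measure U).
Proof.
move=> UL oU Ux; have /nbhs_ballP[e /= e0 He] : nbhs x U by exact: open_nbhs_nbhs.
apply: fine_gt0; apply/andP; split; last exact: (measureU_lty UL oU).
apply: (@lt_le_trans _ _ (lebesgue_measure `]x - e, x + e[)).
  have xe : x - e < x + e by rewrite ltrD2l -subr_gt0 opprK addr_gt0.
  by rewrite lebesgue_measure_itv/= lte_fin xe -EFinB lte_fin subr_gt0.
apply: le_measure; rewrite ?inE//; first exact: open_measurable.
by rewrite -ball_itv.
Qed.

(** The main argument divides by the measure of [Om] and needs a positive error. On the empty set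
    all functions have the same energies, and g itself serves. *)
Lemma main_empty (R : realType) (H : R -> R -> R -> R -> R) (M : R) (g : R -> R) :
  W2oo set0 g -> exists u_oo : R -> R,
  [/\ global_minimiser set0 H g u_oo,
      (exists u_ : R -> R -> R,
         (forall p, 1 < p -> approximate_minimiser set0 H M g p (u_ p)) /\
         forall q, 1 < q ->
           exists p_ : nat -> R,
           [/\ forall j, 1 < p_ j,
               p_ j @[j --> \oo] --> +oo &
               sobolev_weak_cvg 2 q%:E set0 (fun j => u_ (p_ j)) u_oo]) &
      absolute_minimiser set0 H u_oo].
Proof.
move=> gW; have UL : inball (set0 : set R) 0 by [].
have o0 : open (set0 : set R) by exact: open0.
have gbd : W2oo_bd set0 g g.
  rewrite /W2oo_bd; have := adm_W2oo0 (lexx 0) UL o0 (adm0 set0).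
  rewrite (_ : prim (prim (fun=> 0)) = g \- g)//; apply/funext => x /=.
  rewrite subrr; exact: (der2_0_prim2_eq0 (lexx 0) UL (adm_der2_0 (adm0 set0)) (x := x)).
have E0 u v : E_oo set0 H u set0 = E_oo set0 H v set0.
  rewrite /E_oo; congr ess_sup; apply/funext => x.
  by rewrite /patch; case: ifPn => //; rewrite inE.
have Ep0 p u : 1 < p -> E_p set0 H M p u set0 = (- M)%:E.
  move=> p1; rewrite /E_p integral_set0 mule0 poweR0r ?add0e// invr_neq0// gt_eqF//.
  exact: lt_trans p1.
exists g; split.
- by split; [exact: gbd|move=> phi _; rewrite (E0 _ g)].
- exists (fun _ => g); split.
    move=> p p1; split; first exact: gbd.
    rewrite (Ep0 p g p1) (_ : [set E_p set0 H M p v set0 | v in _] = [set (- M)%:E]); last first.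
      by apply/seteqP; split => [_ [v _ <-]|_ ->]; [exact: Ep0|exists g; [exact: gbd|exact: Ep0]].
    by rewrite ereal_inf1 -EFinD lee_fin lerDr powR_ge0.
  move=> q q1; exists (fun j => j.+2%:R); split.
  + by move=> j; rewrite ltr1n.
  + apply/cvgryPge => B; exists (Num.truncn B) => // j /= Bj.
    apply: ltW; apply: lt_le_trans (truncnS_gt B) _; rewrite ler_nat ltnS.
    exact: leqW.
  have sg : sobolev 2 q%:E set0 g by exact: (W2oo_sobolev UL o0 (lt_trans ltr01 q1) gW).
  by split; [move=> _; exact: sg|exact: sg|move=> F _ _; exact: cvg_cst].
- move=> U oU [_ clU] phi _.
  have U0 : U = set0 by rewrite -subset0; apply: subset_trans clU; exact: subset_closure.
  by rewrite U0; have := E0 g (g \+ (phi \_ set0)) => ->; exact: lexx.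
Qed.

Theorem theorem3p4 (R : realType) (Om : set R)
  (Om_open : open Om) (Om_bounded : bounded_set (Om : set R^o))
  (Om_lipschitz : lipschitz_boundary Om)
  (H : R -> R -> R -> R -> R)
  (H_continuous : {within [set z : R * R * R * R | Om z.1.1.1],
     continuous (fun z : R * R * R * R => H z.1.1.1 z.1.1.2 z.1.2 z.2)})
  (m M : R) (m_gt0 : 0 < m) (m_lt_M : m < M)
  (H_bounded_below : forall x eta p X, Om x -> - m <= H x eta p X)
  (H_level_convex : forall x eta p t, Om x ->
     convex_set [set X : R^o | H x eta p X <= t])
  (C1 C2 s t : R) (C1_gt0 : 0 < C1) (C2_gt0 : 0 < C2)
  (s_range : 0 <= s < 1) (t_range : 0 <= t < 1)
  (H_coercive : {ae lebesgue_measure, forall x : R, Om x -> forall eta p X,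
     C1 * `|X| - C2 * (1 + `|eta| `^ s + `|p| `^ t) <= H x eta p X})
  (H_modulus : forall r : R, 0 < r ->
     exists (l : R) (omega : R -> R),
     [/\ 1 < l,
         {within `[0, +oo[, continuous omega},
         {in `[0, +oo[ &, {homo omega : a b / a <= b}},
         omega 0 = 0 &
         {ae lebesgue_measure, forall x : R, Om x ->
            forall eta' eta'' p' p'' X,
            - r < eta' < r -> - r < eta'' < r ->
            - r < p' < r -> - r < p'' < r ->
            `|H x eta' p' X - H x eta'' p'' X| <=
              omega (`|eta' - eta''| + `|p' - p''|) * (1 + `|X| `^ l)}])
  (g : R -> R) (g_W2oo : W2oo Om g)
  (* the functional is not identically +oo on the admissible class *)
  (E_oo_proper : exists2 v, W2oo_bd Om g v & (E_oo Om H v Om < +oo)%E) :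
  exists u_oo : R -> R,
  [/\ global_minimiser Om H g u_oo,
      (exists u_ : R -> R -> R,
         (forall p, 1 < p -> approximate_minimiser Om H M g p (u_ p)) /\
         forall q, 1 < q ->
           exists p_ : nat -> R,
           [/\ forall j, 1 < p_ j,
               p_ j @[j --> \oo] --> +oo &
               sobolev_weak_cvg 2 q%:E Om (fun j => u_ (p_ j)) u_oo]) &
      absolute_minimiser Om H u_oo].
Proof.
have [Om0|/set0P[x Ox]] := eqVneq Om set0; first by subst Om; exact: main_empty.
have [L L0 UL] := bounded_inball Om_bounded.
have V0 := lebesgue_measure_open_gt0 UL Om_open Ox.
have M0 : 0 <= M by exact: ltW (lt_trans m_gt0 m_lt_M).
exact: (main_nonempty (ltW L0) UL Om_open H_continuous m_lt_M H_bounded_below H_level_convex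
  M0 C1_gt0 C2_gt0 s_range t_range H_coercive g_W2oo V0 E_oo_proper).
Qed.
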